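(* Let $k \ge 1$. The decision problems $\mathrm{detTILING}(\exp_{k+1}(n), \exp_k(n))$ and $\mathrm{detTILING}( *, \exp_k(n))$ are both $k\mathsf{EXPSPACE}$-complete.
   Context: Define $\exp_0(n) = n$ and $\exp_k(n) = 2^{\exp_{k-1}(n)}$ for $k \ge 1$. $k\mathsf{EXPSPACE}$ is the class of problems decidable by a deterministic Turing machine in space $\exp_k(p(n))$ for some polynomial $p$. Fix a countable set $\mathcal{C}$ of colors containing a distinguished color $\mathit{white}$. A tile type is a 4-tuple $t = \langle \mathit{left}(t), \mathit{top}(t), \mathit{right}(t), \mathit{bottom}(t)\rangle \in \mathcal{C}^4$. For a finite set $T$ of tile types, a $T$-tiling of the $H \times W$ rectangle is a function $\tau : \{1,\dots,H\}\times\{1,\dots,W\} \to T$ such that: (1) $\mathit{left}(\tau(i,1)) = \mathit{right}(\tau(i,W)) = \mathit{white}$ for all $i$; (2) $\mathit{top}(\tau(1,j)) = \mathit{bottom}(\tau(H,j)) = \mathit{white}$ for all $j$; (3) $\mathit{right}(\tau(i,j)) = \mathit{left}(\tau(i,j+1))$ for all $i$ and all $j \le W-1$; (4) $\mathit{bottom}(\tau(i,j)) = \mathit{top}(\tau(i+1,j))$ for all $i \le H-1$ and all $j$. A set $T$ of tile types is deterministic if there is a partition $\mathcal{C} = \mathit{Col} \sqcup \mathit{Col}'$ with $\mathit{white} \in \mathit{Col}$ such that: for every $t \in T$, $\mathit{top}(t) \in \mathit{Col}$ iff $\mathit{bottom}(t) \in \mathit{Col}'$; for all $c \in \mathit{Col}$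 and $c' \in \mathcal{C}$ there is at most one $t \in T$ with $\mathit{left}(t) = c$ and $\mathit{top}(t) = c'$; for all $c \in \mathit{Col}'$ and $c' \in \mathcal{C}$ there is at most one $t \in T$ with $\mathit{right}(t) = c$ and $\mathit{top}(t) = c'$. $\mathrm{detTILING}(h(n), w(n))$: input an integer $n$ in unary, a finite deterministic set $T$ of tile types and a tile $t_0$; answer yes iff there is a $T$-tiling $\tau$ of the $h(n) \times w(n)$ rectangle with $\tau(1,1) = t_0$. $\mathrm{detTILING}( *, w(n))$: same input; answer yes iff there exist an integer $h$ and a $T$-tiling $\tau$ of the $h \times w(n)$ rectangle with $\tau(1,1)=t_0$. *)

(* Defs.v *)
From mathcomp Require Import all_boot.
Set Implicit Arguments. Unset Strict Implicit. Unset Printing Implicit Defensive.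

Fixpoint expk (k n : nat) : nat :=
  match k with 0 => n | k'.+1 => 2 ^ expk k' n end.

Definition peval (cs : seq nat) (n : nat) : nat :=
  foldr (fun c acc => c + n * acc) 0 cs.

(* Deterministic single-tape Turing machines (tape infinite to the   *)
(* right, cells indexed by nat; moving left at cell 0 stays put).    *)
Inductive dir := DL | DR | DS.

Record TM (Gamma : finType) : Type := mkTM {
  tm_state : finType;
  tm_start : tm_state;
  tm_acc   : tm_state;
  tm_rej   : tm_state;
  tm_delta : tm_state -> Gamma -> tm_state * Gamma * dir }.

Record config (Gamma : finType) (M : TM Gamma) : Type := Cfg {
  cf_state : tm_state M;
  cf_tape  : nat -> Gamma;
  cf_head  : nat }.

Definition halted (Gamma : finType) (M : TM Gamma) (c : config M) : bool :=
  (cf_state c == tm_acc M) || (cf_state c == tm_rej M).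

Definition move (h : nat) (d : dir) : nat :=
  match d with DL => h.-1 | DR => h.+1 | DS => h end.

Definition step (Gamma : finType) (M : TM Gamma) (c : config M) : config M :=
  if halted c then c else
  let: (q', a, d) := @tm_delta Gamma M (cf_state c) (cf_tape c (cf_head c)) in
  @Cfg Gamma M q' (fun i => if i == cf_head c then a else cf_tape c i) (move (cf_head c) d).

Definition run (Gamma : finType) (M : TM Gamma) (c : config M) (t : nat) : config M :=
  iter t (@step Gamma M) c.

Definition init (Sigma Gamma : finType) (blank : Gamma) (inj : Sigma -> Gamma)
  (M : TM Gamma) (w : seq Sigma) : config M :=
  @Cfg Gamma M (tm_start M) (fun i => nth blank (map inj w) i) 0.

Definition good_embedding (Sigma Gamma : finType) (blank : Gamma) (inj : Sigma -> Gamma) :=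
  injective inj /\ forall x, inj x != blank.

Definition decides_in_space (Sigma Gamma : finType) (blank : Gamma) (inj : Sigma -> Gamma)
  (M : TM Gamma) (L : seq Sigma -> Prop) (s : nat -> nat) : Prop :=
  forall w : seq Sigma,
    (forall t, cf_head (run (init blank inj M w) t) < s (size w)) /\
    exists t, halted (run (init blank inj M w) t) /\
              (cf_state (run (init blank inj M w) t) = tm_acc M <-> L w).

Definition in_kEXPSPACE (k : nat) (Sigma : finType) (L : seq Sigma -> Prop) : Prop :=
  exists (Gamma : finType) (blank : Gamma) (inj : Sigma -> Gamma) (M : TM Gamma) (p : seq nat),
    good_embedding blank inj /\
    decides_in_space blank inj M L (fun n => expk k (peval p n)).

Definition poly_time_computable (Sigma Sigma' : finType)
  (f : seq Sigma -> seq Sigma') : Prop :=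
  exists (Gamma : finType) (blank : Gamma) (inj : Sigma -> Gamma) (outj : Sigma' -> Gamma)
         (M : TM Gamma) (p : seq nat),
    good_embedding blank inj /\ good_embedding blank outj /\
    forall w, exists t, t <= peval p (size w) /\
      cf_state (run (init blank inj M w) t) = tm_acc M /\
      forall i, i <= size (f w) ->
        cf_tape (run (init blank inj M w) t) i = nth blank (map outj (f w)) i.

Definition poly_reducible (Sigma Sigma' : finType)
  (L : seq Sigma -> Prop) (L' : seq Sigma' -> Prop) : Prop :=
  exists f : seq Sigma -> seq Sigma', poly_time_computable f /\
    forall w, L w <-> L' (f w).

Definition kEXPSPACE_hard (k : nat) (Sigma' : finType) (L' : seq Sigma' -> Prop) : Prop :=
  forall (Sigma : finType) (L : seq Sigma -> Prop),
    in_kEXPSPACE k L -> poly_reducible L L'.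

Definition kEXPSPACE_complete (k : nat) (Sigma' : finType) (L' : seq Sigma' -> Prop) : Prop :=
  in_kEXPSPACE k L' /\ kEXPSPACE_hard k L'.

Definition color := nat.
Definition white : color := 0.
Definition tile := (color * color * color * color)%type.
Definition tleft   (t : tile) : color := t.1.1.1.
Definition ttop    (t : tile) : color := t.1.1.2.
Definition tright  (t : tile) : color := t.1.2.
Definition tbottom (t : tile) : color := t.2.

Definition is_tiling (T : seq tile) (H W : nat) (tau : nat -> nat -> tile) : Prop :=
  (forall i j, 1 <= i <= H -> 1 <= j <= W -> tau i j \in T) /\
  (forall i, 1 <= i <= H -> tleft (tau i 1) = white /\ tright (tau i W) = white) /\
  (forall j, 1 <= j <= W -> ttop (tau 1 j) = white /\ tbottom (tau H j) = white) /\
  (forall i j, 1 <= i <= H -> 1 <= j < W -> tright (tau i j) = tleft (tau i j.+1)) /\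
  (forall i j, 1 <= i < H -> 1 <= j <= W -> tbottom (tau i j) = ttop (tau i.+1 j)).

Definition deterministic (T : seq tile) : Prop :=
  exists Col : pred color,
    Col white /\
    (forall t, t \in T -> (Col (ttop t) <-> ~~ Col (tbottom t))) /\
    (forall c c', Col c -> forall t1 t2, t1 \in T -> t2 \in T ->
       tleft t1 = c -> ttop t1 = c' -> tleft t2 = c -> ttop t2 = c' -> t1 = t2) /\
    (forall c c', ~~ Col c -> forall t1 t2, t1 \in T -> t2 \in T ->
       tright t1 = c -> ttop t1 = c' -> tright t2 = c -> ttop t2 = c' -> t1 = t2).

(* yes-instances; determinism of T is part of a valid instance *)
Definition detTILING (h w : nat -> nat) (n : nat) (T : seq tile) (t0 : tile) : Prop :=
  deterministic T /\ exists tau, is_tiling T (h n) (w n) tau /\ tau 1 1 = t0.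

Definition detTILING_star (w : nat -> nat) (n : nat) (T : seq tile) (t0 : tile) : Prop :=
  deterministic T /\ exists H tau, 0 < H /\ is_tiling T H (w n) tau /\ tau 1 1 = t0.

(* Encoding of instances over the 4-letter alphabet 'I_4:            *)
(*   0,1 = binary digits, 2 = '#', 3 = '|' (unary mark / separator). *)
Definition s_sharp : 'I_4 := inord 2.
Definition s_mark  : 'I_4 := inord 3.

Fixpoint bin_aux (fuel n : nat) : seq 'I_4 :=
  match fuel with
  | 0 => [::]
  | f.+1 => if n < 2 then [:: inord n] else rcons (bin_aux f n./2) (inord (odd n))
  end.
Definition bin (n : nat) : seq 'I_4 := bin_aux n.+1 n.

Definition enc_tile (t : tile) : seq 'I_4 :=
  bin (tleft t) ++ s_mark :: bin (ttop t) ++ s_mark :: bin (tright t) ++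
  s_mark :: bin (tbottom t).

Definition encode (n : nat) (T : seq tile) (t0 : tile) : seq 'I_4 :=
  nseq n s_mark ++ s_sharp :: enc_tile t0 ++ flatten [seq s_sharp :: enc_tile t | t <- T].

Definition lang (P : nat -> seq tile -> tile -> Prop) (x : seq 'I_4) : Prop :=
  exists n T t0, x = encode n T t0 /\ P n T t0.

(* Main.v *)
(* Membership.  A row of width W = exp_k(n) is written as the string of the binary codes of
   its tiles; its length is exp_k of a polynomial in the input size.  A tiling is a path in
   the graph on strings of vertical colours whose edges are the rows with matching horizontal
   colours, so detTILING(exp_(k+1), exp_k) asks for a path of length exactly 2^W and
   detTILING(star, exp_k) for a path of arbitrary length, which may be taken simple.
   Savitch's recursion on the midpoint decides both in space quadratic in the length of a
   row.  It is run by a program on finitely many stacks, which a single-tape machine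
   simulates with all stacks side by side.

   Hardness.  Row i + 1 of the tiling carries the i-th configuration of a machine deciding L,
   the head travelling through the horizontal colours, and the first row spells the input.
   The colours alternate with the parity of the row; left of the head the horizontal colour
   [FZl] lies in Col' and determines the tile together with its right side, right of the head
   white lies in Col and determines it from the left, which makes the tile set
   deterministic.  Only an accepting computation, once its head is back at cell 0, admits a
   last row with white bottoms.  Waiting in the accepting state fills the tiling up to the
   prescribed height, since the halting time is below 2^W.  The column numbers of the first
   row are powers of two, whose binary codes are trivial to write down. *)
From Stdlib Require Import FunctionalExtensionality Classical.
From HB Require Import structures.
Require Import Defs.
From mathcomp Require Import all_boot zify.
Set Implicit Arguments. Unset Strict Implicit. Unset Printing Implicit Defensive.

(** * Stack programs and their simulation by Turing machines *)

(** [decides_in_space] and [poly_time_computable] ask for concrete machines, so every algorithm is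
    assembled from parts whose space, and where required time, is accounted for. Predicates are
    written as formulas with equality, connectives and quantifiers over strings no longer than a
    given string, and the machine is read off the formula. The tower of exponentials enters at one
    place only: the input is paired with a string of [expk k n] letters, after which everything is
    polynomial in the length of the pair. A Boolean [tb] says whether running time is bounded too;
    only then must the number of rounds of a loop be bounded. Membership has to reject strings that
    code no instance and tile sets that are not deterministic, so the partition of the colours is
    itself searched for, as a list of the colours in Col. In the reduction, determinism clashes with
    the white left border, which lies in Col although the cells left of the head need a colour in
    Col'. An extra first column turns one into the other; its own colours alternate, which forces an
    even height. *)

Section StackPrograms.
Variable A : finType.

Definition store := nat -> seq A.

Definition upd (s : store) (r : nat) (v : seq A) : store :=
  fun i => if i == r then v else s i.

Inductive cmd :=
| Skip
| Push of nat & A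
| Pop of nat
| Then of cmd & cmd
| If of nat & pred (option A) & cmd & cmd
| While of nat & pred (option A) & cmd.

(* [exec M c s t s']: [c] leads from [s] to [s'] in [t] instructions and never
   pushes on a stack of height [M] or more. *)
Inductive exec (M : nat) : cmd -> store -> nat -> store -> Prop :=
| ESkip s : exec M Skip s 0 s
| EPush r a s : size (s r) < M -> exec M (Push r a) s 1 (upd s r (a :: s r))
| EPop r s : exec M (Pop r) s 1 (upd s r (behead (s r)))
| EThen c1 c2 s1 s2 s3 t1 t2 :
    exec M c1 s1 t1 s2 -> exec M c2 s2 t2 s3 -> exec M (Then c1 c2) s1 (t1 + t2) s3
| EIfT r (p : pred (option A)) c1 c2 s s' t : p (ohead (s r)) -> exec M c1 s t s' ->
    exec M (If r p c1 c2) s t.+2 s'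
| EIfF r (p : pred (option A)) c1 c2 s s' t : ~~ p (ohead (s r)) -> exec M c2 s t s' ->
    exec M (If r p c1 c2) s t.+1 s'
| EWhileF r (p : pred (option A)) c s : ~~ p (ohead (s r)) -> exec M (While r p c) s 1 s
| EWhileT r (p : pred (option A)) c s1 s2 s3 t1 t2 : p (ohead (s1 r)) ->
    exec M c s1 t1 s2 -> exec M (While r p c) s2 t2 s3 ->
    exec M (While r p c) s1 (t1 + t2).+2 s3.

Inductive instr :=
| IPush of nat & A
| IPop of nat
| IBr of nat & pred (option A) & nat.

Definition ireg i := match i with IPush r _ => r | IPop r => r | IBr r _ _ => r end.

(** [b] is the address of the first instruction. A branch falls through when its test succeeds and
    jumps otherwise, so a branch on [xpred0] is an unconditional jump. *)
Fixpoint compile (b : nat) (c : cmd) : seq instr :=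
  match c with
  | Skip => [::]
  | Push r a => [:: IPush r a]
  | Pop r => [:: IPop r]
  | Then c1 c2 => let k1 := compile b c1 in k1 ++ compile (b + size k1) c2
  | If r p c1 c2 =>
      let k1 := compile b.+1 c1 in
      let k2 := compile (b + size k1).+2 c2 in
      IBr r p (b + size k1).+2 :: k1 ++ IBr 0 xpred0 ((b + size k1).+2 + size k2) :: k2
  | While r p c1 =>
      let k1 := compile b.+1 c1 in
      IBr r p (b + size k1).+2 :: k1 ++ [:: IBr 0 xpred0 b]
  end.

Fixpoint maxreg (c : cmd) : nat :=
  match c with
  | Skip => 0
  | Push r _ | Pop r => r
  | Then c1 c2 => maxn (maxreg c1) (maxreg c2)
  | If r _ c1 c2 => maxn r (maxn (maxreg c1) (maxreg c2))
  | While r _ c1 => maxn r (maxreg c1)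
  end.

Definition iok R N i :=
  (ireg i <= R) && (if i is IBr _ _ tgt then tgt <= N else true).

Lemma compile_ok R N b c : maxreg c <= R -> b + size (compile b c) <= N ->
  all (iok R N) (compile b c).
Proof.
rewrite /iok; elim: c b => [|r a|r|c1 IH1 c2 IH2|r p c1 IH1 c2 IH2|r p c1 IH1] b //=.
- by move=> ->.
- by move=> ->.
- rewrite geq_max size_cat => /andP[h1 h2] h; rewrite all_cat IH1 ?IH2 //; lia.
- rewrite !geq_max size_cat /= => /and3P[h1 h2 h3] h.
  rewrite all_cat /= IH1 ?IH2 //; lia.
- rewrite !geq_max size_cat /= => /andP[h1 h2] h.
  rewrite all_cat /= IH1 //; lia.
Qed.

Definition inext (i : instr) (pc : nat) (s : store) : nat * store :=
  match i with
  | IPush r a => (pc.+1, upd s r (a :: s r))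
  | IPop r => (pc.+1, upd s r (behead (s r)))
  | IBr r p tgt => (if p (ohead (s r)) then pc.+1 else tgt, s)
  end.

Definition fits M (i : instr) (s : store) : Prop :=
  if i is IPush r _ then size (s r) < M else True.

Inductive crun (M : nat) (K : seq instr) : nat -> store -> nat -> nat -> store -> Prop :=
| Crun0 pc s : crun M K pc s 0 pc s
| CrunS pc s i t pc' s' : onth K pc = Some i -> fits M i s ->
    crun M K (inext i pc s).1 (inext i pc s).2 t pc' s' -> crun M K pc s t.+1 pc' s'.

Lemma crun_trans M K pc1 s1 t1 pc2 s2 t2 pc3 s3 :
  crun M K pc1 s1 t1 pc2 s2 -> crun M K pc2 s2 t2 pc3 s3 ->
  crun M K pc1 s1 (t1 + t2) pc3 s3.
Proof.
elim=> // pc s i t pc' s' hi hf _ IH h; rewrite addSn.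
by apply: CrunS hi hf _; apply: IH.
Qed.

Lemma onth_mid (T : Type) (K1 K2 : seq T) i : onth (K1 ++ i :: K2) (size K1) = Some i.
Proof. by elim: K1. Qed.

(** Jump targets are absolute and depend on [size K1]; placing the code between arbitrary [K1] and
    [K2] is the generality that the induction needs for subprograms. *)
Lemma compile_correct M c s t s' : exec M c s t s' ->
  forall K1 K2, crun M (K1 ++ compile (size K1) c ++ K2) (size K1) s t
    (size K1 + size (compile (size K1) c)) s'.
Proof.
elim=> {c s t s'}.
- by move=> s K1 K2 /=; rewrite addn0; apply: Crun0.
- move=> r a s h K1 K2 /=; rewrite addn1.
  by apply: (CrunS (onth_mid _ _ _)) => //=; apply: Crun0.
- move=> r s K1 K2 /=; rewrite addn1.
  by apply: (CrunS (onth_mid _ _ _)) => //=; apply: Crun0.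
- move=> c1 c2 s1 s2 s3 t1 t2 _ IH1 _ IH2 K1 K2 /=; rewrite size_cat addnA -catA.
  apply: (crun_trans (IH1 _ _)).
  have := IH2 (K1 ++ compile (size K1) c1) K2.
  by rewrite size_cat -catA.
- move=> r p c1 c2 s s' t hp _ IH K1 K2 /=.
  apply: (CrunS (onth_mid _ _ _)) => //=; rewrite hp.
  set k1 := compile _ c1; set k2 := compile _ c2; set i1 := IBr r p _; set i2 := IBr 0 _ _.
  have := IH (rcons K1 i1) (i2 :: k2 ++ K2).
  rewrite size_rcons -/k1 cat_rcons -!catA /= => h.
  rewrite -[t.+1]addn1; apply: (crun_trans h).
  apply: CrunS (_ : onth _ _ = Some i2) _ _ => //.
    have -> : (size K1).+1 + size k1 = size (K1 ++ i1 :: k1) by rewrite size_cat /=; lia.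
    by rewrite (_ : K1 ++ _ = (K1 ++ i1 :: k1) ++ i2 :: k2 ++ K2) ?onth_mid // -!catA.
  rewrite /= size_cat /=.
  rewrite (_ : (size K1 + size k1).+2 + size k2 =
    size K1 + (size k1 + (size k2).+1).+1); [exact: Crun0|lia].
- move=> r p c1 c2 s s' t hp _ IH K1 K2 /=.
  apply: (CrunS (onth_mid _ _ _)) => //=; rewrite (negbTE hp).
  set k1 := compile _ c1; set i1 := IBr r p _; set i2 := IBr 0 _ _.
  have := IH (K1 ++ i1 :: k1 ++ [:: i2]) K2.
  have -> : size (K1 ++ i1 :: k1 ++ [:: i2]) = (size K1 + size k1).+2.
    by rewrite size_cat /= size_cat /=; lia.
  rewrite -!catA /= -!catA /=.
  have -> : (size K1 + size k1).+2 + size (compile (size K1 + size k1).+2 c2) =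
    size K1 + (size (k1 ++ i2 :: compile (size K1 + size k1).+2 c2)).+1.
    by rewrite size_cat /=; lia.
  by [].
- move=> r p c s hp K1 K2 /=.
  apply: (CrunS (onth_mid _ _ _)) => //=; rewrite (negbTE hp) size_cat /=.
  set k1 := compile _ c.
  by rewrite (_ : (size K1 + size k1).+2 = size K1 + (size k1 + 1).+1); [exact: Crun0|lia].
- move=> r p c s1 s2 s3 t1 t2 hp _ IH1 _ IH2 K1 K2.
  move: (IH2 K1 K2) => {IH2} /=.
  set k1 := compile _ c; set i1 := IBr r p _; set i2 := IBr 0 _ _.
  rewrite -!catA /= => IH2.
  apply: (CrunS (onth_mid _ _ _)) => //=; rewrite hp.
  have := IH1 (rcons K1 i1) (i2 :: K2).
  rewrite size_rcons -/k1 cat_rcons /= => h.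
  rewrite -addnS; apply: (crun_trans h).
  apply: CrunS (_ : onth _ _ = Some i2) _ _ => //.
  have -> : (size K1).+1 + size k1 = size (K1 ++ i1 :: k1) by rewrite size_cat /=; lia.
  by rewrite (_ : K1 ++ _ = (K1 ++ i1 :: k1) ++ i2 :: K2) ?onth_mid // -!catA.
Qed.

End StackPrograms.

Arguments Skip {A}.
Arguments Pop {A} _.

(** * Runs of a Turing machine with bounded head position *)

Section Reach.
Variables (Gamma : finType) (M : TM Gamma).

Definition reach (S : nat) (c : config M) (t : nat) (c' : config M) : Prop :=
  run c t = c' /\ forall t', t' <= t -> cf_head (run c t') <= S.

Lemma run_add (c : config M) t1 t2 : run c (t1 + t2) = run (run c t1) t2.
Proof. by rewrite /run addnC iterD. Qed.

Lemma reach_trans S c1 t1 c2 t2 c3 :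
  reach S c1 t1 c2 -> reach S c2 t2 c3 -> reach S c1 (t1 + t2) c3.
Proof.
move=> [h1 b1] [h2 b2]; split=> [|t' ht]; first by rewrite run_add h1.
case: (leqP t' t1) => h; first exact: b1.
by rewrite -(subnKC (ltnW h)) run_add h1; apply: b2; lia.
Qed.

Lemma reach0 S c : cf_head c <= S -> reach S c 0 c.
Proof. by split=> // -[]. Qed.

Lemma reach1 S c c' : step c = c' -> cf_head c <= S -> cf_head c' <= S -> reach S c 1 c'.
Proof. by move=> h1 h2 h3; split=> [|[|[|]]] //=; rewrite /run /= h1. Qed.

Lemma run_halted (c : config M) t : halted c -> run c t = c.
Proof. by move=> h; elim: t => //= t ->; rewrite /step h. Qed.

End Reach.

(** An instruction starts at cell 0 in [PAt]; [PSeek] runs right to the first free cell on the track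
    of the register, [PBack] stands one cell to its left on the top letter, [PRet] returns to the
    marked cell. [PInit] sets the mark on cell 0. *)
Inductive phase := PInit | PAt | PSeek | PBack | PRet.

Definition phase_code (p : phase) : 'I_5 :=
  inord (match p with PInit => 0 | PAt => 1 | PSeek => 2 | PBack => 3 | PRet => 4 end).
Definition phase_decode (i : 'I_5) : phase :=
  match val i with 0 => PInit | 1 => PAt | 2 => PSeek | 3 => PBack | _ => PRet end.
Lemma phase_codeK : cancel phase_code phase_decode.
Proof. by case; rewrite /phase_decode /phase_code /= inordK. Qed.
HB.instance Definition _ := Finite.copy phase (can_type phase_codeK).

Section Simulation.
Variables (A : finType) (K : seq (instr A)) (R : nat).
Hypothesis hK : all (iok R (size K)) K.

Definition column := {ffun 'I_R.+1 -> option A}.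
Variable acc : column -> bool.

(* A cell carries one letter of every stack; the boolean marks cell 0. *)
Definition letter : finType := (bool * column)%type.

Definition sim_state : finType := (phase * 'I_(size K).+1 + bool)%type.

Definition set_col (x : column) (r : nat) (v : option A) : column :=
  [ffun i : 'I_R.+1 => if i == r :> nat then v else x i].

(** A program counter past the end halts with the verdict [acc] on the bottom letters of all stacks.
    The mark is erased then, so that the final tape carries the stacks and nothing else, as the
    output of a reduction requires. *)
Definition sim_delta (q : sim_state) (x : letter) : sim_state * letter * dir :=
  match q with
  | inr b => (q, x, DS)
  | inl (ph, pc) =>
    match onth K pc, ph with
    | _, PInit => (inl (PAt, pc), (true, x.2), DS)
    | _, PRet => if x.1 then (inl (PAt, pc), x, DS) else (inl (PRet, pc), x, DL)
    | None, _ => (inr (acc x.2), (false, x.2), DS)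
    | Some i, PAt => (inl (PSeek, pc), x, DS)
    | Some i, PSeek =>
      if x.2 (inord (ireg i)) is Some _ then (inl (PSeek, pc), x, DR) else
      match i with
      | IPush r a => (inl (PRet, inord pc.+1), (x.1, set_col x.2 r (Some a)), DS)
      | IPop r => if x.1 then (inl (PRet, inord pc.+1), x, DS) else (inl (PBack, pc), x, DL)
      | IBr r p tgt => if x.1 then (inl (PRet, inord (if p None then pc.+1 else tgt)), x, DS)
                       else (inl (PBack, pc), x, DL)
      end
    | Some i, PBack =>
      match i with
      | IPush r a => (q, x, DS)
      | IPop r => (inl (PRet, inord pc.+1), (x.1, set_col x.2 r None), DS)
      | IBr r p tgt => (inl (PRet, inord (if p (x.2 (inord r)) then pc.+1 else tgt)), x, DS)
      end
    end
  end.

Definition sim_tm : TM letter :=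
  @mkTM letter sim_state (inl (PInit, ord0)) (inr true) (inr false) sim_delta.

(** Bottoms are aligned at cell 0, whence the [rev]: the top of a stack, the head of the list, is
    the last letter on its track. *)
Definition tape_of (mk : bool) (s : store A) : nat -> letter :=
  fun i => (mk && (i == 0), [ffun r : 'I_R.+1 => onth (rev (s r)) i]).

Definition sim_cfg ph (pc : nat) mk (s : store A) h : config sim_tm :=
  @Cfg letter sim_tm (inl (ph, inord pc)) (tape_of mk s) h.

Definition bounded M (s : store A) := forall i, size (s i) <= M.

Lemma onth_rcons (T : Type) (l : seq T) (x : T) j :
  onth (rcons l x) j = if j == size l then Some x else onth l j.
Proof. by elim: l j => [|y l IH] [|j] //=; rewrite ?onth0n // IH eqSS. Qed.

Lemma write_same (T : Type) (f : nat -> T) h : (fun i => if i == h then f h else f i) = f.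
Proof. by apply: functional_extensionality => i; case: eqP => [->|]. Qed.

Lemma write_push mk (s : store A) (r : nat) a :
  (fun i => if i == size (s r) then
     ((tape_of mk s (size (s r))).1, set_col (tape_of mk s (size (s r))).2 r (Some a))
     else tape_of mk s i) = tape_of mk (upd s r (a :: s r)).
Proof.
apply: functional_extensionality => i; rewrite /tape_of /=.
case: eqP => [->|ni]; congr pair; apply/ffunP => j; rewrite !ffunE /upd.
  by case: (nat_of_ord j == r) => //; rewrite rev_cons onth_rcons size_rev eqxx.
by case: (_ =P r) => [->|_] //; rewrite rev_cons onth_rcons size_rev; case: eqP.
Qed.

Lemma write_pop mk (s : store A) (r : nat) h : size (s r) = h.+1 ->
  (fun i => if i == h then ((tape_of mk s h).1, set_col (tape_of mk s h).2 r None)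
     else tape_of mk s i) = tape_of mk (upd s r (behead (s r))).
Proof.
move=> hs; apply: functional_extensionality => i; rewrite /tape_of /=.
case: eqP => [->|ni]; congr pair; apply/ffunP => j; rewrite !ffunE /upd.
  by case: (nat_of_ord j == r) => //; rewrite onth_default // size_rev size_behead hs.
case: (_ =P r) => [->|_] //; case: (s r) hs => //= a l [hl].
by rewrite rev_cons onth_rcons size_rev hl; case: eqP.
Qed.

Lemma tape_track (s : store A) (r : nat) h : r <= R ->
  [ffun r' : 'I_R.+1 => onth (rev (s r')) h] (inord r) = onth (rev (s r)) h.
Proof. by move=> hr; rewrite ffunE inordK. Qed.

Lemma top_letter (s : store A) r h : size (s r) = h.+1 -> onth (rev (s r)) h = ohead (s r).
Proof.
by case: (s r) => //= a l [hl]; rewrite rev_cons onth_rcons size_rev hl eqxx.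
Qed.

Lemma inord_pc pc i : onth K pc = Some i -> (inord pc : 'I_(size K).+1) = pc :> nat.
Proof. by move=> h; rewrite inordK // ltnS ltnW // -onthTE h. Qed.

Lemma onth_iok pc i : onth K pc = Some i -> iok R (size K) i.
Proof.
move=> h; have /(all_nthP i) := hK; have hp : pc < size K by rewrite -onthTE h.
by move/(_ _ hp); rewrite (onth_nth _ _ _ _ h).
Qed.

Lemma not_halted ph pc mk s h : halted (sim_cfg ph pc mk s h) = false.
Proof. by []. Qed.

Lemma sim_seek M i pc s h : onth K pc = Some i -> bounded M s -> h <= size (s (ireg i)) ->
  reach M (sim_cfg PSeek pc true s h) (size (s (ireg i)) - h)
    (sim_cfg PSeek pc true s (size (s (ireg i)))).
Proof.
move=> hi hb; move: {2}(size (s (ireg i)) - h) (erefl (size (s (ireg i)) - h)) => n.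
have /andP[hr _] := onth_iok hi.
elim: n h => [|n IH] h hn hh.
  have -> : h = size (s (ireg i)) by lia.
  by rewrite subnn; apply: reach0; exact: (hb (ireg i)).
have hb1 := hb (ireg i).
have -> : size (s (ireg i)) - h = 1 + (size (s (ireg i)) - h.+1) by lia.
apply: reach_trans (IH h.+1 _ _) => //; try lia.
apply: reach1 => /=; try lia.
rewrite /step not_halted /= (inord_pc hi) hi tape_track //.
have : onth (rev (s (ireg i))) h by rewrite onthTE size_rev; lia.
by case: onth => //= a _; rewrite write_same.
Qed.

Lemma sim_ret M pc s h : h <= M ->
  reach M (sim_cfg PRet pc true s h) h.+1 (sim_cfg PAt pc true s 0).
Proof.
elim: h => [|h IH] hM.
  by apply: reach1 => //; rewrite /step not_halted /=; case: onth => [?|]; rewrite write_same.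
rewrite -[h.+2]add1n; apply: reach_trans (IH _); try lia.
by apply: reach1 => /=; try lia; rewrite /step not_halted /=; case: onth => [?|]; rewrite write_same.
Qed.

(** The cost is a walk to the end of a track of length at most [M] and back, plus a constant number
    of turns. *)
Lemma sim_instr M i pc s : onth K pc = Some i -> bounded M s -> fits M i s ->
  exists2 t, t <= 2 * M + 4 &
  reach M (sim_cfg PAt pc true s 0) t
    (sim_cfg PAt (inext i pc s).1 true (inext i pc s).2 0).
Proof.
move=> hi hb hf; have /andP[hr ht] := onth_iok hi.
have hb1 := hb (ireg i); have hpc := inord_pc hi.
have h1 : reach M (sim_cfg PAt pc true s 0) 1 (sim_cfg PSeek pc true s 0).
  by apply: reach1 => //; rewrite /step not_halted /= hpc hi write_same.
have h2 := reach_trans h1 (sim_seek hi hb (leq0n _)).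
rewrite subn0 in h2.
have hend : onth (rev (s (ireg i))) (size (s (ireg i))) = None by rewrite onth_default ?size_rev.
have hstep : step (sim_cfg PSeek pc true s (size (s (ireg i)))) =
   match i with
   | IPush r a => sim_cfg PRet pc.+1 true (upd s r (a :: s r)) (size (s r))
   | IPop r => if s r is [::] then sim_cfg PRet pc.+1 true s 0
               else sim_cfg PBack pc true s (size (s r)).-1
   | IBr r p tgt => if s r is [::] then sim_cfg PRet (if p None then pc.+1 else tgt) true s 0
               else sim_cfg PBack pc true s (size (s r)).-1
   end.
  rewrite /step not_halted /= hpc hi tape_track // hend.
  case: i hr {hf ht hb1 hend h1 h2 hi} => [r a|r|r p tgt] hr /=.
  - by rewrite write_push.
  - by case: (s r) => [|b l] /=; rewrite write_same.
  - by case: (s r) => [|b l] /=; rewrite write_same.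
have hn : inext i pc s = match i with
   | IPush r a => (pc.+1, upd s r (a :: s r))
   | IPop r => (pc.+1, upd s r (behead (s r)))
   | IBr r p tgt => (if p (ohead (s r)) then pc.+1 else tgt, s)
  end by case: (i).
rewrite hn; case: i hi hf hr ht hb1 hend h2 hstep {hn} => [r a|r|r p tgt] hi hf hr ht hb1 hend h2 hstep.
- exists (1 + size (s r) + 1 + (size (s r)).+1); first by move: hf hb1 => /=; lia.
  apply: reach_trans (sim_ret _ _ _) => //.
  by apply: reach_trans h2 (reach1 hstep _ _).
- case hs: (s r) h2 hstep hend hb1 => [|b l] /= h2 hstep hend hb1.
    exists (1 + 0 + 1 + 1); first by lia.
    rewrite (_ : upd s r [::] = s); last first.
      by apply: functional_extensionality => j; rewrite /upd; case: eqP => // ->.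
    apply: reach_trans (sim_ret _ _ _) => //.
    by apply: reach_trans h2 (reach1 hstep _ _).
  exists (1 + (size l).+1 + 1 + 1 + (size l).+1); first by lia.
  apply: reach_trans (sim_ret _ _ _); last by lia.
  apply: (reach_trans (reach_trans h2 (reach1 hstep _ _))) => //=; first by lia.
  apply: reach1 => /=; try lia.
  rewrite /step not_halted /= hpc hi /sim_cfg; congr Cfg.
  have hsz : size (s r) = (size l).+1 by rewrite hs.
  by rewrite (write_pop _ hsz) hs.
- case hs: (s r) h2 hstep hend hb1 => [|b l] /= h2 hstep hend hb1.
    exists (1 + 0 + 1 + 1); first by lia.
    apply: reach_trans (sim_ret _ _ _) => //.
    by apply: reach_trans h2 (reach1 hstep _ _).
  exists (1 + (size l).+1 + 1 + 1 + (size l).+1); first by lia.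
  apply: reach_trans (sim_ret _ _ _); last by lia.
  apply: (reach_trans (reach_trans h2 (reach1 hstep _ _))) => //=; first by lia.
  apply: reach1 => /=; try lia.
  have hsz : size (s r) = (size l).+1 by rewrite hs.
  by rewrite /step not_halted /= hpc hi tape_track // (top_letter hsz) hs /= write_same.
Qed.

Lemma bounded_upd M s r v : bounded M s -> size v <= M -> bounded M (upd s r v).
Proof. by move=> h hv i; rewrite /upd; case: eqP. Qed.

Lemma bounded_next M i pc s : bounded M s -> fits M i s -> bounded M (inext i pc s).2.
Proof.
case: i => [r a|r|r p tgt] hb hf //=; apply: bounded_upd => //.
by rewrite size_behead; have := hb r; lia.
Qed.

Lemma sim_crun M pc s n pc' s' : crun M K pc s n pc' s' -> bounded M s ->
  exists2 t, t <= n * (2 * M + 4) &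
  reach M (sim_cfg PAt pc true s 0) t (sim_cfg PAt pc' true s' 0).
Proof.
elim=> {pc s n pc' s'} [pc s|pc s i n pc' s' hi hf _ IH] hb.
  by exists 0 => //; apply: reach0.
have [t ht r] := IH (bounded_next pc hb hf).
have [t1 ht1 r1] := sim_instr hi hb hf.
by exists (t1 + t); [rewrite mulSn; lia|exact: reach_trans r1 r].
Qed.

Lemma sim_run M s n s' : crun M K 0 s n (size K) s' -> bounded M s ->
  exists2 t, t <= n * (2 * M + 4) + 2 &
  reach M (sim_cfg PInit 0 false s 0) t
    (@Cfg letter sim_tm (inr (acc [ffun r => onth (rev (s' (val r))) 0]))
       (tape_of false s') 0).
Proof.
move=> hr hb; have [t ht r] := sim_crun hr hb.
exists (1 + t + 1); first by lia.
apply: (@reach_trans _ _ _ _ _ (sim_cfg PAt (size K) true s' 0)); last first.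
  apply: reach1 => //; rewrite /step not_halted /= inordK // onth_default //=.
  congr Cfg; apply: functional_extensionality => i; rewrite /tape_of.
  by case: eqP => [->|] //; congr pair; rewrite andbF.
apply: reach_trans r; apply: reach1 => //.
rewrite /step not_halted /=; case: onth => [?|];
  by congr Cfg; apply: functional_extensionality => i; rewrite /tape_of; case: eqP => // ->.
Qed.

End Simulation.

Section CmdTM.
Variables (A Sigma : finType) (g : Sigma -> A).
Hypothesis g_inj : injective g.
Variable (c : cmd A).
Let R := maxreg c.
Variable acc : column A R -> bool.

Definition cmd_tm : TM (letter A R) := sim_tm (compile 0 c) acc.

Definition letter_of (a : option A) : letter A R :=
  (false, [ffun r : 'I_R.+1 => if r == 0 :> nat then a else None]).

Lemma letter_of_embedding : good_embedding (letter_of None) (fun x => letter_of (Some (g x))).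
Proof.
split=> [x y|x].
  by case=> /ffunP /(_ ord0); rewrite !ffunE /= => -[] /g_inj.
by apply/eqP=> -[] /ffunP /(_ ord0); rewrite !ffunE.
Qed.

(** Reversed, because the first input letter lies in cell 0 and hence at the bottom of stack 0. *)
Definition input_store (w : seq A) : store A := upd (fun _ => [::]) 0 (rev w).

Lemma init_tape (w : seq Sigma) :
  (fun i => nth (letter_of None) (map (fun x => letter_of (Some (g x))) w) i) =
  tape_of R false (input_store (map g w)).
Proof.
apply: functional_extensionality => i; rewrite /tape_of /input_store /upd.
have -> : [seq letter_of (Some (g x)) | x <- w] = [seq letter_of a | a <- [seq Some (g x) | x <- w]].
  by rewrite -map_comp.
rewrite -(_ : letter_of (nth None [seq Some (g x) | x <- w] i) =
   nth (letter_of None) [seq letter_of a | a <- [seq Some (g x) | x <- w]] i); last first.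
  case: (ltnP i (size [seq Some (g x) | x <- w])) => h; first by rewrite (nth_map None).
  by rewrite !nth_default // size_map.
congr pair; apply/ffunP => r; rewrite !ffunE; case: eqP => _; last by rewrite onth_default.
by rewrite revK onthE -map_comp.
Qed.

Lemma cmd_tm_run M (w : seq Sigma) n s' :
  exec M c (input_store (map g w)) n s' -> size w <= M ->
  exists2 t, t <= n * (2 * M + 4) + 2 &
  reach M (init (letter_of None) (fun x => letter_of (Some (g x))) cmd_tm w) t
    (@Cfg _ cmd_tm (inr (acc [ffun r => onth (rev (s' (val r))) 0])) (tape_of R false s') 0).
Proof.
move=> he hw.
have hb : bounded M (input_store (map g w)).
  by move=> i; rewrite /input_store /upd; case: eqP => // _; rewrite size_rev size_map.
have hok : all (iok R (size (compile 0 c))) (compile 0 c) by apply: compile_ok.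
have := compile_correct he [::] [::]; rewrite /= add0n cats0 => hc.
have [t ht r] := sim_run hok acc hc hb; exists t => //.
move: r; rewrite /init init_tape /sim_cfg.
by rewrite (_ : inord 0 = ord0 :> 'I_(size (compile 0 c)).+1) //; apply: val_inj; rewrite /= inordK.
Qed.

End CmdTM.

(** * Basic routines on stacks, with optional time bounds *)

Section Macros.
Variable A : finType.
Variable tb : bool.
Implicit Types (s : store A) (r : nat).

(** The time bound is asserted only when [tb] holds: the searches behind the space bounds run too
    long for polynomial timing, whereas the push limit [M] is respected in both modes. *)
Definition execb M (c : cmd A) s T s' := exists2 t, (tb -> t <= T) & exec M c s t s'.

Lemma execb_weak M c s T T' s' : execb M c s T s' -> T <= T' -> execb M c s T' s'.
Proof. by move=> [t h1 h2] hT; exists t => // /h1; lia. Qed.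

Lemma execb_then M c1 c2 s1 s2 s3 T1 T2 :
  execb M c1 s1 T1 s2 -> execb M c2 s2 T2 s3 -> execb M (Then c1 c2) s1 (T1 + T2) s3.
Proof.
move=> [t1 h1 e1] [t2 h2 e2]; exists (t1 + t2); last exact: EThen e1 e2.
by move=> htb; have := h1 htb; have := h2 htb; lia.
Qed.

Lemma execb_ifT M r (p : pred (option A)) c1 c2 s s' T : p (ohead (s r)) ->
  execb M c1 s T s' -> execb M (If r p c1 c2) s T.+2 s'.
Proof. by move=> hp [t h e]; exists t.+2 => //; exact: EIfT hp e. Qed.

Lemma execb_ifF M r (p : pred (option A)) c1 c2 s s' T : ~~ p (ohead (s r)) ->
  execb M c2 s T s' -> execb M (If r p c1 c2) s T.+1 s'.
Proof. by move=> hp [t h e]; exists t.+1 => //; exact: EIfF hp e. Qed.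

Lemma execb_whileF M r (p : pred (option A)) c s : ~~ p (ohead (s r)) ->
  execb M (While r p c) s 1 s.
Proof. by move=> hp; exists 1 => //; exact: EWhileF. Qed.

Lemma execb_whileT M r (p : pred (option A)) c s1 s2 s3 T1 T2 : p (ohead (s1 r)) ->
  execb M c s1 T1 s2 -> execb M (While r p c) s2 T2 s3 ->
  execb M (While r p c) s1 (T1 + T2).+2 s3.
Proof.
move=> hp [t1 h1 e1] [t2 h2 e2]; exists (t1 + t2).+2; last exact: EWhileT hp e1 e2.
by move=> htb; have := h1 htb; have := h2 htb; lia.
Qed.

Lemma execb_push M r a s : size (s r) < M -> execb M (Push r a) s 1 (upd s r (a :: s r)).
Proof. by move=> h; exists 1 => //; exact: EPush. Qed.

Lemma execb_pop M r s : execb M (Pop r) s 1 (upd s r (behead (s r))).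
Proof. by exists 1 => //; exact: EPop. Qed.

Lemma execb_skip M s : execb M (Skip) s 0 s.
Proof. by exists 0 => //; exact: ESkip. Qed.

Lemma upd_same s r v : upd s r v r = v.
Proof. by rewrite /upd eqxx. Qed.

Lemma upd_other s r v i : i != r -> upd s r v i = s i.
Proof. by rewrite /upd => /negbTE ->. Qed.

Lemma upd_upd s r v w : upd (upd s r v) r w = upd s r w.
Proof. by apply: functional_extensionality => i; rewrite /upd; case: eqP. Qed.

Lemma upd_comm s r r' v w : r != r' -> upd (upd s r v) r' w = upd (upd s r' w) r v.
Proof.
move=> h; apply: functional_extensionality => i; rewrite /upd.
by case: eqP => // ->; rewrite eq_sym (negbTE h).
Qed.

Lemma upd_id s r v : s r = v -> upd s r v = s.
Proof.
by move=> h; apply: functional_extensionality => i; rewrite /upd; case: eqP => // ->.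
Qed.

Definition nonempty : pred (option A) := isSome.

Definition clear r := While r nonempty (Pop r).

Lemma execb_clear M r s : execb M (clear r) s (3 * size (s r) + 1) (upd s r [::]).
Proof.
move: {2}(s r) (erefl (s r)) => l; elim: l s => [|a l IH] s hl.
  by rewrite hl upd_id //; apply: execb_whileF; rewrite hl.
have := IH (upd s r (behead (s r))); rewrite upd_same upd_upd hl /= => /(_ erefl) h.
apply: execb_weak (execb_whileT _ (execb_pop _ _ _) _) _; try by rewrite hl.
- by rewrite hl; exact: h.
- by rewrite /=; lia.
Qed.

Definition nletters := size (enum A).

(** Tests can only branch, so the top letter is brought into the control by a cascade of tests over
    the whole alphabet. *)
Definition dispatch (r : nat) (k : A -> cmd A) : cmd A :=
  foldr (fun a c => If r (pred1 (Some a)) (k a) c) Skip (enum A).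

Lemma execb_dispatch M r k s a l T s' : s r = a :: l -> execb M (k a) s T s' ->
  execb M (dispatch r k) s (T + nletters + 1) s'.
Proof.
rewrite /dispatch /nletters => hs he; have : a \in enum A by rewrite mem_enum.
elim: (enum A) => //= b e IH; case: (b =P a) => [->|/eqP hb].
  by move=> _; apply: execb_weak (execb_ifT _ _ he) _; rewrite ?hs //=; lia.
rewrite inE eq_sym (negbTE hb) /= => /IH h.
apply: execb_weak (execb_ifF _ _ h) _; last by lia.
by rewrite hs /= (inj_eq Some_inj) eq_sym hb.
Qed.

Definition movrev r r' := While r nonempty (dispatch r (fun a => Then (Pop r) (Push r' a))).

Definition unit_cost := 3 * nletters + 12.

Lemma execb_movrev M r r' s : r != r' -> size (s r) + size (s r') <= M ->
  execb M (movrev r r') s (unit_cost * (size (s r)).+1)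
    (upd (upd s r' (catrev (s r) (s r'))) r [::]).
Proof.
move=> hr; move: {2}(s r) (erefl (s r)) => l; elim: l s => [|a l IH] s hl.
  rewrite hl /= => _; rewrite (upd_id (s := s)) // upd_id //.
  by apply: execb_weak (execb_whileF _ _ _) _; rewrite ?hl // /unit_cost; lia.
rewrite hl /= => hM.
have := IH (upd (upd s r l) r' (a :: s r')).
rewrite !(upd_other _ _ hr) upd_same => /(_ erefl).
rewrite upd_same upd_upd (upd_comm _ l (catrev _ _) hr) upd_upd => h.
have h1 : execb M (dispatch r (fun a => Then (Pop r) (Push r' a))) s (1 + 1 + nletters + 1)
     (upd (upd s r l) r' (a :: s r')).
  apply: (execb_dispatch hl); apply: execb_then (execb_pop _ _ _) _.
  have := @execb_push M r' a (upd s r (behead (s r))).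
  by rewrite upd_other 1?eq_sym // hl /=; apply; lia.
apply: execb_weak (execb_whileT _ h1 (h _)) _ => /=; first by rewrite hl.
  by lia.
  by rewrite /unit_cost; lia.
Qed.

Definition move_reg r r' tmp := Then (movrev r tmp) (movrev tmp r').

Lemma execb_move M r r' tmp s : r != r' -> r != tmp -> r' != tmp ->
  s r' = [::] -> s tmp = [::] -> size (s r) <= M ->
  execb M (move_reg r r' tmp) s (2 * unit_cost * (size (s r)).+1) (upd (upd s r' (s r)) r [::]).
Proof.
move=> h1 h2 h3 e1 e2 hM.
have := @execb_movrev M r tmp s h2; rewrite e2 addn0 => /(_ hM) H1.
set s1 := upd _ r _ in H1.
have e3 : s1 tmp = rev (s r) by rewrite /s1 upd_other 1?eq_sym // upd_same.
have e4 : s1 r' = [::] by rewrite /s1 upd_other 1?eq_sym // upd_other.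
have := @execb_movrev M tmp r' s1; rewrite e3 e4 size_rev addn0 eq_sym => /(_ h3 hM) H2.
have -> : 2 * unit_cost * (size (s r)).+1 =
  unit_cost * (size (s r)).+1 + unit_cost * (size (s r)).+1 by lia.
rewrite (_ : upd (upd s r' (s r)) r [::] = upd (upd s1 r' (catrev (rev (s r)) [::])) tmp [::]).
  exact: execb_then H1 H2.
rewrite -/(rev _) revK /s1; apply: functional_extensionality => i; rewrite /upd.
case: (i =P tmp) => [->|_]; first by rewrite ![tmp == _]eq_sym (negbTE h2) (negbTE h3) e2.
by case: (i =P r) => [->|_]; rewrite ?(negbTE h1).
Qed.

(** Unloading [tmp] onto both registers restores the source while it builds the copy. *)
Definition copy_reg r r' tmp :=
  Then (movrev r tmp)
    (While tmp nonempty (dispatch tmp (fun a => Then (Pop tmp) (Then (Push r a) (Push r' a))))).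

Lemma execb_copy M r r' tmp s : r != r' -> r != tmp -> r' != tmp ->
  s r' = [::] -> s tmp = [::] -> size (s r) <= M ->
  execb M (copy_reg r r' tmp) s (2 * unit_cost * (size (s r)).+1) (upd s r' (s r)).
Proof.
move=> h1 h2 h3 e1 e2 hM.
have := @execb_movrev M r tmp s h2; rewrite e2 addn0 => /(_ hM) H1.
set s1 := upd _ r _ in H1.
have e3 : s1 tmp = rev (s r) by rewrite /s1 upd_other 1?eq_sym // upd_same.
(* Invariant of the unloading loop: [l1] is still in [tmp], and [l2], already in the original order,
   is on both registers. *)
have H2 : forall l1 l2, s r = catrev l1 l2 ->
  execb M (While tmp nonempty (dispatch tmp (fun a => Then (Pop tmp) (Then (Push r a) (Push r' a)))))
    (upd (upd (upd s tmp l1) r l2) r' l2) (unit_cost * (size l1).+1) (upd s r' (s r)).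
  elim=> [|a l1 IH] l2 hl.
    rewrite (_ : upd _ r' l2 = upd s r' (s r)).
      apply: execb_weak (execb_whileF _ _ _) _; last by rewrite /unit_cost; lia.
      by rewrite upd_other 1?eq_sym // e2.
    apply: functional_extensionality => i; rewrite /upd hl /=.
    case: (i =P r') => // _; case: (i =P r) => [->|_]; first by rewrite hl.
    by case: eqP => // ->; rewrite e2.
  set s2 := upd _ r' l2.
  have f1 : s2 tmp = a :: l1 by rewrite /s2 upd_other 1?eq_sym // upd_other 1?eq_sym // upd_same.
  have hsz := congr1 size hl; rewrite catrevE size_cat size_rev /= in hsz.
  have hd : execb M (dispatch tmp (fun a => Then (Pop tmp) (Then (Push r a) (Push r' a)))) s2
     (1 + (1 + 1) + nletters + 1) (upd (upd (upd s tmp l1) r (a :: l2)) r' (a :: l2)).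
    apply: (execb_dispatch f1); apply: execb_then (execb_pop _ _ _) _.
    have fr : upd s2 tmp (behead (s2 tmp)) r = l2.
      by rewrite upd_other // /s2 upd_other // upd_same.
    have fr' : upd (upd s2 tmp (behead (s2 tmp))) r (a :: l2) r' = l2.
      by rewrite upd_other 1?eq_sym // upd_other // /s2 upd_same.
    have := @execb_push M r a (upd s2 tmp (behead (s2 tmp))); rewrite fr => q1.
    have := @execb_push M r' a (upd (upd s2 tmp (behead (s2 tmp))) r (a :: l2)); rewrite fr' => q2.
    rewrite (_ : upd _ r' _ = upd (upd (upd s2 tmp (behead (s2 tmp))) r (a :: l2)) r' (a :: l2)).
      by apply: execb_then (q1 _) (q2 _); lia.
    apply: functional_extensionality => i; rewrite f1 /s2 /upd /=.
    by case: (i =P r') => // _; case: (i =P r) => // _; case: (i =P tmp).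
  have hl' : s r = catrev l1 (a :: l2) by rewrite hl.
  apply: execb_weak (execb_whileT _ hd (IH _ hl')) _; first by rewrite f1.
  by rewrite /unit_cost /=; lia.
have -> : 2 * unit_cost * (size (s r)).+1 =
  unit_cost * (size (s r)).+1 + unit_cost * (size (s r)).+1 by lia.
apply: execb_then H1 _.
have := H2 (rev (s r)) [::]; rewrite size_rev catrevE revK cats0 => /(_ erefl).
rewrite (_ : upd _ r' [::] = s1) // /s1; apply: functional_extensionality => i.
rewrite /upd; case: (i =P r') => [->|_]; first by rewrite e1 eq_sym (negbTE h1) (negbTE h3).
by case: (i =P r) => // _; case: (i =P tmp).
Qed.

Fixpoint pushes r (l : seq A) : cmd A :=
  if l is a :: l' then Then (pushes r l') (Push r a) else Skip.

Lemma execb_pushes M r l s : size l + size (s r) <= M ->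
  execb M (pushes r l) s (size l) (upd s r (l ++ s r)).
Proof.
elim: l => [|a l IH] /= hM; first by rewrite upd_id //; exact: execb_skip.
rewrite -addn1; apply: execb_then (IH _) _; first by lia.
have := @execb_push M r a (upd s r (l ++ s r)); rewrite upd_same upd_upd; apply.
by rewrite size_cat; lia.
Qed.

End Macros.

(** * Stores with a block of consecutive registers laid over them *)

Section Views.
Variable A : finType.
Implicit Types (s : store A) (b : nat) (vs : seq (seq A)).

Definition view s b vs : store A := fun i => if i < b then s i else nth [::] vs (i - b).

Definition empty_from s b := forall i, b <= i -> s i = [::].

Lemma view_nil s b : empty_from s b -> view s b [::] = s.
Proof.
move=> h; apply: functional_extensionality => i; rewrite /view nth_nil.
by case: ltnP => // /h.
Qed.

Lemma view_eq s b vs ws : (forall i, nth [::] vs i = nth [::] ws i) -> view s b vs = view s b ws.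
Proof. by move=> h; apply: functional_extensionality => i; rewrite /view h. Qed.

Lemma view_view s b vs ws : view (view s b vs) (b + size vs) ws = view s b (vs ++ ws).
Proof.
apply: functional_extensionality => i; rewrite /view nth_cat.
case: (ltnP i (b + size vs)) => h1; case: (ltnP i b) => h2 //; try lia.
  by rewrite (_ : i - b < size vs) //; lia.
by rewrite (_ : i - b < size vs = false) ?subnDA //; lia.
Qed.

Lemma view_at s b vs k : view s b vs (b + k) = nth [::] vs k.
Proof. by rewrite /view ltnNge leq_addr addKn. Qed.

Lemma view_lt s b vs i : i < b -> view s b vs i = s i.
Proof. by rewrite /view => ->. Qed.

Lemma upd_view s b vs k v : upd (view s b vs) (b + k) v = view s b (set_nth [::] vs k v).
Proof.
apply: functional_extensionality => i; rewrite /upd /view nth_set_nth /=.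
case: ltnP => h; first by case: eqP => // e; lia.
by rewrite (_ : (i - b == k) = (i == b + k)) //; apply/eqP/eqP; lia.
Qed.

Lemma view_at0 s b vs : view s b vs b = nth [::] vs 0.
Proof. by rewrite /view ltnn subnn. Qed.

Lemma upd_view0 s b vs v : upd (view s b vs) b v = view s b (set_nth [::] vs 0 v).
Proof. by rewrite -upd_view addn0. Qed.

Lemma view_one s b v : empty_from s b -> view s b [:: v] = upd s b v.
Proof. by move=> h; rewrite -[in RHS](view_nil h) upd_view0. Qed.

Lemma empty_view s b vs : empty_from (view s b vs) (b + size vs).
Proof. by move=> i hi; rewrite /view ltnNge (_ : b <= i) ?nth_default //=; lia. Qed.

Lemma map_view_lt s b vs args : all (fun i => i < b) args -> map (view s b vs) args = map s args.
Proof. by move=> /allP h; apply/eq_in_map => i /h; exact: view_lt. Qed.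

Lemma map_view_block s b vs : map (view s b vs) (iota b (size vs)) = vs.
Proof.
apply: (@eq_from_nth _ [::]); rewrite size_map size_iota // => i hi.
by rewrite (nth_map 0) ?size_iota // nth_iota // view_at.
Qed.

Lemma map_view s b vs args : all (fun i => i < b) args ->
  map (view s b vs) (iota b (size vs) ++ args) = vs ++ map s args.
Proof. by move=> h; rewrite map_cat map_view_block map_view_lt. Qed.

End Views.

Section Blocks.
Variables (A : finType) (tb : bool).
Local Notation execb := (@execb A tb).
Local Notation unit_cost := (unit_cost A).
Implicit Types (s : store A) (b : nat) (vs : seq (seq A)).

Definition bound_all (e : seq (seq A)) L := all (fun x => size x <= L) e.

Lemma bound_all_nth e L i : bound_all e L -> size (nth [::] e i) <= L.
Proof.
move=> h; case: (ltnP i (size e)) => hi; first exact: (all_nthP [::] h).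
by rewrite nth_default.
Qed.

Lemma bound_all_weak e L L' : L <= L' -> bound_all e L -> bound_all e L'.
Proof. by move=> h; apply: sub_all => x; lia. Qed.

Fixpoint clear_block b n : cmd A :=
  if n is n'.+1 then Then (clear A b) (clear_block b.+1 n') else Skip.

Lemma execb_clear_block M s b n vs ws L : size vs = n -> bound_all vs L ->
  execb M (clear_block b n) (view s b (vs ++ ws)) (n * (3 * L + 1))
    (view s b (nseq n [::] ++ ws)).
Proof.
move=> hn hL; suff: forall us, execb M (clear_block (b + size us) n)
    (view s b (us ++ vs ++ ws)) (n * (3 * L + 1)) (view s b (us ++ nseq n [::] ++ ws)).
  by move/(_ [::]); rewrite addn0.
elim: n vs hn hL => [|n IH] [|v vs] //=; first by move=> _ _ us; exact: execb_skip.
move=> [hn] /andP[hv hL] us; rewrite mulSn; apply: execb_then.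
  apply: execb_weak (execb_clear _ _ _ _) _.
  by rewrite view_at nth_cat ltnn subnn /=; lia.
rewrite upd_view (_ : set_nth [::] _ _ _ = rcons us [::] ++ vs ++ ws).
  have := IH vs hn hL (rcons us [::]); rewrite size_rcons addnS !cat_rcons; exact.
rewrite cat_rcons; elim: us => //= u us IH'; by rewrite IH'.
Qed.

(** [i + n] is constant along the recursion, so the scratch register [b + j + i + n] is always the
    first one past the block. *)
Fixpoint shift_block b (j i n : nat) : cmd A :=
  if n is n'.+1 then Then (move_reg A (b + j + i) (b + i) (b + j + i + n))
                          (shift_block b j i.+1 n') else Skip.

Lemma nth_nseq_nil (n k : nat) : nth [::] (nseq n ([::] : seq A)) k = [::].
Proof. by rewrite nth_nseq if_same. Qed.

Lemma execb_shift_block M s b j vs L : 0 < j -> bound_all vs L -> L <= M ->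
  execb M (shift_block b j 0 (size vs)) (view s b (nseq j [::] ++ vs))
    (size vs * (2 * unit_cost * L.+1)) (view s b vs).
Proof.
move=> hj hL hM.
suff: forall us ws, bound_all ws L ->
    execb M (shift_block b j (size us) (size ws)) (view s b (us ++ nseq j [::] ++ ws))
    (size ws * (2 * unit_cost * L.+1)) (view s b (us ++ ws)) by move/(_ [::] vs hL).
move=> us ws; elim: ws us => [|w ws IH] us /=.
  rewrite !cats0 => _; rewrite (@view_eq _ _ _ (us ++ nseq j [::]) us); first exact: execb_skip.
  by move=> i; rewrite nth_cat; case: ltnP => // h; rewrite nth_nseq_nil nth_default.
move=> /andP[hw hws]; rewrite mulSn; apply: execb_then.
  set s1 := view _ _ _.
  have e1 : s1 (b + j + size us) = w.
    rewrite -addnA /s1 view_at nth_cat ifF; last by lia.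
    by rewrite addnK nth_cat size_nseq ltnn subnn.
  have e2 : s1 (b + size us) = [::].
    by rewrite /s1 view_at nth_cat ltnn subnn nth_cat size_nseq hj nth_nseq_nil.
  have e3 : s1 (b + j + size us + (size ws).+1) = [::].
    by rewrite /s1 -!addnA view_at nth_default // !size_cat size_nseq /=; lia.
  apply: execb_weak (execb_move _ _ _ _ e2 e3 _) _; rewrite ?e1; try lia.
  by rewrite leq_mul2l ltnS hw orbT.
rewrite -[b + j + _]addnA !upd_view -[(size us).+1](size_rcons us w) -(cat_rcons w us ws).
rewrite view_at (_ : set_nth _ _ _ _ = rcons us w ++ nseq j [::] ++ ws); first exact: IH.
have -> : nth [::] (us ++ nseq j [::] ++ w :: ws) (j + size us) = w.
  rewrite nth_cat ifF; last by lia.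
  by rewrite addnK nth_cat size_nseq ltnn subnn.
case: j hj {IH} => // j _.
elim: us => [|u us IHu] /=; last by rewrite addnS /= IHu.
by rewrite addn0; congr cons; elim: j => //= j ->.
Qed.

End Blocks.

(** * String functions computable in polynomial space or time *)

Definition polyb (B : nat -> nat) := exists a, forall L, B L <= (L + 2) ^ a.

Lemma polyb_le (B B' : nat -> nat) : (forall L, B L <= B' L) -> polyb B' -> polyb B.
Proof. by move=> h [a ha]; exists a => L; apply: leq_trans (h L) (ha L). Qed.

Lemma polyb_const n : polyb (fun _ => n).
Proof.
exists n => L; apply: leq_trans (_ : 2 ^ n <= _); first exact: ltnW (ltn_expl _ _).
by case: n => // n; rewrite leq_exp2r // leq_addl.
Qed.

Lemma polyb_id : polyb (fun L => L).
Proof. by exists 1 => L; rewrite expn1 leq_addr. Qed.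

Lemma polyb_add B1 B2 : polyb B1 -> polyb B2 -> polyb (fun L => B1 L + B2 L).
Proof.
move=> [a ha] [b hb]; exists (maxn a b).+1 => L.
rewrite expnS addn2 mulSn; have h c : c <= maxn a b -> (L + 2) ^ c <= L.+2 ^ maxn a b.
  by rewrite addn2; exact: leq_pexp2l.
apply: leq_add; first by apply: leq_trans (ha L) (h _ (leq_maxl _ _)).
apply: leq_trans (leq_trans (hb L) (h _ (leq_maxr _ _))) _.
by rewrite leq_pmull.
Qed.

Lemma polyb_mul B1 B2 : polyb B1 -> polyb B2 -> polyb (fun L => B1 L * B2 L).
Proof. by move=> [a ha] [b hb]; exists (a + b) => L; rewrite expnD leq_mul. Qed.

Lemma polyb_comp B1 B2 : polyb B1 -> polyb B2 -> polyb (fun L => B1 (B2 L)).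
Proof.
move=> [a ha] [b hb]; exists (b.+2 * a) => L; apply: leq_trans (ha _) _.
rewrite expnM; case: a ha => // a _; rewrite leq_exp2r // !expnS.
have := hb L; have : 0 < (L + 2) ^ b by rewrite expn_gt0 addn2.
by nia.
Qed.

Lemma polyb_max B1 B2 : polyb B1 -> polyb B2 -> polyb (fun L => maxn (B1 L) (B2 L)).
Proof.
move=> h1 h2; apply: polyb_le (polyb_add h1 h2) => L.
by rewrite geq_max leq_addr leq_addl.
Qed.

Lemma polyb_succ B : polyb B -> polyb (fun L => (B L).+1).
Proof. by move=> h; apply: polyb_le (polyb_add h (polyb_const 1)) => L; rewrite addn1. Qed.

Ltac polyb := repeat first
  [ assumption | apply: polyb_const | apply: polyb_id | apply: polyb_add
  | apply: polyb_succ | apply: polyb_mul | apply: polyb_max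
  | match goal with h : polyb ?B |- polyb (fun L => ?B _) => apply: (polyb_comp h) end ].

Section Computes.
Variables (A : finType) (tb : bool).
Local Notation str := (seq A).
Local Notation env := (seq str).
Implicit Types (F G : env -> env) (B : nat -> nat) (e : env).

Definition prog := seq nat -> nat -> cmd A.

(* [p args b] leaves the [j] strings [F e] in registers [b, ..., b+j-1], where
   [e] lists the contents of the registers [args], all below [b]; the registers
   from [b] on serve as scratch and are empty before and otherwise after. *)
Definition computes j (p : prog) F B :=
  forall args b s L M, all (fun i => i < b) args -> empty_from s b ->
    bound_all (map s args) L -> B L <= M ->
  [/\ size (F (map s args)) = j, bound_all (F (map s args)) (B L) &
      execb tb M (p args b) s (B L) (view s b (F (map s args)))].

Lemma computes_eq j p F G B : (forall e, F e = G e) -> computes j p F B -> computes j p G B.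
Proof. by move=> h hF args b s L M *; rewrite -h; apply: hF. Qed.

Lemma all_lt_weak args b b' : b <= b' -> all (fun i => i < b) args -> all (fun i => i < b') args.
Proof. by move=> h; apply: sub_all => x; lia. Qed.

Lemma computes_nil : computes 0 (fun _ _ => Skip) (fun _ => [::]) (fun _ => 0).
Proof. by move=> args b s L M _ hs _ _; split=> //; rewrite view_nil //; exact: execb_skip. Qed.

Lemma bound_cat e1 e2 L : bound_all (e1 ++ e2) L = bound_all e1 L && bound_all e2 L.
Proof. exact: all_cat. Qed.

Lemma computes_cat j1 j2 p1 p2 F1 F2 B1 B2 : computes j1 p1 F1 B1 -> computes j2 p2 F2 B2 ->
  computes (j1 + j2) (fun args b => Then (p1 args b) (p2 args (b + j1)))
    (fun e => F1 e ++ F2 e) (fun L => B1 L + B2 L).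
Proof.
move=> h1 h2 args b s L M ha hs hL hM.
have [z1 b1 e1] := h1 args b s L M ha hs hL (leq_trans (leq_addr _ _) hM).
have hm := map_view_lt s (F1 (map s args)) ha.
have := h2 args (b + j1) (view s b (F1 (map s args))) L M
  (all_lt_weak (leq_addr _ _) ha).
rewrite hm -z1 => /(_ (@empty_view _ _ _ _) hL (leq_trans (leq_addl _ _) hM)) [z2 b2 e2].
rewrite view_view in e2.
split; first by rewrite size_cat z1 z2.
  rewrite bound_cat (bound_all_weak _ b1) ?leq_addr //.
  by rewrite (bound_all_weak _ b2) ?leq_addl.
exact: execb_then e1 e2.
Qed.

Definition let_cost i j B1 B2 L :=
  B1 L + (B2 (B1 L + L) + (j * (3 * B1 L + 1) + i * (2 * unit_cost A * (B2 (B1 L + L)).+1))).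

(** The intermediate values sit where the result has to go; they are cleared and the result is moved
    down by [j]. The case [j = 0] is separate because [move_reg] moves between distinct
    registers. *)
Definition let_prog i j (pG pF : prog) : prog := fun args b =>
  Then (pG args b) (Then (pF (iota b j ++ args) (b + j)) (Then (clear_block A b j)
    (if j is 0 then Skip else shift_block A b j 0 i))).

Lemma computes_let i j pG pF G F B1 B2 : computes j pG G B1 -> computes i pF F B2 ->
  computes i (let_prog i j pG pF) (fun e => F (G e ++ e)) (let_cost i j B1 B2).
Proof.
move=> h1 h2 args b s L M ha hs hL hM; rewrite /let_cost in hM *.
have [|z1 b1 e1] := h1 args b s L M ha hs hL; first by lia.
set g := G _ in z1 b1 e1 *.
have := h2 (iota b j ++ args) (b + j) (view s b g) (B1 L + L) M.
have -> : map (view s b g) (iota b j ++ args) = g ++ map s args by rewrite -z1 map_view.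
rewrite -{3}z1 => /(_ _ (@empty_view _ _ _ _)) [|||z2 b2 e2].
- rewrite all_cat (all_lt_weak _ ha) ?leq_addr // andbT.
  by apply/allP => x; rewrite mem_iota => /andP[_].
- by rewrite bound_cat (bound_all_weak _ b1) ?leq_addr // (bound_all_weak _ hL) ?leq_addl.
- by lia.
rewrite -z1 view_view z1 in e2.
split=> //; first by apply: bound_all_weak b2; lia.
apply: execb_then e1 _; apply: execb_then e2 _.
apply: execb_then (execb_clear_block _ _ _ _ _ z1 b1) _.
case: (j) z1 => [|j'] z1 /=.
  by apply: execb_weak (execb_skip _ _ _) _.
by rewrite -z2; apply: execb_shift_block => //; lia.
Qed.

(** The state occupies [j] registers and the condition the next one; a nonempty condition means
    another round. The new state is built above the old one, which is then cleared and replaced. *)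
Definition loop_prog j (pI pS pc : prog) : prog := fun args b =>
  let args' := iota b j ++ args in
  Then (pI args b) (Then (pc args' (b + j))
    (While (b + j) (@nonempty A)
       (Then (clear A (b + j)) (Then (pS args' (b + j)) (Then (clear_block A b j)
          (Then (shift_block A b j 0 j) (pc args' (b + j)))))))).

Definition loop_cost j (BI BS Bc Q : nat -> nat) L :=
  BI L + Q L + 1 + (Bc (Q L + L) + BS (Q L + L) +
  (Q L).+1 * (3 * Bc (Q L + L) + 8 + BS (Q L + L) + j * (3 * Q L + 1) +
    j * (2 * unit_cost A * (Q L).+1) + Bc (Q L + L))).

(** [Q] bounds the length of every state met and, when time counts, also the number [N] of rounds.
    Without [tb] the number of rounds is free, since each round reuses the same registers. *)
Lemma computes_loop j pI pS pc I S c F BI BS Bc Q : 0 < j ->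
  computes j pI I BI -> computes j pS S BS -> computes 1 pc (fun e => [:: c e]) Bc ->
  (forall e L, bound_all e L -> let st n := iter n (fun x => S (x ++ e)) (I e) in
     exists N, [/\ forall n, n < N -> c (st n ++ e) != [::], c (st N ++ e) = [::],
       F e = st N, forall n, n <= N -> bound_all (st n) (Q L) & tb -> N <= Q L]) ->
  computes j (loop_prog j pI pS pc) F (loop_cost j BI BS Bc Q).
Proof.
move=> hj hI hS hc hF args b s L M ha hs hL hM; rewrite /loop_cost in hM *.
have [N [hcN hcN0 hFN hQ hN]] := hF _ _ hL.
set e := map s args in hcN hcN0 hFN hQ hL *.
set st := fun n => iter n (fun x => S (x ++ e)) (I e) in hcN hcN0 hFN hQ *.
have [|zI bI eI] := hI args b s L M ha hs hL; first by lia.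
have hb' : forall n, n <= N -> bound_all (st n ++ e) (Q L + L).
  move=> n /hQ h; rewrite bound_cat (bound_all_weak _ h) ?leq_addr //.
  by rewrite (bound_all_weak _ hL) ?leq_addl.
have ha' : all (fun i => i < b + j) (iota b j ++ args).
  rewrite all_cat (all_lt_weak _ ha) ?leq_addr // andbT.
  by apply/allP => x; rewrite mem_iota => /andP[].
have hme : forall vs, size vs = j -> map (view s b vs) (iota b j ++ args) = vs ++ e.
  by move=> vs <-; rewrite map_view.
have hem : forall vs, size vs = j -> empty_from (view s b vs) (b + j).
  by move=> vs <-; exact: empty_view.
have hvv : forall vs ws, size vs = j -> view (view s b vs) (b + j) ws = view s b (vs ++ ws).
  by move=> vs ws <-; exact: view_view.
have step : forall n, n <= N -> size (st n) = j ->
   [/\ size (st n.+1) = j,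
    execb tb M (pS (iota b j ++ args) (b + j)) (view s b (st n)) (BS (Q L + L))
       (view s b (st n ++ st n.+1)) &
    execb tb M (pc (iota b j ++ args) (b + j)) (view s b (st n)) (Bc (Q L + L))
       (view s b (st n ++ [:: c (st n ++ e)]))].
  move=> n hn zn.
  have := hS (iota b j ++ args) (b + j) (view s b (st n)) (Q L + L) M ha' (hem _ zn).
  rewrite hme // hvv // => /(_ (hb' _ hn)) [|z1 b1 e1]; first by lia.
  have := hc (iota b j ++ args) (b + j) (view s b (st n)) (Q L + L) M ha' (hem _ zn).
  by rewrite hme // hvv // => /(_ (hb' _ hn)) [|z2 b2 e2] //; lia.
have bc : forall n, n <= N -> size (st n) = j -> size (c (st n ++ e)) <= Bc (Q L + L).
  move=> n hn zn.
  have := hc (iota b j ++ args) (b + j) (view s b (st n)) (Q L + L) M ha' (hem _ zn).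
  rewrite hme // => /(_ (hb' _ hn)) [|_ + _]; first by lia.
  by rewrite /bound_all /= andbT.
have zst : forall n, n <= N -> size (st n) = j.
  by elim=> [//|n IH] hn; have [] := step n (ltnW hn) (IH (ltnW hn)).
rewrite /loop_prog; cbv zeta.
set body := Then (clear A (b + j)) _.
have hbody : forall n, n < N -> execb tb M body (view s b (st n ++ [:: c (st n ++ e)]))
    (3 * Bc (Q L + L) + 1 + (BS (Q L + L) + (j * (3 * Q L + 1) +
    (j * (2 * unit_cost A * (Q L).+1) + Bc (Q L + L)))))
    (view s b (st n.+1 ++ [:: c (st n.+1 ++ e)])).
  move=> n hn; have zn := zst n (ltnW hn); have zn1 := zst n.+1 hn.
  have [_ e1 _] := step n (ltnW hn) zn.
  have [_ _ e2] := step n.+1 hn zn1.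
  apply: execb_then.
    apply: execb_weak (execb_clear _ _ _ _) _.
    rewrite view_at nth_cat zn ltnn subnn /=.
    by have := bc n (ltnW hn) zn; lia.
  rewrite upd_view (@view_eq _ _ _ _ (st n)); last first.
    move=> i; rewrite nth_set_nth /= nth_cat zn; case: eqP => [->|/eqP hi].
      by rewrite nth_default ?zn.
    case: ltnP => // hji; rewrite !nth_default ?zn //=.
    by rewrite subn_gt0 ltn_neqAle eq_sym hi.
  apply: execb_then e1 _.
  apply: execb_then (execb_clear_block _ _ _ _ _ zn (hQ n (ltnW hn))) _.
  apply: execb_then _ e2.
  have := @execb_shift_block A tb M s b j (st n.+1) (Q L) hj (hQ _ hn).
  by rewrite zn1; apply; lia.
have hloop : forall n, n <= N ->
    execb tb M (While (b + j) (@nonempty A) body) (view s b (st n ++ [:: c (st n ++ e)]))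
      ((N - n) * (3 * Bc (Q L + L) + 8 + BS (Q L + L) + j * (3 * Q L + 1) +
    j * (2 * unit_cost A * (Q L).+1) + Bc (Q L + L)) + 1) (view s b (st N)).
  move=> n hn; move: {2}(N - n) (erefl (N - n)) => d.
  elim: d n hn => [|d IH] n hn hd.
    have -> : n = N by lia.
    rewrite hcN0 subnn (@view_eq _ _ _ _ (st N)).
      by apply: execb_whileF; rewrite view_at nth_default ?zst.
    move=> i; rewrite nth_cat; case: ltnP => // h; rewrite [RHS]nth_default //.
    by case: (i - _) => // -[].
  have hn' : n < N by lia.
  apply: execb_weak (execb_whileT _ (hbody _ hn') (IH n.+1 hn' _)) _; last 2 first.
  - by lia.
  - by rewrite (_ : N - n = (N - n.+1).+1) ?mulSn; lia.
  rewrite view_at nth_cat zst // ltnn subnn /=.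
  by case: (c _) (hcN _ hn').
have zF : size (F e) = j by rewrite hFN zst.
split=> //; first by rewrite hFN; apply: bound_all_weak (hQ _ (leqnn _)); lia.
have [_ _ e0] := step 0 (leq0n _) (zst 0 (leq0n _)).
have hFN' : F e = st N by [].
rewrite -hFN' in hloop.
have [t1 ht1 {}eI] := eI; have [t2 ht2 {}e0] := e0; have [t3 ht3 e3] := hloop 0 (leq0n _).
exists (t1 + (t2 + t3)); last exact: EThen eI (EThen e0 e3).
move=> htb; have := ht1 htb; have := ht2 htb; have := ht3 htb; have := hN htb.
rewrite subn0; move: (3 * _ + _ + _ + _ + _ + _) => X.
rewrite mulSn => q1 q2 q3 q4; have q5 : N * X <= Q L * X by rewrite leq_mul2r q1 orbT.
by lia.
Qed.

End Computes.

(** * Closure properties of polynomially bounded string functions *)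

Section Comp.
Variables (A : finType) (tb : bool).
Local Notation str := (seq A).
Local Notation env := (seq str).
Implicit Types (F G : env -> env) (f g : env -> str) (e : env).
Local Notation computes := (@computes A tb).

Definition Comp j F := exists p B, polyb B /\ computes j p F B.
Definition C f := Comp 1 (fun e => [:: f e]).

Lemma Comp_ext j F G : (forall e, F e = G e) -> Comp j F -> Comp j G.
Proof. by move=> h [p [B [hB hc]]]; exists p, B; split=> //; apply: computes_eq hc. Qed.

Lemma C_ext f g : (forall e, f e = g e) -> C f -> C g.
Proof. by move=> h; apply: Comp_ext => e; rewrite h. Qed.

(** Any environment is the content of the registers from 0 on in a suitable store, so running the
    program there yields facts about [F e] alone. *)
Lemma computes_value j p F B e L : computes j p F B -> bound_all e L ->
  size (F e) = j /\ bound_all (F e) (B L).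
Proof.
move=> h hL.
have hm : map (view (fun _ => [::]) 0 e) (iota 0 (size e)) = e by rewrite map_view_block.
have := h (iota 0 (size e)) (size e) (view (fun _ => [::]) 0 e) L (B L).
rewrite hm => -[] //; first by apply/allP => x; rewrite mem_iota.
exact: empty_view.
Qed.

Lemma bound_allP e : exists L, bound_all e L.
Proof.
exists (\max_(x <- e) size x); apply/allP => x hx.
exact: leq_bigmax_seq hx isT.
Qed.

Lemma Comp_size j F e : Comp j F -> size (F e) = j.
Proof. by move=> [p [B [_ hc]]]; have [L hL] := bound_allP e; have [] := computes_value hc hL. Qed.

Lemma C_bound f : C f -> exists2 B, polyb B & forall e L, bound_all e L -> size (f e) <= B L.
Proof.
move=> [p [B [hB hc]]]; exists B => // e L hL; have [_] := computes_value hc hL.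
by rewrite /bound_all /= andbT.
Qed.

(** Selecting arguments costs nothing at run time: only the list of register numbers handed to the
    program changes. *)
Lemma Comp_sel j F selN selS : Comp j F ->
  (forall s args, map s (selN args) = selS (map s args)) ->
  (forall args : seq nat, {subset selN args <= args}) -> Comp j (fun e => F (selS e)).
Proof.
move=> [p [B [hB hc]]] h1 h2; exists (fun args b => p (selN args) b), B; split=> //.
move=> args b s L M ha hs hL hM; rewrite -h1; apply: hc => //.
  by apply/allP => x /h2; exact: (allP ha).
apply/allP => x /mapP[r hr ->]; apply: (allP hL); exact: (map_f s (h2 _ _ hr)).
Qed.

Lemma Comp_behead j F : Comp j F -> Comp j (fun e => F (behead e)).
Proof.
by move=> h; apply: (@Comp_sel _ _ behead behead h) => [s [] //|args x]; exact: mem_behead.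
Qed.

Lemma Comp_take n j F : Comp j F -> Comp j (fun e => F (take n e)).
Proof.
move=> h; apply: (@Comp_sel _ _ (take n) (take n) h) => [s args|args x]; first by rewrite map_take.
exact: mem_take.
Qed.

Lemma Comp_nil : Comp 0 (fun _ => [::]).
Proof. exists (fun _ _ => Skip), (fun _ => 0); split; [exact: polyb_const|exact: computes_nil]. Qed.

Lemma Comp_cat j1 j2 F1 F2 : Comp j1 F1 -> Comp j2 F2 -> Comp (j1 + j2) (fun e => F1 e ++ F2 e).
Proof.
move=> [p1 [B1 [h1 c1]]] [p2 [B2 [h2 c2]]]; do 2!eexists.
by split; last exact: computes_cat c1 c2; polyb.
Qed.

Lemma Comp_cons j f F : C f -> Comp j F -> Comp j.+1 (fun e => f e :: F e).
Proof. by move=> h1 h2; apply: Comp_cat h1 h2. Qed.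

Lemma Comp_letn i j G F : Comp j G -> Comp i F -> Comp i (fun e => F (G e ++ e)).
Proof.
move=> [p1 [B1 [h1 c1]]] [p2 [B2 [h2 c2]]]; do 2!eexists.
split; last exact: computes_let c1 c2.
by rewrite /let_cost; polyb.
Qed.

Lemma Comp_comp i j G F : Comp j G -> Comp i F -> Comp i (fun e => F (G e)).
Proof.
move=> hG hF; apply: Comp_ext (Comp_letn hG (Comp_take j hF)) => e.
by rewrite /= -{1}(Comp_size e hG) take_size_cat.
Qed.

Lemma C_let g f : C g -> C f -> C (fun e => f (g e :: e)).
Proof. exact: Comp_letn. Qed.

Lemma C_var i : C (fun e => nth [::] e i).
Proof.
exists (fun args b => if i < size args then copy_reg A (nth 0 args i) b b.+1 else Skip).
exists (fun L => L + 2 * unit_cost A * L.+1); split.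
  by polyb.
move=> args b s L M ha hs hL hM; split=> //.
  rewrite /bound_all /= andbT; apply: leq_trans (leq_addr _ _).
  exact: (bound_all_nth i hL).
case: ltnP => hi; last first.
  rewrite nth_default ?size_map // (@view_eq _ s b _ [::]).
    by rewrite view_nil //; exact: execb_weak (execb_skip _ _ _) _.
  by case=> [|[]].
have hr : nth 0 args i < b by apply: (allP ha); exact: mem_nth.
have hv : nth [::] (map s args) i = s (nth 0 args i) by rewrite (nth_map 0).
have hsz := bound_all_nth i hL; rewrite hv in hsz.
rewrite hv view_one //.
apply: execb_weak (execb_copy _ _ _ _ _ _ _) _; try (by rewrite ?hs //); try lia.
by have : (size (s (nth 0 args i))).+1 <= L.+1; [|nia].
Qed.

Lemma C_const l : C (fun _ => l).
Proof.
exists (fun args b => pushes b l), (fun _ => size l); split; first exact: polyb_const.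
move=> args b s L M ha hs hL hM; split=> //; first by rewrite /bound_all /= leqnn.
rewrite view_one //.
by have := @execb_pushes A tb M b l s; rewrite hs // cats0 addn0; apply.
Qed.

Lemma Comp_case (p : pred (option A)) j c F G : C c -> Comp j F -> Comp j G ->
  Comp j (fun e => if p (ohead (c e)) then F e else G e).
Proof.
move=> [pc [Bc [hBc hc]]] [pF [BF [hBF hF]]] [pG [BG [hBG hG]]].
exists (fun args b => Then (pc args b) (If b p (Then (clear A b) (pF args b))
   (Then (clear A b) (pG args b)))), (fun L => Bc L + ((3 * Bc L + 1 + (BF L + BG L)) + 2)); split.
  by polyb.
move=> args b s L M ha hs hL hM; set e := map s args in hL *.
have [|_ bc ec] := hc args b s L M ha hs hL; first by lia.
have [|zF bF eF] := hF args b s L M ha hs hL; first by lia.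
have [|zG bG eG] := hG args b s L M ha hs hL; first by lia.
have hcl : execb tb M (clear A b) (view s b [:: c e]) (3 * Bc L + 1) s.
  have := execb_clear tb M b (view s b [:: c e]).
  rewrite view_at0 upd_view0 (@view_eq _ s b (set_nth _ _ _ _) [::]) ?view_nil; [|by []|by case=> [|[]]].
  by move=> h; apply: execb_weak h _; move: bc; rewrite /bound_all /= andbT -/e; lia.
have hb : view s b [:: c e] b = c e by rewrite view_at0.
case hp: (p (ohead (c e))).
  split=> //; first by apply: bound_all_weak bF; lia.
  apply: execb_then ec _; apply: execb_weak (execb_ifT _ _ (execb_then hcl eF)) _; last by lia.
  by rewrite hb hp.
split=> //; first by apply: bound_all_weak bG; lia.
apply: execb_then ec _; apply: execb_weak (execb_ifF _ _ (execb_then hcl eG)) _; last by lia.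
by rewrite hb hp.
Qed.

Lemma Comp_caseA j c (F : A -> env -> env) G : C c -> (forall a, Comp j (F a)) -> Comp j G ->
  Comp j (fun e => if c e is a :: _ then F a e else G e).
Proof.
move=> hc hF hG.
suff h : forall l : seq A, Comp j (fun e => if c e is a :: _ then if a \in l then F a e else G e else G e).
  by apply: Comp_ext (h (enum A)) => e; case: (c e) => // a u; rewrite mem_enum.
elim=> [|b l IH]; first by apply: Comp_ext hG => e; case: (c e).
apply: Comp_ext (Comp_case (pred1 (Some b)) hc (hF b) IH) => e.
case: (c e) => [|a u] //=; rewrite inE (inj_eq Some_inj).
by case: eqP => [->|].
Qed.

Lemma C_caseA c (f : A -> env -> str) g : C c -> (forall a, C (f a)) -> C g ->
  C (fun e => if c e is a :: _ then f a e else g e).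
Proof.
move=> hc hf hg; have := Comp_caseA hc hf hg; apply: Comp_ext => e.
by case: (c e).
Qed.

Lemma C_behead f : C f -> C (fun e => behead (f e)).
Proof.
move=> [p [B [hB hc]]].
exists (fun args b => Then (p args b) (Pop b)), (fun L => B L + 1); split; first by polyb.
move=> args b s L M ha hs hL hM.
have [|_ bc ec] := hc args b s L M ha hs hL; first by lia.
split=> //; first by move: bc; rewrite /bound_all /= !andbT size_behead; lia.
apply: execb_then ec _; set v := f _.
have := execb_pop tb M b (view s b [:: v]).
by rewrite view_at0 upd_view0.
Qed.

Lemma C_push a f : C f -> C (fun e => a :: f e).
Proof.
move=> [p [B [hB hc]]].
exists (fun args b => Then (p args b) (Push b a)), (fun L => B L + 1); split; first by polyb.
move=> args b s L M ha hs hL hM.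
have [|_ bc ec] := hc args b s L M ha hs hL; first by lia.
have hsz : size (f (map s args)) <= B L by move: bc; rewrite /bound_all /= andbT.
split=> //; first by rewrite /bound_all /= andbT; lia.
apply: execb_then ec _; set v := f _ in hsz *.
have := @execb_push A tb M b a (view s b [:: v]).
by rewrite view_at0 upd_view0; apply; rewrite /=; lia.
Qed.

Lemma C_nth j F i : Comp j F -> C (fun e => nth [::] (F e) i).
Proof. by move=> h; apply: Comp_comp h (C_var i). Qed.

Lemma Comp_loop j I S c F (Q : nat -> nat) : 0 < j -> polyb Q ->
  Comp j I -> Comp j S -> C c ->
  (forall e L, bound_all e L -> let st n := iter n (fun x => S (x ++ e)) (I e) in
     exists N, [/\ forall n, n < N -> c (st n ++ e) != [::], c (st N ++ e) = [::],
       F e = st N, forall n, n <= N -> bound_all (st n) (Q L) & tb -> N <= Q L]) ->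
  Comp j F.
Proof.
move=> hj hQ [pI [BI [hBI hI]]] [pS [BS [hBS hS]]] [pc [Bc [hBc hc]]] h.
do 2!eexists; split; last exact: computes_loop hj hI hS hc h.
have hQL : polyb (fun L => Q L + L) by polyb.
have h1 := polyb_comp hBc hQL; have h2 := polyb_comp hBS hQL.
by rewrite /loop_cost; polyb.
Qed.

(** The body also sees the unread part of the string, current letter included, which can then serve
    as a counter. *)
Fixpoint floop (F : A -> env -> str) e (l acc : str) : str :=
  if l is a :: l' then floop F e l' (F a (acc :: l :: e)) else acc.

(** A round may lengthen the accumulator only by an amount bounded in the other strings. An
    increment growing with the accumulator would permit doubling in every round, and an exponential
    result. *)
Lemma C_floop (F : A -> env -> str) g i Q : polyb Q -> C g -> C i -> (forall a, C (F a)) ->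
  (forall a acc l e L, bound_all (l :: e) L -> size (F a (acc :: l :: e)) <= size acc + Q L) ->
  C (fun e => floop F e (g e) (i e)).
Proof.
move=> hQ hg hi hF hsz.
have [Bg hBg bg] := C_bound hg; have [Bi hBi bi] := C_bound hi.
pose Q' := fun L => Bi L + Bg L * Q (Bg L + L) + Bg L.
have hQ' : polyb Q'.
  have := polyb_comp hQ (polyb_add hBg polyb_id) => /= h.
  by rewrite /Q'; polyb.
pose R e := [:: floop F e (g e) (i e); [::]].
suff : Comp 2 R by move=> h; apply: C_ext (C_nth 0 h).
pose S (e : env) := if nth [::] e 1 is a :: _ then [:: F a e; behead (nth [::] e 1)]
   else [:: nth [::] e 0; nth [::] e 1].
apply: (@Comp_loop 2 (fun e => [:: i e; g e]) S (fun e => nth [::] e 1) R Q') => //.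
- exact: Comp_cons hi hg.
- apply: Comp_caseA (C_var 1) _ _ => [a|]; apply: Comp_cons => //; try exact: C_var.
  by apply: C_behead; exact: C_var.
- exact: C_var.
move=> e L hL st; exists (size (g e)).
have key : forall n, n <= size (g e) -> exists acc,
   [/\ st n = [:: acc; drop n (g e)], size acc <= Bi L + n * Q (Bg L + L) &
       floop F e (drop n (g e)) acc = floop F e (g e) (i e)].
  elim=> [|n IH] hn; first by exists (i e); rewrite drop0 mul0n addn0; split=> //; exact: bi.
  have [acc [e1 e2 e3]] := IH (ltnW hn).
  rewrite /st iterS -/(st n) e1 /S /=.
  have [a ha] : exists a, drop n (g e) = a :: drop n.+1 (g e).
    case hg': (g e) hn => [//|a u] hn; exists (nth a (g e) n).
    by rewrite -hg' (drop_nth a) // hg'.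
  rewrite ha /=; eexists; split; first by [].
    apply: leq_trans (hsz _ _ _ _ (Bg L + L) _) _.
      rewrite -ha /bound_all /= size_drop; apply/andP; split; first by have := bg e L hL; lia.
      by apply: sub_all hL => x; lia.
    by rewrite mulSn; lia.
  by rewrite -e3 ha.
split.
- move=> n hn; have [acc [-> _ _]] := key n (ltnW hn); rewrite /=.
  by rewrite -size_eq0 size_drop subn_eq0 -ltnNge.
- by have [acc [-> _ _]] := key _ (leqnn _); rewrite /= drop_size.
- by have [acc [-> _ ]] := key _ (leqnn _); rewrite drop_size /R /= => ->.
- move=> n hn; have [acc [-> h _]] := key n hn.
  have hgL := bg e L hL.
  have : n * Q (Bg L + L) <= Bg L * Q (Bg L + L) by rewrite leq_mul2r (leq_trans hn hgL) orbT.
  by rewrite /bound_all /= size_drop /Q' andbT => hh; apply/andP; split; lia.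
- by move=> _; have := bg e L hL; rewrite /Q'; lia.
Qed.

End Comp.

(** * Concatenation, transducers and repetition *)

Section Library.
Variables (A : finType) (tb : bool).
Local Notation str := (seq A).
Local Notation env := (seq str).
Local Notation C := (@C A tb).
Implicit Types (f g : env -> str) (e : env).

Lemma C_tail f : C f -> C (fun e => f (behead e)).
Proof. exact: (@Comp_behead _ _ 1 (fun e => [:: f e])). Qed.

Lemma C_catrev f g : C f -> C g -> C (fun e => catrev (f e) (g e)).
Proof.
move=> hf hg.
have h : C (fun e => floop (fun a e => a :: nth [::] e 0) e (f e) (g e)).
  apply: (@C_floop _ _ _ _ _ (fun _ => 1)) => //; first by polyb.
    by move=> a; apply: C_push; exact: C_var.
  by move=> a acc l e L _ /=; rewrite addn1.
by apply: C_ext h => e; elim: (f e) (g e) => //= a l IH m; rewrite IH.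
Qed.

Lemma C_rev f : C f -> C (fun e => rev (f e)).
Proof. by move=> hf; apply: C_catrev => //; exact: C_const. Qed.

Lemma C_cat f g : C f -> C g -> C (fun e => f e ++ g e).
Proof.
move=> hf hg; have := C_catrev (C_rev hf) hg; apply: C_ext => e.
by rewrite catrevE revK.
Qed.

Fixpoint transduce (d : A -> A -> A * str) (fin : A -> str) (q : A) (l : str) : str :=
  if l is a :: l' then (d q a).2 ++ transduce d fin (d q a).1 l' else fin q.

(** The accumulator holds the state on top of the reversed output, so that a letter of input costs
    pushes of bounded number. *)
Lemma C_transduce d fin q f : C f -> C (fun e => transduce d fin q (f e)).
Proof.
move=> hf.
pose F a (e : env) := if nth [::] e 0 is q :: _ then
   (d q a).1 :: catrev (d q a).2 (behead (nth [::] e 0)) else nth [::] e 0.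
have hv : C (fun e => nth [::] e 0) by exact: C_var.
have h : C (fun e => floop F e (f e) [:: q]).
  apply: (@C_floop _ _ _ _ _ (fun _ => \max_q \max_a size (d q a).2)) => //.
  - by polyb.
  - exact: C_const.
  - move=> a; apply: C_caseA => // b; apply: C_push; apply: C_catrev; first exact: C_const.
    by apply: C_behead.
  move=> a [|b acc] l e L _ //=; rewrite catrevE size_cat size_rev.
  have h1 : size (d b a).2 <= \max_a size (d b a).2.
    by rewrite (bigD1 a) //= leq_maxl.
  have h2 : \max_a size (d b a).2 <= \max_q \max_a size (d q a).2.
    by rewrite [leqRHS](bigD1 b) //= leq_maxl.
  by lia.
have h2 : C (fun e => if floop F e (f e) [:: q] is r :: _ then
     catrev (behead (floop F e (f e) [:: q])) (fin r) else [::]).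
  apply: C_caseA => // [b|]; last exact: C_const.
  by apply: C_catrev; [apply: C_behead|exact: C_const].
apply: C_ext h2 => e.
suff H : forall l q out, exists q' out', floop F e l (q :: out) = q' :: out' /\
    catrev out' (fin q') = catrev out (transduce d fin q l).
  by have [q' [out' [-> /= ->]]] := H (f e) q [::].
elim=> [|a l IH] p out; first by exists p, out.
rewrite /= /F /=; have [q' [out' [h3 h4]]] := IH (d p a).1 (catrev (d p a).2 out).
by exists q', out'; split=> //; rewrite h4 !catrevE rev_cat revK catA.
Qed.

Lemma C_flatmap (h : A -> str) f : C f -> C (fun e => flatten (map h (f e))).
Proof.
move=> hf; have [a0 _|noA] := pickP A; last first.
  by apply: C_ext (@C_const A tb [::]) => e; case: (f e) => // a; have := noA a.
have := C_transduce (fun q a => (q, h a)) (fun _ => [::]) a0 hf; apply: C_ext => e.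
by elim: (f e) => //= a l ->.
Qed.

Lemma C_map (h : A -> A) f : C f -> C (fun e => map h (f e)).
Proof.
move=> hf; apply: C_ext (C_flatmap (fun a => [:: h a]) hf) => e.
by elim: (f e) => //= a l ->.
Qed.

Lemma C_filter (h : pred A) f : C f -> C (fun e => filter h (f e)).
Proof.
move=> hf; apply: C_ext (C_flatmap (fun a => if h a then [:: a] else [::]) hf) => e.
by elim: (f e) => //= a l ->; case: (h a).
Qed.

Lemma C_repeat f g : C f -> C g -> C (fun e => flatten (nseq (size (f e)) (g e))).
Proof.
move=> hf hg; have [Bg hBg bg] := C_bound hg.
have h : C (fun e => floop (fun a e => nth [::] e 2 ++ nth [::] e 0) (g e :: e) (f e) [::]).
  have h : C (fun e => floop (fun a e => nth [::] e 2 ++ nth [::] e 0) e (f (behead e)) [::]).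
    apply: (@C_floop _ _ _ _ _ (fun L => L)) => //.
    - by polyb.
    - exact: (C_tail hf).
    - exact: C_const.
    - by move=> a; apply: C_cat; exact: C_var.
    move=> a acc l e L hL /=; rewrite size_cat addnC leq_add2l.
    by apply: (@bound_all_nth _ (l :: e) L 1).
  exact: C_let hg h.
apply: C_ext h => e.
suff H : forall l acc, floop (fun _ e => nth [::] e 2 ++ nth [::] e 0) (g e :: e) l acc =
    flatten (nseq (size l) (g e)) ++ acc by rewrite H cats0.
elim=> //= a l IH acc; rewrite IH catA; congr (_ ++ _).
by elim: (size l) => [|n IHn] /=; rewrite ?cats0 // -catA IHn.
Qed.

End Library.

(** * Predicates decided by a computed flag *)

Section Dec.
Variables (A : finType) (tb : bool) (a0 : A).
Local Notation str := (seq A).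
Local Notation env := (seq str).
Local Notation C := (@C A tb).
Implicit Types (f g : env -> str) (e : env) (P Q : env -> Prop).

Definition flag (b : bool) : str := if b then [:: a0] else [::].

Definition Dec P := exists q : env -> bool, C (fun e => flag (q e)) /\ forall e, q e <-> P e.

Lemma Dec_ext P Q : (forall e, P e <-> Q e) -> Dec P -> Dec Q.
Proof. by move=> h [q [hq hr]]; exists q; split=> // e; rewrite hr. Qed.

Lemma Dec_comp j P F : Comp tb j F -> Dec P -> Dec (fun e => P (F e)).
Proof.
move=> hF [q [hq hr]]; exists (fun e => q (F e)); split=> [|e]; last exact: hr.
exact: Comp_comp hF hq.
Qed.

Lemma C_ifq f g (q : env -> bool) : C (fun e => flag (q e)) -> C f -> C g ->
  C (fun e => if q e then f e else g e).
Proof.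
move=> hq hf hg; have := Comp_case isSome hq hf hg; apply: Comp_ext => e.
by case: (q e).
Qed.

Lemma Dec_not P : Dec P -> Dec (fun e => ~ P e).
Proof.
move=> [q [hq hr]]; exists (fun e => ~~ q e); split=> [|e]; last by rewrite -hr; split=> /negP.
apply: C_ext (C_ifq hq (@C_const A tb [::]) (@C_const A tb [:: a0])) => e.
by case: (q e).
Qed.

Lemma Dec_and P Q : Dec P -> Dec Q -> Dec (fun e => P e /\ Q e).
Proof.
move=> [p [hp rp]] [q [hq rq]]; exists (fun e => p e && q e); split=> [|e].
  apply: C_ext (C_ifq hp hq (@C_const A tb [::])) => e; by case: (p e).
by rewrite -rp -rq; split=> /andP.
Qed.

Lemma Dec_imp P Q : Dec P -> Dec Q -> Dec (fun e => P e -> Q e).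
Proof.
move=> [p [hp rp]] [q [hq rq]]; exists (fun e => p e ==> q e); split=> [|e].
  apply: C_ext (C_ifq hp hq (@C_const A tb [:: a0])) => e; by case: (p e).
by rewrite -rp -rq; split=> /implyP.
Qed.

Lemma Dec_or P Q : Dec P -> Dec Q -> Dec (fun e => P e \/ Q e).
Proof.
move=> [p [hp rp]] [q [hq rq]]; exists (fun e => p e || q e); split=> [|e].
  apply: C_ext (C_ifq hp (@C_const A tb [:: a0]) hq) => e; by case: (p e).
by rewrite -rp -rq; split=> /orP.
Qed.

Lemma Dec_iff P Q : Dec P -> Dec Q -> Dec (fun e => P e <-> Q e).
Proof.
move=> hP hQ; apply: (Dec_ext (P := fun e => (P e -> Q e) /\ (Q e -> P e))) => // .
by apply: Dec_and; apply: Dec_imp.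
Qed.

(** A marker [a0] is put on [g e], and each letter of [f e] strikes out an equal letter below the
    marker; a mismatch empties the accumulator for good. The strings are equal when exactly the
    marker remains. *)
Lemma Dec_eq f g : C f -> C g -> Dec (fun e => f e = g e).
Proof.
move=> hf hg; pose F a (e : env) := if nth [::] e 0 is _ :: _ then
    (if behead (nth [::] e 0) is b :: _ then
       (if b == a then a0 :: behead (behead (nth [::] e 0)) else [::]) else [::]) else [::].
have hv : C (fun e => nth [::] e 0) by exact: C_var.
have h0 : C (fun e => [::]) by exact: C_const.
have h : C (fun e => floop F e (f e) (a0 :: g e)).
  apply: (@C_floop _ _ _ _ _ (fun _ => 0)) => //.
  - by polyb.
  - exact: C_push.
  - move=> a; apply: C_caseA => // _; apply: C_caseA => // [|b]; first exact: C_behead.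
    by case: eqP => _ //; apply: C_push; do 2!apply: C_behead.
  by move=> a [|b [|c acc]] l e L _ //=; rewrite /F /=; case: ifP => //= _; lia.
exists (fun e => f e == g e); split=> [|e]; last by split=> /eqP.
have h2 : C (fun e => if floop F e (f e) (a0 :: g e) is _ :: _ then
   (if behead (floop F e (f e) (a0 :: g e)) is _ :: _ then [::] else [:: a0]) else [::]).
  apply: C_caseA => // _; apply: C_caseA => //; first exact: C_behead.
  exact: C_const.
apply: C_ext h2 => e; rewrite /flag.
have hnil : forall l, floop F e l [::] = [::] by elim.
elim: (f e) (g e) => [|a l IH] [|b m] //=; rewrite /F /= ?hnil //.
rewrite eqseq_cons [a == b]eq_sym; case: (b =P a) => [_|_] /=; last by rewrite hnil.
exact: IH.
Qed.

Lemma Dec_size f g : C f -> C g -> Dec (fun e => size (f e) <= size (g e)).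
Proof.
move=> hf hg.
have h : C (fun e => floop (fun _ e => behead (nth [::] e 0)) e (f e) (a0 :: g e)).
  apply: (@C_floop _ _ _ _ _ (fun _ => 0)) => //.
  - by polyb.
  - exact: C_push.
  - by move=> a; apply: C_behead; exact: C_var.
  by move=> a acc l e L _ /=; rewrite size_behead; lia.
exists (fun e => size (f e) <= size (g e)); split=> [|e] //.
have := C_caseA h (fun _ => @C_const A tb [:: a0]) (@C_const A tb [::]).
apply: C_ext => e; set l := floop _ _ _ _; rewrite /flag.
suff : size l = (size (g e)).+1 - size (f e) by case: l => [|a l] /=; case: leqP => //; lia.
rewrite /l -[(size (g e)).+1]/(size (a0 :: g e)); elim: (f e) (a0 :: _) => [|a u IH] m /=.
  by rewrite subn0.
by rewrite IH size_behead; lia.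
Qed.

End Dec.

(** * Exhaustive search in bounded space *)

Inductive loops (T : Type) (c : pred T) (step : T -> T) (inv : pred T) : T -> T -> Prop :=
| LoopEnd x : ~~ c x -> inv x -> loops c step inv x x
| LoopStep x y : c x -> inv x -> loops c step inv (step x) y -> loops c step inv x y.

Lemma loops_iter T (c inv : pred T) step x y : loops c step inv x y -> exists N,
  [/\ forall n, n < N -> c (iter n step x), ~~ c (iter N step x), y = iter N step x &
      forall n, n <= N -> inv (iter n step x)].
Proof.
elim=> {x y} [x h1 h2|x y h1 h2 _ [N [a1 a2 a3 a4]]].
  by exists 0; split=> // n; rewrite leqn0 => /eqP ->.
by exists N.+1; rewrite iterSr; split=> // -[|n] // hn; rewrite iterSr; auto.
Qed.

Section Space.
Variables (A : finType) (a0 a1 : A).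
Hypothesis a01 : a0 != a1.
Local Notation str := (seq A).
Local Notation env := (seq str).
Local Notation C := (@C A false).
Local Notation Comp := (@Comp A false).
Local Notation Dec := (@Dec A false a0).
Local Notation flag := (flag a0).
Implicit Types (f g : env -> str) (e : env).

Lemma Comp_while j I S c F (Q : nat -> nat) : 0 < j -> polyb Q ->
  Comp j I -> Comp j S -> C c ->
  (forall e L, bound_all e L ->
     loops (fun x => c (x ++ e) != [::]) (fun x => S (x ++ e)) (fun x => bound_all x (Q L))
       (I e) (F e)) ->
  Comp j F.
Proof.
move=> hj hQ hI hS hc h; apply: Comp_loop hj hQ hI hS hc _ => e L hL st.
have [N [h1 h2 h3 h4]] := loops_iter (h e L hL).
by exists N; split=> //; apply/eqP; move: h2; rewrite negbK.
Qed.

Definition first_letter : A := head a0 (enum A).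
Definition next_letter (a : A) : option A := onth (enum A) (index a (enum A)).+1.

Lemma letter_ind (P : A -> Prop) : P first_letter ->
  (forall a b, next_letter a = Some b -> P a -> P b) -> forall a, P a.
Proof.
move=> h0 hS a; have ha : a \in enum A by rewrite mem_enum.
rewrite -(nth_index a0 ha); have := ha; rewrite -index_mem.
elim: (index a _) => [|i IH] hi; first by rewrite nth0.
apply: hS (IH (ltnW hi)); rewrite /next_letter index_uniq ?enum_uniq ?(ltnW hi) //.
by have := onthTE (enum A) i.+1; rewrite hi -(odflt_onth a0); case: onth.
Qed.

Lemma last_letter : exists a, next_letter a = None.
Proof.
have h : 0 < size (enum A) by rewrite -cardE; apply/card_gt0P; exists a0.
exists (nth a0 (enum A) (size (enum A)).-1); rewrite /next_letter index_uniq ?enum_uniq //.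
  by rewrite onth_default // prednK.
by rewrite prednK.
Qed.

(* Successor in bijective numeration, least significant letter first: iterating
   it from the empty string lists all strings, by nondecreasing length. *)
Fixpoint succ (l : str) : str :=
  if l is a :: l' then
    if next_letter a is Some b then b :: l' else first_letter :: succ l'
  else [:: first_letter].

Definition word (i : nat) := iter i succ [::].

Lemma word_onto s : exists i, word i = s.
Proof.
elim: s => [|a s [i <-]]; first by exists 0.
elim: i a => [|i IH]; apply: letter_ind.
- by exists 1.
- by move=> a b h [k hk]; exists k.+1; rewrite /word iterS -/(word k) hk /= h.
- have [a ha] := last_letter; have [k hk] := IH a.
  by exists k.+1; rewrite /word iterS -/(word k) hk /= ha.
- by move=> a b h [k hk]; exists k.+1; rewrite /word iterS -/(word k) hk /= h.
Qed.

Lemma size_succ l : size l <= size (succ l) <= (size l).+1.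
Proof. by clear a01; elim: l => //= a l IH; case: next_letter => [b|] //=; lia. Qed.

Lemma size_word_mono i k : i <= k -> size (word i) <= size (word k).
Proof.
clear a01; move=> /subnKC <-; elim: (k - i) => [|d IH]; first by rewrite addn0.
by have := size_succ (word (i + d)); rewrite addnS -[succ _]/(word (i + d).+1); lia.
Qed.

Lemma long_word n : exists i, n < size (word i).
Proof. by have [i hi] := word_onto (nseq n.+1 a0); exists i; rewrite hi size_nseq. Qed.

(** Lengths do not decrease along the enumeration, so the words of length at most [n] form an
    initial segment; this is the number of its elements. *)
Definition nwords n := ex_minn (long_word n).

Lemma nwordsP n i : (size (word i) <= n) = (i < nwords n).
Proof.
clear a01; rewrite /nwords; case: ex_minnP => m hm hmin; case: (ltnP i m) => h.
  by rewrite leqNgt; apply/negP => /hmin; lia.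
by have := size_word_mono h; lia.
Qed.

Lemma short_words n s : size s <= n <-> exists2 i, i < nwords n & word i = s.
Proof.
split=> [hs|[i hi <-]]; last by rewrite nwordsP.
by have [i hi] := word_onto s; exists i => //; rewrite -nwordsP hi.
Qed.

(** The successor is a transduction: state [a1] means a pending carry, state [a0] copies, and a
    carry left at the end becomes a new letter. *)
Lemma C_succ f : C f -> C (fun e => succ (f e)).
Proof.
move=> hf.
pose d (q a : A) : A * str := if q == a1 then
  (if next_letter a is Some b then (a0, [:: b]) else (a1, [:: first_letter])) else (a0, [:: a]).
pose fin (q : A) := if q == a1 then [:: first_letter] else [::].
apply: C_ext (C_transduce d fin a1 hf) => e.
have h0 l : transduce d fin a0 l = l.
  by elim: l => [|a l IH]; rewrite /= /d /fin (negbTE a01) //= IH.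
elim: (f e) => [|a l IH] /=; rewrite /d /fin eqxx //.
by case: next_letter => [b|] /=; rewrite ?h0 ?IH.
Qed.

Lemma flag_nil b : (flag b != [::]) = b.
Proof. by case: b. Qed.

Lemma C_drop2 f : C f -> C (fun e => f (behead (behead e))).
Proof. by move=> h; apply: (@C_tail _ _ (fun e => f (behead e))); exact: C_tail. Qed.

(** All candidates are tried one after the other in the space of a single one, with a flag
    remembering success. The loop stops at the first word that is too long, hence the bound
    [(Bf L).+1]. The exponential number of rounds is where [tb] has to be false. *)
Lemma Dec_ex (Q : str -> env -> Prop) f : C f ->
  Dec (fun e => Q (nth [::] e 0) (behead e)) ->
  Dec (fun e => exists s, size s <= size (f e) /\ Q s e).
Proof.
move=> hf [q [hq qP]]; have [Bf hBf bf] := C_bound hf.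
pose ex e := has (fun i => q (word i :: e)) (iota 0 (nwords (size (f e)))).
exists ex; split; last first.
  move=> e; split.
    move/hasP=> [i]; rewrite mem_iota add0n => /= hi /qP /= h.
    by exists (word i); rewrite nwordsP.
  move=> [s [/short_words [i hi <-] h]]; apply/hasP; exists i; first by rewrite mem_iota.
  by apply/qP.
(* The test must see the candidate and [e], but not the flag in second position. *)
have hq' : C (fun e => flag (q (take 1 e ++ drop 2 e))).
  apply: (@Comp_sel _ _ 1 (fun e => [:: flag (q e)]) (fun l => take 1 l ++ drop 2 l)) => //.
    by move=> s l; rewrite map_cat map_take map_drop.
  by move=> l x; rewrite mem_cat => /orP[/mem_take|/mem_drop].
have [c [hc cP]] := Dec_size a0 (C_var A false 0) (C_drop2 hf).
pose S (e : env) := [:: succ (nth [::] e 0);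
   if q (take 1 e ++ drop 2 e) then [:: a0] else nth [::] e 1].
pose R e := [:: word (nwords (size (f e))); flag (ex e)].
suff h : Comp 2 R by exact: (C_nth 1 h).
apply: (@Comp_while 2 (fun _ => [:: [::]; [::]]) S (fun e => flag (c e)) R (fun L => (Bf L).+1)) => //.
- by polyb.
- by do 2!apply: Comp_cons; try exact: C_const; exact: Comp_nil.
- apply: Comp_cons; first by apply: C_succ; exact: C_var.
  exact: (C_ifq hq' (@C_const A false [:: a0]) (C_var A false 1)).
move=> e L hL; set n := nwords (size (f e)).
suff h k : k <= n -> loops (fun x => flag (c (x ++ e)) != [::]) (fun x => S (x ++ e))
   (fun x => bound_all x (Bf L).+1)
   [:: word k; flag (has (fun i => q (word i :: e)) (iota 0 k))] (R e) by exact: (h 0 (leq0n _)).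
move: {2}(n - k) (erefl (n - k)) => m; elim: m k => [|m IH] k hm hk.
  have -> : k = n by lia.
  apply: LoopEnd.
    rewrite flag_nil; apply/negP => /cP /=; rewrite nwordsP ltnn //.
  have hs := bf e L hL; have [->|n0] := posnP n; first by rewrite /bound_all /=.
  have := size_succ (word n.-1); have := nwordsP (size (f e)) n.-1.
  rewrite -/n prednK // leqnn -[succ _]/(word n.-1.+1) prednK // /bound_all /= => h1 h2.
  rewrite andbT; apply/andP; split; last by case: has.
  by case/andP: h2 => _ h2; apply: leq_trans h2 _; rewrite ltnS; apply: leq_trans h1 hs.
have hkn : k < n by lia.
apply: LoopStep.
- by rewrite flag_nil; apply/cP => /=; rewrite nwordsP.
- have hs := bf e L hL; have := nwordsP (size (f e)) k; rewrite hkn /bound_all /= => h1.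
  rewrite andbT; apply/andP; split; last by case: has.
  exact: leq_trans (leq_trans h1 hs) (leqnSn _).
have := IH k.+1; rewrite -(addn1 k) iotaD has_cat /= addn1.
rewrite (_ : S _ = [:: word k.+1; flag (has (fun i => q (word i :: e)) (iota 0 k) || (q (word (0 + k) :: e) || false))]).
  by apply; lia.
rewrite /S /= !drop0 orbF add0n; case: (q _) => /=; rewrite ?orbT ?orbF //.
Qed.

Lemma Dec_all (Q : str -> env -> Prop) f : C f ->
  Dec (fun e => Q (nth [::] e 0) (behead e)) ->
  Dec (fun e => forall s, size s <= size (f e) -> Q s e).
Proof.
move=> hf hQ; apply: (Dec_ext (P := fun e => ~ exists s, size s <= size (f e) /\ ~ Q s e)); last first.
  by apply: Dec_not; apply: Dec_ex => //; apply: Dec_not.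
move: hQ => [q [_ qP]] e; split.
  move=> h s hs; have := qP (s :: e) => /= <-; apply/negPn/negP => hq; apply: h; exists s; split=> //.
  by have := qP (s :: e) => /= <-; apply/negP.
by move=> h [s [hs hn]]; apply: hn; exact: h.
Qed.

End Space.

(** * Savitch's theorem *)

Section Savitch.
Variables (A : finType) (a0 a1 : A).
Hypothesis a01 : a0 != a1.
Local Notation str := (seq A).
Local Notation env := (seq str).
Local Notation C := (@C A false).
Local Notation Comp := (@Comp A false).
Local Notation Dec := (@Dec A false a0).
Local Notation flag := (flag a0).
Local Notation succ := (succ a0).
Local Notation word := (word a0).
Local Notation nwords := (nwords a0).
Implicit Types (f g : env -> str) (e : env).

(* Self-delimiting code: [a1] announces a letter, [a0] ends the string. *)
Definition code (s : str) : str := flatten [seq [:: a1; a] | a <- s] ++ [:: a0].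

Fixpoint uncode (st : str) : str * str :=
  if st is a :: t then
    if a == a1 then (if t is b :: t' then (b :: (uncode t').1, (uncode t').2) else ([::], [::]))
    else ([::], st)
  else ([::], [::]).

Definition top st := (uncode st).1.
Definition below st := behead (uncode st).2.

Lemma uncode_code s r : uncode (code s ++ r) = (s, a0 :: r).
Proof.
elim: s => [|a s IH] /=; first by rewrite (negbTE a01).
by rewrite eqxx /= -/(code s) IH.
Qed.

Lemma top_code s r : top (code s ++ r) = s.
Proof. by rewrite /top uncode_code. Qed.

Lemma below_code s r : below (code s ++ r) = r.
Proof. by rewrite /below uncode_code. Qed.

Lemma size_code s : size (code s) = (2 * size s).+1.
Proof. by rewrite size_cat /= addn1; congr _.+1; elim: s => //= a s ->; lia. Qed.

Lemma C_code f : C f -> C (fun e => code (f e)).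
Proof. by move=> hf; apply: C_cat (C_flatmap _ hf) (C_const _ _). Qed.

Lemma C_uncode f : C f -> C (fun e => top (f e)) /\ C (fun e => below (f e)).
Proof.
move=> hf; have [Bf hBf bf] := C_bound hf.
pose R e := [:: rev (uncode (f e)).1; (uncode (f e)).2].
suff h : Comp 2 R.
  split; last exact: C_behead (C_nth 1 h).
  by apply: C_ext (C_rev (C_nth 0 h)) => e; rewrite /R /= revK.
pose S (e : env) := [:: if behead (nth [::] e 1) is b :: _ then b :: nth [::] e 0 else nth [::] e 0;
   behead (behead (nth [::] e 1))].
pose c (e : env) := if nth [::] e 1 is a :: _ then (if a == a1 then [:: a0] else [::]) else [::].
have h1 := @C_var A false 1; have h0 := @C_var A false 0.
apply: (@Comp_while _ 2 (fun e => [:: [::]; f e]) S c R Bf) => //.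
- exact: (Comp_cons (@C_const A false [::]) hf).
- apply: (@Comp_cons _ _ 1); last by do 2!apply: C_behead.
  by apply: C_caseA => //; [exact: C_behead|move=> b; exact: C_push].
- apply: C_caseA => // [a|]; last exact: C_const.
  by case: (a == a1); exact: C_const.
move=> e L hL; rewrite /R.
suff H st out : size out + size st <= Bf L ->
    loops (fun x => c (x ++ e) != [::]) (fun x => S (x ++ e)) (fun x => bound_all x (Bf L))
      [:: out; st] [:: catrev (uncode st).1 out; (uncode st).2] by apply: H; exact: bf.
have [m] := ubnP (size st); elim: m st out => // m IH [|a [|b t]] out /= hm hB.
- by apply: LoopEnd; rewrite /c /bound_all //= andbT; lia.
- case: eqP => [ha|/eqP ha].
    apply: LoopStep; rewrite /c /S /= ?ha ?eqxx //.
      by rewrite /bound_all /= andbT; apply/andP; split; lia.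
    by apply: LoopEnd; rewrite /c /bound_all //= !andbT; lia.
  apply: LoopEnd; rewrite /c /= ?(negbTE ha) // /bound_all /= andbT; apply/andP; split; lia.
case: eqP => [ha|/eqP ha].
  apply: LoopStep; rewrite /c /S /= ?ha ?eqxx //.
    by rewrite /bound_all /= andbT; apply/andP; split; lia.
  by apply: (IH t (b :: out)) => /=; lia.
apply: LoopEnd; rewrite /c /= ?(negbTE ha) // /bound_all /= andbT; apply/andP; split; lia.
Qed.

Fixpoint reach_in (R : str -> str -> Prop) n d u v : Prop :=
  if d is d'.+1 then exists m, size m <= n /\ (reach_in R n d' u m /\ reach_in R n d' m v)
  else R u v.

Section Machine.
Variables (q : env -> bool) (f g : env -> str).
Hypotheses (hq : C (fun e => flag (q e))) (hf : C f) (hg : C g).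

Fixpoint reachb e n d u v : bool :=
  if d is d'.+1 then
    has (fun i => reachb e n d' u (word i) && reachb e n d' (word i) v) (iota 0 (nwords n))
  else q (u :: v :: e).

Definition answer (b : bool) : str := if b then [:: a1] else [::].

(** A pending call: its end points, the midpoint under trial, and [ph], nonempty once the first half
    is confirmed. *)
Definition frame u v m ph (st : str) := code u ++ code v ++ code m ++ code ph ++ st.

(* State: mode, u, v, stack, remaining depth. Mode [a0] calls reach(u, v); modes
   [a1] and the empty string return true and false to the topmost frame. *)
Definition sav_cond (e : env) : str := if nth [::] e 0 is a :: _ then
  (if a == a0 then [:: a0] else nth [::] e 3) else nth [::] e 3.

Definition sav_step (e : env) : env :=
  let md := nth [::] e 0 in let u := nth [::] e 1 in let v := nth [::] e 2 in
  let st := nth [::] e 3 in let d := nth [::] e 4 in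
  let e' := behead (behead (behead (behead (behead e)))) in
  let fu := top st in let s1 := below st in let fv := top s1 in let s2 := below s1 in
  let fm := top s2 in let s3 := below s2 in let ph := top s3 in let s4 := below s3 in
  let fn := succ fm in
  let retry := if (size fn <= size (f e')) then
      [:: [:: a0]; fu; fn; frame fu fv fn [::] s4; d] else [:: [::]; [::]; [::]; s4; a0 :: d] in
  if md is a :: _ then
    if a == a0 then
      if d is _ :: _ then [:: [:: a0]; u; [::]; frame u v [::] [::] st; behead d]
      else [:: if q (u :: v :: e') then [:: a1] else [::]; [::]; [::]; st; d]
    else if ph is _ :: _ then [:: [:: a1]; [::]; [::]; s4; a0 :: d]
    else [:: [:: a0]; fm; fv; frame fu fv fm [:: a0] s4; d]
  else retry.

Lemma Comp_list5 f0 f1 f2 f3 f4 : C f0 -> C f1 -> C f2 -> C f3 -> C f4 ->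
  Comp 5 (fun e => [:: f0 e; f1 e; f2 e; f3 e; f4 e]).
Proof.
by move=> h0 h1 h2 h3 h4; do 4![apply: Comp_cons => //].
Qed.

Lemma C_frame fu fv fm fp fs : C fu -> C fv -> C fm -> C fp -> C fs ->
  C (fun e => frame (fu e) (fv e) (fm e) (fp e) (fs e)).
Proof. by move=> h1 h2 h3 h4 h5; do 4!(apply: C_cat; first exact: C_code). Qed.

Lemma Comp_step : Comp 5 sav_step.
Proof.
have hv i : C (fun e => nth [::] e i) by exact: C_var.
have hc l : C (fun _ => l) by exact: C_const.
pose st e : str := nth [::] e 3.
have hs0 : C st by exact: hv.
have [hu h1] := C_uncode hs0; have [hfv h2] := C_uncode h1.
have [hm h3] := C_uncode h2; have [hp h4] := C_uncode h3.
have hsm := C_succ a01 hm.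
have hf5 : C (fun e => f (behead (behead (behead (behead (behead e)))))).
  exact: (C_drop2 (C_drop2 (C_tail hf))).
have [qs [hqs qsP]] := Dec_size a0 hsm hf5.
have hpush g' : C g' -> C (fun e => a0 :: g' e) by exact: C_push.
have hqe : C (fun e => flag (q (nth [::] e 1 :: nth [::] e 2 ::
    behead (behead (behead (behead (behead e))))))).
  have h : C (fun e => flag (q (take 2 e ++ drop 7 e))).
    apply: (@Comp_sel _ _ 1 (fun e => [:: flag (q e)]) (fun l => take 2 l ++ drop 7 l)
       (fun l => take 2 l ++ drop 7 l)) => //.
      by move=> s l; rewrite map_cat map_take map_drop.
    by move=> l x; rewrite mem_cat => /orP[/mem_take|/mem_drop].
  have := Comp_letn (Comp_cons (hv 1) (hv 2)) h; apply: C_ext => e /=.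
  by rewrite take0 -!drop1 !drop_drop.
apply: Comp_caseA => // [a|].
  case: (a == a0).
    apply: Comp_caseA => // [b|].
      apply: Comp_list5 => //; first by apply: C_frame.
      exact: C_behead (hv 4).
    apply: Comp_list5 => //; exact: (C_ifq hqe (hc [:: a1]) (hc [::])).
  apply: Comp_caseA => // [b|]; apply: Comp_list5 => //; first exact: hpush (hv 4).
  by apply: C_frame.
have := Comp_case isSome hqs (Comp_list5 (hc [:: a0]) hu hsm (C_frame hu hfv hsm (hc [::]) h4) (hv 4))
  (Comp_list5 (hc [::]) (hc [::]) (hc [::]) h4 (hpush _ (hv 4))).
apply: Comp_ext => e.
have -> : isSome (ohead (flag (qs e))) = (size (succ (top (below (below (st e))))) <=
     size (f (behead (behead (behead (behead (behead e))))))).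
  by apply/idP/idP; [case hh: (qs e) => //= _; exact/qsP|move=> /qsP ->].
by [].
Qed.

Lemma a10 : (a1 == a0) = false.
Proof. by rewrite eq_sym (negbTE a01). Qed.

Lemma step_answer b x y u v m ph st d e :
  sav_step ([:: answer b; x; y; frame u v m ph st; d] ++ e) =
  if b then (if ph is _ :: _ then [:: answer true; [::]; [::]; st; a0 :: d]
             else [:: [:: a0]; m; v; frame u v m [:: a0] st; d])
  else if size (succ m) <= size (f e)
       then [:: [:: a0]; u; succ m; frame u v (succ m) [::] st; d]
       else [:: answer false; [::]; [::]; st; a0 :: d].
Proof.
rewrite /sav_step /= /frame !(below_code, top_code).
by case: b => /=; rewrite ?a10.
Qed.

Lemma cond_answer b x y u v m ph st d e :
  sav_cond ([:: answer b; x; y; frame u v m ph st; d] ++ e) != [::].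
Proof.
have h : frame u v m ph st != [::].
  have : 0 < size (frame u v m ph st) by rewrite /frame size_cat size_code addSn.
  by case: frame.
by rewrite /sav_cond; case: b; rewrite /= ?a10.
Qed.

Definition frame_cost X := 4 * (2 * X).+1.

Lemma size_frame X (u v m ph st : str) : size u <= X -> size v <= X -> size m <= X -> size ph <= X ->
  size (frame u v m ph st) <= frame_cost X + size st.
Proof. by move=> h1 h2 h3 h4; rewrite /frame /frame_cost; do 4!rewrite size_cat size_code; lia. Qed.

Section Eval.
Variables (e : env) (X B : nat).
Hypotheses (hX : size (f e) < X) (hB : X <= B).
Let n := size (f e).
Local Notation run := (loops (fun x => sav_cond (x ++ e) != [::])
  (fun x => sav_step (x ++ e)) (fun x => bound_all x B)).

Lemma inv_ok (md u v st : str) d : size md <= X -> size u <= X -> size v <= X -> size st <= B -> d <= B ->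
  bound_all [:: md; u; v; st; nseq d a0] B.
Proof.
move=> h1 h2 h3 h4 h5; rewrite /bound_all /= size_nseq h4 h5.
by rewrite (leq_trans h1 hB) (leq_trans h2 hB) (leq_trans h3 hB).
Qed.

Lemma size_word_X i : i < nwords n -> size (word i) <= X.
Proof. by rewrite -nwordsP => h; apply: leq_trans h (ltnW hX). Qed.

(** Continuation form: what the machine reaches from the returned answer, it reaches from the call.
    Nested calls then compose without cutting runs apart, and the space hypothesis charges one frame
    to each of the [d] levels still to be opened. *)
Lemma eval_call d (u v st : str) y : size u <= X -> size v <= X ->
  size st + d * frame_cost X <= B -> d <= B ->
  run [:: answer (reachb e n d u v); [::]; [::]; st; nseq d a0] y ->
  run [:: [:: a0]; u; v; st; nseq d a0] y.
Proof.
have X1 : 0 < X by apply: leq_ltn_trans hX.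
elim: d u v st y => [|d IH] u v st y hu hv hst hd hy.
  apply: LoopStep; first by rewrite /sav_cond /= eqxx.
    by apply: inv_ok => //; lia.
  by rewrite /sav_step /= eqxx.
have hst' m ph : size m <= X -> size ph <= X ->
    size (frame u v m ph st) + d * frame_cost X <= B.
  by move=> hm hp; have := size_frame st hu hv hm hp; move: hst; rewrite mulSn; lia.
have hst2 m ph : size m <= X -> size ph <= X -> size (frame u v m ph st) <= B.
  by move=> hm hp; have := hst' m ph hm hp; lia.
have hst3 : size st <= B by lia.
apply: LoopStep; first by rewrite /sav_cond /= eqxx.
  exact: inv_ok.
rewrite /sav_step /= eqxx.
have N0 : 0 < nwords n by rewrite -nwordsP.
rewrite /= in hy.
(* Induction on the number of midpoints left after [word i]; [retry] in both cases is the reaction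
   to a half that failed. *)
suff H k i : i + k.+1 = nwords n ->
    run [:: answer (has (fun i => reachb e n d u (word i) && reachb e n d (word i) v)
         (iota i k.+1)); [::]; [::]; st; nseq d.+1 a0] y ->
    run [:: [:: a0]; u; word i; frame u v (word i) [::] st; nseq d a0] y.
  by apply: (H (nwords n).-1 0); rewrite ?add0n prednK.
elim: k i => [|k IHk] i hi hy'.
  have hiN : i < nwords n by lia.
  have hm := size_word_X hiN.
  have retry ph : size ph <= X ->
      run [:: answer false; [::]; [::]; st; nseq d.+1 a0] y ->
      run [:: answer false; [::]; [::]; frame u v (word i) ph st; nseq d a0] y.
    move=> hp hr; apply: LoopStep; first exact: cond_answer.
      by apply: inv_ok => //; [exact: hst2|lia].
    rewrite step_answer (_ : _ <= _ = false) //.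
    by rewrite -[succ _]/(word i.+1) nwordsP -/n -hi addn1 ltnn.
  apply: (IH) => //; [exact: hst'|lia|].
  rewrite /= orbF in hy'; case: (reachb e n d u (word i)) hy' => [|] hy'; last exact: retry.
  apply: LoopStep; first exact: cond_answer.
    by apply: inv_ok => //; [exact: hst2|lia].
  rewrite step_answer; apply: (IH) => //; [exact: hst'|lia|].
  case: (reachb e n d (word i) v) hy' => [|] hy'; last exact: retry.
  apply: LoopStep; first exact: cond_answer.
    by apply: inv_ok => //; [exact: hst2|lia].
  by rewrite step_answer.
have hiN : i.+1 < nwords n by lia.
have hm := size_word_X (ltnW hiN).
have retry ph : size ph <= X ->
    run [:: answer (has (fun i => reachb e n d u (word i) && reachb e n d (word i) v)
         (iota i.+1 k.+1)); [::]; [::]; st; nseq d.+1 a0] y ->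
    run [:: answer false; [::]; [::]; frame u v (word i) ph st; nseq d a0] y.
  move=> hp hr; apply: LoopStep; first exact: cond_answer.
    by apply: inv_ok => //; [exact: hst2|lia].
  rewrite step_answer (_ : _ <= _ = true); first by rewrite -[succ (word i)]/(word i.+1); apply: IHk => //; lia.
  by rewrite -[succ _]/(word i.+1) nwordsP -/n hiN.
apply: (IH) => //; [exact: hst'|lia|].
rewrite -[k.+2]add1n iotaD has_cat addn1 /= orbF in hy'.
case: (reachb e n d u (word i)) hy' => [|] hy'; last exact: retry.
apply: LoopStep; first exact: cond_answer.
  by apply: inv_ok => //; [exact: hst2|lia].
rewrite step_answer; apply: (IH) => //; [exact: hst'|lia|].
case: (reachb e n d (word i) v) hy' => [|] hy'; last exact: retry.
apply: LoopStep; first exact: cond_answer.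
  by apply: inv_ok => //; [exact: hst2|lia].
by rewrite step_answer.
Qed.

End Eval.

(** The product in the space bound is the number of levels times the size of a frame, the square of
    Savitch's theorem. *)
Lemma C_reachb u v : C u -> C v ->
  C (fun e => flag (reachb e (size (f e)) (size (g e)) (u e) (v e))).
Proof.
move=> hu hv; have [Bu hBu bu] := C_bound hu; have [Bv hBv bv] := C_bound hv.
have [Bf hBf bf] := C_bound hf; have [Bg hBg bg] := C_bound hg.
pose X L := (Bf L + Bu L + Bv L).+1.
pose R e := [:: answer (reachb e (size (f e)) (size (g e)) (u e) (v e)); [::]; [::]; [::];
  nseq (size (g e)) a0].
suff h : Comp 5 R.
  have := C_caseA (C_nth 0 h) (fun _ => @C_const A false [:: a0]) (@C_const A false [::]).
  by apply: C_ext => e /=; case: reachb.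
have hc : C sav_cond.
  have h0 := C_var A false 0; have h3 := C_var A false 3.
  by apply: C_caseA => // a; case: (a == a0) => //; exact: C_const.
have hI : Comp 5 (fun e => [:: [:: a0]; u e; v e; [::]; nseq (size (g e)) a0]).
  apply: Comp_list5 => //; try exact: C_const.
  by apply: C_ext (C_map (fun _ => a0) hg) => e; elim: (g e) => //= a l ->.
apply: (Comp_while _ _ hI Comp_step hc (Q := fun L => X L + Bg L * frame_cost (X L) + Bg L)) => //.
  by rewrite /X /frame_cost; polyb.
move=> e L hL; have b1 := bu e L hL; have b2 := bv e L hL; have b3 := bf e L hL.
have b4 := bg e L hL.
have b5 : size (g e) * frame_cost (X L) <= Bg L * frame_cost (X L) by rewrite leq_mul2r b4 orbT.
apply: (@eval_call e (X L)) => /=; rewrite ?add0n; try first [lia | rewrite /X; lia].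
apply: LoopEnd; first by rewrite /sav_cond; case: reachb => //=; rewrite ?a10.
by apply: (@inv_ok (X L)) => //; [lia|by case: reachb => //; rewrite /X|lia].
Qed.

End Machine.

Lemma Dec_reach (R : str -> str -> env -> Prop) f g u v : C f -> C g -> C u -> C v ->
  Dec (fun e => R (nth [::] e 0) (nth [::] e 1) (behead (behead e))) ->
  Dec (fun e => reach_in (fun x y => R x y e) (size (f e)) (size (g e)) (u e) (v e)).
Proof.
move=> hf hg hu hv [q [hq qP]].
exists (fun e => reachb q e (size (f e)) (size (g e)) (u e) (v e)); split; first exact: C_reachb.
move=> e; elim: (size (g e)) (u e) (v e) => [|d IH] x y /=; first exact: (qP (x :: y :: e)).
split.
  move=> /hasP[i]; rewrite mem_iota add0n => /= hi /andP[/IH h1 /IH h2].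
  by exists (word i); rewrite nwordsP.
move=> [m [/(short_words a0) [i hi <-] [/IH h1 /IH h2]]].
by apply/hasP; exists i; rewrite ?mem_iota //= h1.
Qed.

End Savitch.

(** * Growth up to a tower of exponentials over a polynomial *)

Lemma leq_expk k a b : a <= b -> expk k a <= expk k b.
Proof. by move=> h; elim: k => //= k IH; rewrite leq_exp2l. Qed.

Lemma expk_ge k a : a <= expk k a.
Proof. by elim: k => //= k IH; apply: leq_trans IH (ltnW (ltn_expl _ _)). Qed.

Lemma expk_add j k a : expk (j + k) a = expk j (expk k a).
Proof. by elim: j => //= j ->. Qed.

(** A power of a tower is absorbed by the polynomial at its bottom: an exponent becomes a factor one
    level below, and that factor is again dominated by a power. *)
Lemma expk_pow k a : exists c, forall X, (expk k X + 2) ^ a <= expk k ((X + 2) ^ c).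
Proof.
elim: k a => [|k IH] a; first by exists a.
have [c hc] := IH a.+1; exists c => X /=; set E := expk k X.
have h1 : 2 ^ E + 2 <= 2 ^ (E + 2).
  have h0 : 0 < 2 ^ E by rewrite expn_gt0.
  by rewrite expnD; lia.
apply: leq_trans (_ : (2 ^ (E + 2)) ^ a <= _); first by case: (a) => // a'; rewrite leq_exp2r.
rewrite -expnM leq_exp2l //; apply: leq_trans (hc X); rewrite expnS leq_mul2l.
apply/orP; right; apply: leq_trans (_ : 2 ^ a <= _); first exact: ltnW (ltn_expl _ _).
by case: (a) => // a'; rewrite leq_exp2r // leq_addl.
Qed.

(* [growth 0] is [polyb]. *)
Definition growth k (B : nat -> nat) := exists a, forall L, B L <= expk k ((L + 2) ^ a).

Lemma growth_le k (B B' : nat -> nat) : (forall L, B L <= B' L) -> growth k B' -> growth k B.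
Proof. by move=> h [a ha]; exists a => L; apply: leq_trans (h L) (ha L). Qed.

Lemma growth_comp j k B1 B2 : growth j B1 -> growth k B2 -> growth (j + k) (fun L => B1 (B2 L)).
Proof.
move=> [a ha] [b hb]; have [c hc] := expk_pow k a; exists (b.+2 * c) => L.
apply: leq_trans (ha _) _; rewrite expk_add; apply: leq_expk.
apply: leq_trans (_ : (expk k ((L + 2) ^ b) + 2) ^ a <= _).
  by case: (a) => // a'; rewrite leq_exp2r // leq_add2r.
apply: leq_trans (hc _) _; apply: leq_expk; rewrite expnM.
case: (c) => // c'; rewrite leq_exp2r // !expnS.
have : 0 < (L + 2) ^ b by rewrite expn_gt0 addn2.
by nia.
Qed.

Lemma growth_polyb k B : polyb B -> growth k B.
Proof. by move=> [a ha]; exists a => L; apply: leq_trans (ha L) (expk_ge _ _). Qed.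

Lemma growth_max k B1 B2 : growth k B1 -> growth k B2 -> growth k (fun L => maxn (B1 L) (B2 L)).
Proof.
move=> [a ha] [b hb]; exists (maxn a b) => L; rewrite geq_max.
by apply/andP; split; [apply: leq_trans (ha L) _|apply: leq_trans (hb L) _];
  apply: leq_expk; rewrite addn2; apply: leq_pexp2l; rewrite ?leq_maxl ?leq_maxr.
Qed.

Lemma growth_poly k B G : growth k B -> polyb G -> growth k (fun L => G (B L)).
Proof. by move=> h1 h2; apply: (growth_comp (j := 0)). Qed.

Lemma growth_add k B1 B2 : growth k B1 -> growth k B2 -> growth k (fun L => B1 L + B2 L).
Proof.
move=> h1 h2; apply: growth_le (growth_poly (growth_max h1 h2) (_ : polyb (fun x => x + x))).
  by move=> L; rewrite leq_add ?leq_maxl ?leq_maxr.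
by polyb.
Qed.

Lemma growth_mul k B1 B2 : growth k B1 -> growth k B2 -> growth k (fun L => B1 L * B2 L).
Proof.
move=> h1 h2; apply: growth_le (growth_poly (growth_max h1 h2) (_ : polyb (fun x => x * x))).
  by move=> L; rewrite leq_mul ?leq_maxl ?leq_maxr.
by polyb.
Qed.

Lemma growth_weak j k B : growth j B -> growth (j + k) B.
Proof. by move=> h; apply: (growth_comp h); apply: growth_polyb; polyb. Qed.

Lemma growth_succ k B : growth k B -> growth k (fun L => (B L).+1).
Proof. by move=> h; apply: growth_poly h _; polyb. Qed.

Lemma pow_peval a : exists p, forall n, (n + 2) ^ a <= peval p n.
Proof.
case: a => [|a]; first by exists [:: 1] => n /=; lia.
have hp m c n : peval (nseq m 0 ++ [:: c]) n = n ^ m * c.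
  by elim: m => [|m IH] /=; rewrite ?add0n ?IH ?expnS; lia.
(* For positive [n] the top coefficient suffices, as [n + 2 <= 3 * n]; the constant term serves
   [n = 0]. *)
exists (2 ^ a.+1 :: (nseq a 0 ++ [:: 3 ^ a.+1])) => n /=; rewrite hp mulnA -expnS -expnMn.
case: n => [|n]; first by rewrite add0n leq_addr.
by apply: leq_trans (leq_addl _ _); rewrite leq_exp2r //; lia.
Qed.

(** * Padding the input with a tower of exponentials *)

Section Levels.
Variables (A : finType) (a0 a1 : A).
Hypothesis a01 : a0 != a1.
Local Notation str := (seq A).
Local Notation env := (seq str).

Definition Compk k j (F : env -> env) := exists p B, growth k B /\ computes false j p F B.

Lemma Compk_let j k m i (G F : env -> env) : Compk k m G -> Compk j i F ->
  Compk (j + k) i (fun e => F (G e ++ e)).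
Proof.
move=> [p1 [B1 [h1 c1]]] [p2 [B2 [h2 c2]]]; do 2!eexists.
split; last exact: computes_let c1 c2.
have hB1 : growth (j + k) B1 by rewrite addnC; exact: growth_weak.
have hB2 : growth (j + k) (fun L => B2 (B1 L + L)).
  by apply: growth_comp h2 _; apply: growth_add h1 _; apply: growth_polyb; polyb.
have hc n : growth (j + k) (fun _ => n) by apply: growth_polyb; polyb.
rewrite /let_cost; repeat first [assumption | apply: hc | apply: growth_add
  | apply: growth_succ | apply: growth_mul].
Qed.

Lemma Compk_ext k j F G : (forall e, F e = G e) -> Compk k j F -> Compk k j G.
Proof. by move=> h [p [B [hB hc]]]; exists p, B; split=> //; apply: computes_eq hc. Qed.

(** One doubling per letter of the argument. The states outgrow every polynomial, so [computes_loop]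
    is applied directly, with an exponential [Q]. *)
Lemma Compk_pow2 : Compk 1 1 (fun e => [:: nseq (2 ^ size (nth [::] e 0)) a0]).
Proof.
pose I (e : env) := [:: [:: a0]; nth [::] e 0].
pose S (e : env) := [:: nth [::] e 0 ++ nth [::] e 0; behead (nth [::] e 1)].
have [pI [BI [hBI hI]]] : Comp false 2 I.
  exact: Comp_cons (C_const _ _) (C_var _ _ _).
have [pS [BS [hBS hS]]] : Comp false 2 S.
  by apply: Comp_cons (C_cat (C_var _ _ _) (C_var _ _ _)) (C_behead (C_var _ _ _)).
have [pc [Bc [hBc hc]]] := C_var A false 1.
pose F (e : env) := [:: nseq (2 ^ size (nth [::] e 0)) a0; [::]].
have hF e L : bound_all e L -> let st n := iter n (fun x => S (x ++ e)) (I e) in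
     exists N, [/\ forall n, n < N -> nth [::] (st n ++ e) 1 != [::], nth [::] (st N ++ e) 1 = [::],
       F e = st N, forall n, n <= N -> bound_all (st n) (2 ^ L + L) & false -> N <= 2 ^ L + L].
  move=> hL st; have hsz := bound_all_nth 0 hL; exists (size (nth [::] e 0)).
  have hst n : n <= size (nth [::] e 0) -> st n = [:: nseq (2 ^ n) a0; drop n (nth [::] e 0)].
    elim: n => [|n IH] hn; first by rewrite /st /= drop0.
    rewrite /st iterS -/(st n) IH 1?ltnW // /S /= -drop1 drop_drop add1n.
    by rewrite -nseqD addnn -mul2n -expnS.
  split=> //.
  - move=> n hn; rewrite hst ?(ltnW hn) //=.
    have : 0 < size (drop n (nth [::] e 0)) by rewrite size_drop subn_gt0.
    by case: drop.
  - by rewrite hst //= drop_size.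
  - by rewrite hst // drop_size.
  move=> n hn; rewrite hst // /bound_all /= size_nseq size_drop andbT.
  have : 2 ^ n <= 2 ^ L by rewrite leq_exp2l // (leq_trans hn).
  by move=> h; apply/andP; split; lia.
have := computes_loop (isT : 0 < 2) hI hS hc hF.
set B := loop_cost _ _ _ _ _ _ => hcomp.
have hB : growth 1 B.
  have g1 : growth 1 (fun L => 2 ^ L + L).
    apply: growth_add; last by apply: growth_polyb; polyb.
    by exists 1 => L /=; rewrite expn1 leq_exp2l // leq_addr.
  have g0 : growth 1 (fun L => L) by apply: growth_polyb; polyb.
  have g2 : growth 1 (fun L => BI L) by apply: growth_polyb.
  have g3 : growth 1 (fun L => Bc (2 ^ L + L + L)) by apply: growth_poly hBc; exact: growth_add.
  have g4 : growth 1 (fun L => BS (2 ^ L + L + L)) by apply: growth_poly hBS; exact: growth_add.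
  have hconst n : growth 1 (fun _ => n) by apply: growth_polyb; polyb.
  rewrite /B /loop_cost; repeat first [assumption | apply: hconst | apply: growth_add
    | apply: growth_succ | apply: growth_mul].
have h1 : Compk 1 2 F by exists (loop_prog 2 pI pS pc), B.
have h2 : Compk 0 1 (fun e => [:: nth [::] e 0]) by exact: C_var.
by have := Compk_let h1 h2; apply: Compk_ext => e.
Qed.

Lemma Compk_expk k (h : env -> str) : @C A false h ->
  Compk k 1 (fun e => [:: nseq (expk k (size (h e))) a0]).
Proof.
move=> hh; elim: k => [|k IH].
  have h0 : @C A false (fun e => nseq (size (h e)) a0).
    by apply: C_ext (C_map (fun _ => a0) hh) => e; elim: (h e) => //= a l ->.
  exact: h0.
by apply: Compk_ext (Compk_let IH Compk_pow2) => e /=; rewrite size_nseq.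
Qed.

(** Padding: [P] is decided in space polynomial in an environment that contains the long string, and
    a polynomial of a tower of height [k] is again bounded by such a tower over a polynomial. *)
Lemma in_kEXPSPACE_intro k (L : str -> Prop) (P : env -> Prop) (h : env -> str) :
  @C A false h -> Dec false a0 P ->
  (forall x, L x <-> P [:: nseq (expk k (size (h [:: x]))) a0; x]) -> in_kEXPSPACE k L.
Proof.
move=> hh [q [hq qP]] hL.
have [p [B [[a hB] hc]]] : Compk k 1 (fun e => [:: flag a0 (q (nseq (expk k (size (h e))) a0 :: e))]).
  by have := Compk_let (Compk_expk k hh) (_ : Compk 0 1 (fun e => [:: flag a0 (q e)])); apply.
(* [movrev] brings the first input letter to the top. [Pop 3] meets an empty stack; it makes sure
   that the machine has a track for register 2, where [acc] reads the verdict. *)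
pose c := Then (@movrev A 0 1) (Then (p [:: 1] 2) (Pop 3)).
have hR : 3 <= maxreg c by rewrite /c /= !leq_max leqnn !orbT.
pose acc (x : column A (maxreg c)) := isSome (x (inord 2)).
have [cs hcs] : exists cs, forall n, n + B n < expk k (peval cs n).
  have hB' : growth k (fun n => (n + B n).+1).
    apply: growth_succ; apply: growth_add; last by exists a.
    by apply: growth_polyb; polyb.
  have [a' ha'] := hB'; have [cs hcs] := pow_peval a'.
  by exists cs => n; apply: leq_trans (ha' n) (leq_expk _ (hcs n)).
exists (letter A (maxreg c)), (letter_of c None), (fun x => letter_of c (Some x)),
  (@cmd_tm A c acc), cs.
split; first exact: (@letter_of_embedding _ _ id).
move=> w; set M := size w + B (size w).
set s1 := upd (upd (input_store w) 1 w) 0 [::].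
have e1 : execb false M (movrev A 0 1) (input_store w) (unit_cost A * (size w).+1) s1.
  have := @execb_movrev A false M 0 1 (input_store w) isT.
  rewrite /input_store upd_same upd_other // size_rev addn0 catrevE revK cats0.
  by apply; exact: leq_addr.
have hs1 : empty_from s1 2 by move=> [|[|i]].
have hm1 : map s1 [:: 1] = [:: w] by [].
have := hc [:: 1] 2 s1 (size w) M isT hs1; rewrite hm1 /bound_all /= leqnn => /(_ isT (leq_addl _ _)).
move=> [_ _ e2]; set b := q _ in e2.
have e3 := execb_pop false M 3 (view s1 2 [:: flag a0 b]).
have [t _ ex] := execb_then e1 (execb_then e2 e3).
rewrite -{1}(map_id w) in ex.
have [t' _ [hrun hheads]] := cmd_tm_run (g := id) acc ex (leq_addr _ _).
have hacc : acc [ffun r => onth (rev (upd (view s1 2 [:: flag a0 b]) 3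
     (behead (view s1 2 [:: flag a0 b] 3)) (val r))) 0] = b.
  rewrite /acc ffunE /= inordK; last by lia.
  by rewrite upd_other // -[in view _ _ _ 2](addn0 2) view_at /=; case: (b).
rewrite hacc in hrun.
split.
  move=> t0; apply: leq_ltn_trans (hcs (size w)).
  case: (leqP t0 t') => ht; first exact: hheads.
  rewrite -(subnKC (ltnW ht)) run_add hrun run_halted //.
  by rewrite /halted /=; case: (b); rewrite eqxx ?orbT.
exists t'; rewrite hrun; split; first by rewrite /halted /=; case: (b); rewrite eqxx ?orbT.
rewrite hL -qP /=; rewrite -/b; split; first by case.
by move=> ->.
Qed.

End Levels.

(** * Membership *)

Section TilingStrings.

Definition b0 : 'I_4 := inord 0.
Definition b1 : 'I_4 := inord 1.
Local Notation str := (seq 'I_4).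

Lemma neq_inord i j : i < 4 -> j < 4 -> (inord i == inord j :> 'I_4) = (i == j).
Proof.
move=> hi hj; apply/eqP/eqP => [/(congr1 val)|->] //.
by rewrite /= !inordK.
Qed.

Definition is_bit (a : 'I_4) := (a == b0) || (a == b1).

Lemma bit_sharp a : is_bit a -> (a == s_sharp) = false.
Proof. by case/orP=> /eqP ->; rewrite /b0 /b1 /s_sharp neq_inord. Qed.

Lemma bit_mark a : is_bit a -> (a == s_mark) = false.
Proof. by case/orP=> /eqP ->; rewrite /b0 /b1 /s_mark neq_inord. Qed.

Definition bit_val (s : str) := foldl (fun n a => n.*2 + (a == b1)) 0 s.

Lemma bin_aux_bits f n : all is_bit (bin_aux f n).
Proof.
elim: f n => //= f IH n; case: ltnP => h.
  by rewrite /= andbT /is_bit /b0 /b1; case: n h => [|[|]] // _; rewrite eqxx ?orbT.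
by rewrite all_rcons IH andbT /is_bit /b0 /b1; case: odd; rewrite eqxx ?orbT.
Qed.

Lemma bin_bits n : all is_bit (bin n).
Proof. exact: bin_aux_bits. Qed.

Lemma bin_aux_val f n : n < f -> bit_val (bin_aux f n) = n.
Proof.
rewrite /bit_val; elim: f n => // f IH n hn /=; case: ltnP => h.
  by case: n h {hn} => [|[|]] // _; rewrite /= /b1 neq_inord.
rewrite foldl_rcons IH; last by lia.
rewrite /b1 neq_inord ?(odd_double_half n) 1?addnC //; last by case: odd.
by rewrite (_ : (odd n == 1 :> nat) = odd n :> nat) ?odd_double_half //; case: odd.
Qed.

Lemma bin_val n : bit_val (bin n) = n.
Proof. exact: bin_aux_val. Qed.

Lemma bin_inj : injective bin.
Proof. exact: can_inj bin_val. Qed.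

Lemma bin_aux_fuel f f' n : n < f -> n < f' -> bin_aux f n = bin_aux f' n.
Proof.
elim: f f' n => // f IH [|f'] n //= h h'; case: ltnP => // h2.
by rewrite (IH f') //; lia.
Qed.

Lemma bin_rec n : 1 < n -> bin n = rcons (bin n./2) (inord (odd n)).
Proof.
move=> h; transitivity (rcons (bin_aux n n./2) (inord (odd n))); first by rewrite /bin /= ltnNge h.
by rewrite (@bin_aux_fuel n (n./2).+1) //; lia.
Qed.

Lemma bin_small n : n < 2 -> bin n = [:: inord n].
Proof. by rewrite /bin /= => ->. Qed.

(** Without leading zeros: being the code of some number becomes a condition on the letters. *)
Definition canonical (s : str) := all is_bit s /\ (s = [:: b0] \/ ohead s = Some b1).

Lemma canonical_bin n : canonical (bin n).
Proof.
split; first exact: bin_bits.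
have [m] := ubnP n; elim: m n => // m IH n hm.
case: (ltnP n 2) => h.
  by rewrite bin_small //; case: n h {hm} => [|[|]] // _; [left|right].
rewrite bin_rec //; right; have hv := bin_val n./2.
case: (IH n./2); [lia|move=> e|by case: (bin n./2)].
by move: hv; rewrite e /bit_val /= /b0 /b1 neq_inord //=; lia.
Qed.

Lemma bin_nonempty n : exists a s, bin n = a :: s.
Proof. by have [_] := canonical_bin n; case: (bin n) => [|a s] [] // _; exists a, s. Qed.

Lemma canonicalP s : canonical s -> s = bin (bit_val s).
Proof.
elim/last_ind: s => [|s a IH] [] //; first by move=> _ [].
rewrite all_rcons => /andP[ha hs].
case: s IH hs => [|b s] IH hs.
  move=> _; rewrite /bit_val /=; case/orP: ha => /eqP ->.
    by rewrite /b0 /b1 neq_inord // bin_small.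
  by rewrite /b0 /b1 eqxx bin_small.
case=> [[_]|/=[hb]]; first by case: (s).
have {}IH : b :: s = bin (bit_val (b :: s)) by apply: IH; split=> //; right; rewrite /= hb.
have hv : 0 < bit_val (b :: s).
  rewrite lt0n; apply/eqP => h0; move: IH; rewrite h0 bin_small // hb => -[] /eqP.
  by rewrite /b1 neq_inord.
rewrite -rcons_cons /bit_val foldl_rcons -/(bit_val (b :: s)); set v := bit_val _ in IH hv *.
case/orP: ha => /eqP ->.
  rewrite (_ : (b0 == b1) = false) ?addn0; last by rewrite /b0 /b1 neq_inord.
  by rewrite bin_rec ?doubleK ?odd_double -?IH //; lia.
rewrite eqxx bin_rec; last by lia.
have -> : (v.*2 + true)./2 = v by lia.
by rewrite addn1 /= odd_double /= -IH.
Qed.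

Definition nosharp (s : str) := s_sharp \notin s.

Lemma bits_nosharp s : all is_bit s -> nosharp s.
Proof. by move=> /allP h; apply/negP => /h; rewrite /is_bit /b0 /b1 /s_sharp !neq_inord. Qed.

Lemma nosharp_cat s t : nosharp (s ++ t) = nosharp s && nosharp t.
Proof. by rewrite /nosharp mem_cat negb_or. Qed.

Lemma nosharp_cons a s : nosharp (a :: s) = (a != s_sharp) && nosharp s.
Proof. by rewrite /nosharp inE negb_or eq_sym. Qed.

Definition joinb (bs : seq str) : str := flatten [seq s_sharp :: b | b <- bs].

Lemma joinb_cons b bs : joinb (b :: bs) = s_sharp :: b ++ joinb bs.
Proof. by []. Qed.

Lemma joinb_cat bs cs : joinb (bs ++ cs) = joinb bs ++ joinb cs.
Proof. by rewrite /joinb map_cat flatten_cat. Qed.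

Lemma joinb_end bs : exists r, joinb bs ++ [:: s_sharp] = s_sharp :: r.
Proof. by case: bs => [|b bs]; [exists [::]|eexists]. Qed.

Lemma split_sharp b c r s : nosharp b -> nosharp c -> b ++ s_sharp :: r = c ++ s_sharp :: s ->
  b = c /\ r = s.
Proof.
elim: b c => [|a b IH] [|d c] //=; rewrite ?nosharp_cons.
- by move=> _ _ [].
- by move=> _ /andP[h _] [h']; rewrite -h' eqxx in h.
- by move=> /andP[h _] _ [h']; rewrite h' eqxx in h.
by move=> /andP[_ hb] /andP[_ hc] [-> /IH[]// -> ->].
Qed.

Lemma split_past b r a s : nosharp b -> b ++ r = a ++ s_sharp :: s ->
  exists a', a = b ++ a' /\ r = a' ++ s_sharp :: s.
Proof.
elim: b a => [|c b IH] [|d a] //=; rewrite ?nosharp_cons.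
- by move=> _ ->; exists [::].
- by move=> _ ->; exists (d :: a).
- by move=> /andP[h _] [h']; rewrite h' eqxx in h.
by move=> /andP[_ hb] [-> /IH[]// a' [-> ->]]; exists a'.
Qed.

Lemma joinb_inj bs cs : all nosharp bs -> all nosharp cs ->
  joinb bs ++ [:: s_sharp] = joinb cs ++ [:: s_sharp] -> bs = cs.
Proof.
elim: bs cs => [|b bs IH] [|c cs] //=.
- by move=> _ _ /(congr1 size) /=; rewrite size_cat addn1.
- by move=> _ _ /(congr1 size) /=; rewrite size_cat addn1.
move=> /andP[hb hbs] /andP[hc hcs]; rewrite -/(joinb bs) -/(joinb cs) => -[]; rewrite -!catA.
have [r1 e1] := joinb_end bs; have [r2 e2] := joinb_end cs; rewrite e1 e2.
by case/(split_sharp hb hc) => -> h; rewrite (IH cs) // e1 e2 h.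
Qed.

(** Entries of a list are addressed by content instead of position, so that a condition on all
    entries becomes a quantifier over short strings. *)
Definition block (z y : str) : bool := nosharp y && infix (s_sharp :: y ++ [:: s_sharp]) z.

Lemma blockP z y : reflect (nosharp y /\ exists a b, z = a ++ s_sharp :: y ++ s_sharp :: b)
  (block z y).
Proof.
apply: (iffP andP) => -[h1 h2]; split=> //.
  by have [a [b ->]] := infixP h2; exists a, b; rewrite /= -catA.
by have [a [b ->]] := h2; apply/infixP; exists a, b; rewrite /= -catA.
Qed.

Lemma block_joinb bs y : all nosharp bs -> block (joinb bs ++ [:: s_sharp]) y = (y \in bs).
Proof.
elim: bs => [|b bs IH] /=.
  move=> _; apply/negP => /blockP[_ [a [c /(congr1 size)]]].
  by rewrite !size_cat /= size_cat /=; lia.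
move=> /andP[hb hbs]; rewrite inE -IH //; have [r e] := joinb_end bs.
apply/blockP/orP => [[hy [a [c]]]|].
  rewrite -/(joinb bs) -catA; case: a => [|d a] /= [].
    by rewrite e => /(split_sharp hb hy) [-> _]; left.
  move=> _ /(split_past hb) [a' [_ h]]; right; apply/blockP; split=> //; by exists a', c.
rewrite -/(joinb bs) -catA => -[/eqP ->|/blockP[hy [a [c h]]]].
  by rewrite e; split=> //; exists [::], r.
by split=> //; exists (s_sharp :: b ++ a), c; rewrite h /= -catA.
Qed.

Lemma joinb_exists r : ohead r = Some s_sharp \/ r = [::] -> exists2 bs, all nosharp bs & r = joinb bs.
Proof.
have h s : exists b bs, [/\ nosharp b, all nosharp bs & s = b ++ joinb bs].
  elim: s => [|a s [b [bs [h1 h2 ->]]]]; first by exists [::], [::].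
  case: (a =P s_sharp) => [->|/eqP ha].
    by exists [::], (b :: bs); rewrite /= h1 h2.
  by exists (a :: b), bs; rewrite nosharp_cons ha h1 h2.
case: r => [|a r]; first by exists [::].
case=> // -[->]; have [b [bs [h1 h2 ->]]] := h r.
by exists (b :: bs); rewrite //= h1.
Qed.

(** Transducer projecting every tile code to its component [i]; the state counts the marks since the
    last [#], up to 3. *)
Definition field_step (i : nat) (q a : 'I_4) : 'I_4 * str :=
  if a == s_sharp then (b0, [:: s_sharp]) else
  if a == s_mark then (inord (minn q.+1 3), [::]) else (q, if q == i :> nat then [:: a] else [::]).

Definition tile_field (i : nat) (t : tile) : color :=
  match i with 0 => tleft t | 1 => ttop t | 2 => tright t | _ => tbottom t end.

Lemma tile_fieldP t t' : (forall i, i < 4 -> tile_field i t = tile_field i t') -> t = t'.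
Proof.
case: t t' => [[[l1 l2] l3] l4] [[[r1 r2] r3] r4] h.
move: (h 0 isT) (h 1 isT) (h 2 isT) (h 3 isT).
by rewrite /= /tleft /ttop /tright /tbottom /= => -> -> -> ->.
Qed.

Lemma enc_tile_nosharp t : nosharp (enc_tile t).
Proof.
have h n := bits_nosharp (bin_bits n).
have hm : s_mark != s_sharp by rewrite /s_mark /s_sharp neq_inord.
by rewrite /enc_tile !(nosharp_cat, nosharp_cons) !h hm.
Qed.

Local Notation env := (seq str).
Local Notation CC := (@C 'I_4 false).
Local Notation DD := (@Dec 'I_4 false b0).

Lemma b01 : b0 != b1.
Proof. by rewrite /b0 /b1 neq_inord. Qed.

Definition field (i : nat) (z : str) : str := transduce (field_step i) (fun _ => [::]) b0 z.

Section Field.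
Variable i : nat.
Local Notation tr := (transduce (field_step i) (fun _ => [::])).

Lemma tr_bits q s r : all is_bit s -> tr q (s ++ r) = (if q == i :> nat then s else [::]) ++ tr q r.
Proof.
elim: s => [|a s IH] /=; first by case: eqP.
move=> /andP[ha hs]; rewrite /field_step bit_sharp // bit_mark //= IH //.
by case: eqP.
Qed.

Lemma tr_mark (q : 'I_4) r : tr q (s_mark :: r) = tr (inord (minn q.+1 3)) r.
Proof. by rewrite /= /field_step /s_mark /s_sharp neq_inord // eqxx. Qed.

Lemma tr_sharp q r : tr q (s_sharp :: r) = s_sharp :: tr b0 r.
Proof. by rewrite /= /field_step eqxx. Qed.

Lemma tr_tile t r : i < 4 -> tr b0 (enc_tile t ++ r) = bin (tile_field i t) ++ tr (inord 3) r.
Proof.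
move=> hi; have hb := bin_bits.
rewrite /enc_tile; do 3!rewrite -catA tr_bits // cat_cons tr_mark.
rewrite tr_bits // /b0 !inordK //.
by case: i hi => [|[|[|[|]]]] //= _; rewrite ?cats0 ?catA.
Qed.

Lemma field_tile t : i < 4 -> field i (enc_tile t) = bin (tile_field i t).
Proof. by move=> hi; rewrite -[enc_tile t]cats0 /field tr_tile //= cats0. Qed.

Lemma field_row ts : i < 4 ->
  field i (joinb (map enc_tile ts) ++ [:: s_sharp]) =
  joinb (map (fun t => bin (tile_field i t)) ts) ++ [:: s_sharp].
Proof.
move=> hi; rewrite /field.
suff h q : tr q (joinb (map enc_tile ts) ++ [:: s_sharp]) =
  joinb (map (fun t => bin (tile_field i t)) ts) ++ [:: s_sharp] by [].
elim: ts q => [|t ts IH] q; first by rewrite [LHS]tr_sharp.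
by rewrite map_cons joinb_cons cat_cons tr_sharp -catA tr_tile // IH map_cons joinb_cons /= -catA.
Qed.
End Field.

Definition colrow (cs : seq color) : str := joinb (map bin cs) ++ [:: s_sharp].

Lemma bins_nosharp cs : all nosharp (map bin cs).
Proof. by apply/allP => b /mapP[n _ ->]; apply: bits_nosharp; exact: bin_bits. Qed.

Lemma colrow_inj : injective colrow.
Proof.
move=> cs ds /joinb_inj h; apply: (inj_map bin_inj); apply: h; exact: bins_nosharp.
Qed.

Lemma colrow_nonempty cs : colrow cs <> [::].
Proof. by rewrite /colrow; case: (joinb _). Qed.

Lemma enc_tile_inj : injective enc_tile.
Proof.
move=> t t' h; apply: tile_fieldP => i hi; apply: bin_inj.
by rewrite -!field_tile // h.
Qed.

Lemma encs_nosharp T : all nosharp (map enc_tile T).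
Proof. by apply/allP => b /mapP[t _ ->]; exact: enc_tile_nosharp. Qed.

(** The length bounds on the four colours change nothing in meaning; they put the formula into the
    reach of exhaustive search. *)
Definition tform (y : str) : Prop :=
  exists c1, size c1 <= size y /\ exists c2, size c2 <= size y /\
  exists c3, size c3 <= size y /\ exists c4, size c4 <= size y /\
   (y = c1 ++ [:: s_mark] ++ c2 ++ [:: s_mark] ++ c3 ++ [:: s_mark] ++ c4 /\
    (canonical c1 /\ canonical c2 /\ canonical c3 /\ canonical c4)).

Lemma tformP y : tform y <-> exists t, y = enc_tile t.
Proof.
split.
  move=> [c1 [_ [c2 [_ [c3 [_ [c4 [_ [-> [h1 [h2 [h3 h4]]]]]]]]]]]].
  exists (bit_val c1, bit_val c2, bit_val c3, bit_val c4).
  by rewrite /enc_tile /tleft /ttop /tright /tbottom /= -!canonicalP.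
move=> [t ->]; exists (bin (tleft t)); rewrite /enc_tile !size_cat /= !size_cat /= !size_cat /=.
split; first by lia.
exists (bin (ttop t)); split; first by lia.
exists (bin (tright t)); split; first by lia.
exists (bin (tbottom t)); split; first by lia.
by split=> //; split; [|split; [|split]]; exact: canonical_bin.
Qed.

Lemma blocks_tiles r : (ohead r = Some s_sharp \/ r = [::]) ->
  (forall y, size y <= size r -> block (r ++ [:: s_sharp]) y -> tform y) <->
  exists T, r = joinb (map enc_tile T).
Proof.
move=> /joinb_exists[bs hbs ->]; split.
  move=> h.
  have hb b : b \in bs -> exists t, b = enc_tile t.
    move=> hin; apply/tformP; apply: h; last by rewrite block_joinb.
    elim: bs hin {hbs} => // c bs IH; rewrite inE joinb_cons /= size_cat.
    by case/orP=> [/eqP ->|/IH]; lia.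
  have : exists T, bs = map enc_tile T.
    elim: bs hb {h hbs} => [|b bs IH] hb; first by exists [::].
    have [t ht] := hb b (mem_head _ _); have [|T hT] := IH.
      by move=> c hc; apply: hb; rewrite inE hc orbT.
    by exists (t :: T); rewrite ht hT.
  by move=> [T ->]; exists T.
move=> [T /(congr1 (fun s => s ++ [:: s_sharp])) hT] y _.
rewrite (joinb_inj hbs (encs_nosharp T) hT) block_joinb ?encs_nosharp //.
by move=> /mapP[t _ ->]; apply/tformP; exists t.
Qed.

(** The last equation holds all horizontal conditions, borders included: white before the right
    colours gives the same list as white behind the left colours. The fourth condition fixes the
    width at [size u] by counting [#]. *)
Definition row (r u z : str) : Prop :=
  [/\ exists s, size s <= size z /\ z = s ++ [:: s_sharp],
      exists s, size s <= size z /\ z = s_sharp :: s,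
      forall y, size y <= size z -> block z y -> block (r ++ [:: s_sharp]) y,
      map (fun _ => b0) (filter (pred1 s_sharp) z) = b0 :: u &
      [:: s_sharp; b0] ++ field 2 z = field 0 z ++ [:: b0; s_sharp]].

Lemma bin0 : bin 0 = [:: b0].
Proof. by rewrite bin_small. Qed.

Lemma colrow_cons c cs : colrow (c :: cs) = s_sharp :: bin c ++ colrow cs.
Proof. by rewrite /colrow map_cons joinb_cons /= -catA. Qed.

Lemma colrow_rcons cs c : colrow (rcons cs c) = colrow cs ++ bin c ++ [:: s_sharp].
Proof.
rewrite /colrow map_rcons -cats1 joinb_cat -!catA; congr (_ ++ _).
Qed.

Lemma count_row ts : filter (pred1 s_sharp) (joinb (map enc_tile ts) ++ [:: s_sharp]) =
  nseq (size ts).+1 s_sharp.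
Proof.
elim: ts => [|t ts IH]; first by rewrite /= eqxx.
rewrite map_cons joinb_cons /= eqxx -catA filter_cat IH.
rewrite (_ : filter _ (enc_tile t) = [::]) //; apply/eqP; rewrite -(negbK (_ == _)) -has_filter.
by apply/hasPn => a ha; apply: contraNneq (enc_tile_nosharp t) => <-.
Qed.

Lemma rowP T W z : row (joinb (map enc_tile T)) (nseq W b0) z <->
  exists ts, [/\ size ts = W, {subset ts <= T}, 0 :: map tright ts = rcons (map tleft ts) 0 &
    z = joinb (map enc_tile ts) ++ [:: s_sharp]].
Proof.
have e0 ts : field 0 (joinb (map enc_tile ts) ++ [:: s_sharp]) = colrow (map tleft ts).
  by rewrite field_row // /colrow -map_comp.
have e2 ts : field 2 (joinb (map enc_tile ts) ++ [:: s_sharp]) = colrow (map tright ts).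
  by rewrite field_row // /colrow -map_comp.
split.
  move=> [[s [_ hs]] [s' [_ hs']] hb hn hh].
  have [bs hbs e] : exists2 bs, all nosharp bs & s = joinb bs.
    apply: joinb_exists; case: s hs => [|a s] hs; first by right.
    by left; move: hs; rewrite hs' => -[->].
  have hT y : y \in bs -> y \in map enc_tile T.
    move=> hy; have hbl : block z y by rewrite hs e block_joinb.
    rewrite -block_joinb ?encs_nosharp //; apply: hb => //.
    have [_ [a [b ->]]] := blockP _ _ hbl.
    by rewrite size_cat /= size_cat /=; lia.
  have [ts hts hsub] : exists2 ts, bs = map enc_tile ts & {subset ts <= T}.
    elim: bs hT {hbs e} => [|b bs IH] hT; first by exists [::].
    have /mapP[t ht hbt] := hT b (mem_head _ _); have [|ts h1 h2] := IH.
      by move=> c hc; apply: hT; rewrite inE hc orbT.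
    exists (t :: ts); first by rewrite hbt h1.
    by move=> c; rewrite inE => /orP[/eqP ->|/h2].
  have hz : z = joinb (map enc_tile ts) ++ [:: s_sharp] by rewrite hs e hts.
  exists ts; split=> //.
    by move: hn; rewrite hz count_row map_nseq /= => -[] /(congr1 size); rewrite !size_nseq.
  apply: colrow_inj; rewrite colrow_cons colrow_rcons bin0; move: hh; rewrite hz e0 e2.
  by [].
move=> [ts [hW hsub hh ->]]; split.
- by exists (joinb (map enc_tile ts)); rewrite size_cat leq_addr.
- have [s hs] := joinb_end (map enc_tile ts); exists s; rewrite hs; split=> //=.
- move=> y _; rewrite !block_joinb ?encs_nosharp // => /mapP[t ht ->].
  by apply: map_f; exact: hsub.
- by rewrite count_row map_nseq /= hW.
by rewrite e0 e2; have := congr1 colrow hh; rewrite colrow_cons colrow_rcons bin0.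
Qed.

Lemma DD_ex (Q : str -> env -> Prop) (f : env -> str) : CC f ->
  DD (fun e => Q (nth [::] e 0) (behead e)) ->
  DD (fun e => exists s, size s <= size (f e) /\ Q s e).
Proof. exact: Dec_ex b01 _ _. Qed.

Lemma DD_all (Q : str -> env -> Prop) (f : env -> str) : CC f ->
  DD (fun e => Q (nth [::] e 0) (behead e)) ->
  DD (fun e => forall s, size s <= size (f e) -> Q s e).
Proof. exact: Dec_all b01 _ _. Qed.

Lemma DD_sub1 (R : str -> Prop) f : DD (fun e => R (nth [::] e 0)) -> CC f -> DD (fun e => R (f e)).
Proof. by move=> h hf; apply: (Dec_comp (F := fun e => [:: f e]) hf h). Qed.

Lemma DD_sub2 (R : str -> str -> Prop) f g : DD (fun e => R (nth [::] e 0) (nth [::] e 1)) ->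
  CC f -> CC g -> DD (fun e => R (f e) (g e)).
Proof. by move=> h hf hg; apply: (Dec_comp (F := fun e => [:: f e; g e]) (Comp_cons hf hg) h). Qed.

Lemma DD_sub3 (R : str -> str -> str -> Prop) f g h :
  DD (fun e => R (nth [::] e 0) (nth [::] e 1) (nth [::] e 2)) ->
  CC f -> CC g -> CC h -> DD (fun e => R (f e) (g e) (h e)).
Proof.
move=> hR hf hg hh.
exact: (Dec_comp (F := fun e => [:: f e; g e; h e]) (Comp_cons hf (Comp_cons hg hh)) hR).
Qed.

Lemma CC_field i f : CC f -> CC (fun e => field i (f e)).
Proof. exact: C_transduce. Qed.

Lemma CC_tail f : CC f -> CC (fun e => f (behead e)).
Proof. exact: C_tail. Qed.

Lemma CC_tail2 f : CC f -> CC (fun e => f (behead (behead e))).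
Proof. by move=> h; exact: (CC_tail (CC_tail h)). Qed.
Lemma CC_tail3 f : CC f -> CC (fun e => f (behead (behead (behead e)))).
Proof. by move=> h; exact: (CC_tail (CC_tail2 h)). Qed.
Lemma CC_tail4 f : CC f -> CC (fun e => f (behead (behead (behead (behead e))))).
Proof. by move=> h; exact: (CC_tail2 (CC_tail2 h)). Qed.

Definition CC_var i : CC (fun e => nth [::] e i) := C_var _ _ i.
Definition CC_var1 i : CC (fun e => nth [::] (behead e) i) := CC_tail (CC_var i).
Definition CC_var2 i : CC (fun e => nth [::] (behead (behead e)) i) := CC_tail2 (CC_var i).
Definition CC_var3 i : CC (fun e => nth [::] (behead (behead (behead e))) i) := CC_tail3 (CC_var i).
Definition CC_var4 i : CC (fun e => nth [::] (behead (behead (behead (behead e)))) i) :=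
  CC_tail4 (CC_var i).

Lemma CC_ccons a f : CC f -> CC (fun e => a :: f e).
Proof. exact: C_push. Qed.

Lemma CC_cat f g : CC f -> CC g -> CC (fun e => f e ++ g e).
Proof. exact: C_cat. Qed.

Lemma CC_filter p f : CC f -> CC (fun e => filter p (f e)).
Proof. exact: C_filter. Qed.

Lemma CC_map h f : CC f -> CC (fun e => map h (f e)).
Proof. exact: C_map. Qed.

Ltac ccomp := repeat first
  [ assumption | exact: CC_var | exact: CC_var1 | exact: CC_var2 | exact: CC_var3 | exact: CC_var4
  | exact: C_const | apply: CC_ccons | apply: CC_cat | apply: CC_field | apply: CC_filter | apply: CC_map ].

Lemma DD_head a f : CC f -> DD (fun e => ohead (f e) = Some a).
Proof.
move=> hf; exists (fun e => ohead (f e) == Some a); split=> [|e]; last by split=> /eqP.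
have := Comp_case (pred1 (Some a)) hf (@C_const _ false [:: b0]) (@C_const _ _ [::]).
by apply: Comp_ext => e /=; case: eqP.
Qed.

Ltac ddec := repeat first
  [ assumption | apply: Dec_and | apply: Dec_or | apply: Dec_not | apply: Dec_iff | apply: DD_head
  | apply: DD_ex | apply: DD_all | apply: Dec_eq | apply: Dec_imp ]; ccomp.

Lemma DD_tform f : CC f -> DD (fun e => tform (f e)).
Proof.
apply: DD_sub1.
have hbit g : CC g -> DD (fun e => all is_bit (g e)).
  move=> hg; apply: (Dec_ext (P := fun e => filter (predC is_bit) (g e) = [::])); last by ddec.
  move=> e; split=> h; first by rewrite -[all _ _]negbK -has_predC has_filter h.
  by apply/eqP; rewrite -(negbK (_ == _)) -has_filter has_predC negbK.
by rewrite /tform; ddec; apply: hbit; ccomp.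
Qed.

Lemma DD_block f g : CC f -> CC g -> DD (fun e => block (f e) (g e)).
Proof.
apply: (@DD_sub2 (fun z y => block z y)).
apply: (Dec_ext (P := fun e => filter (pred1 s_sharp) (nth [::] e 1) = [::] /\
   exists a, size a <= size (nth [::] e 0) /\ exists b, size b <= size (nth [::] e 0) /\
     nth [::] e 0 = a ++ s_sharp :: nth [::] e 1 ++ s_sharp :: b)); last by ddec.
move=> e; set z := nth _ e 0; set y := nth _ e 1.
have hf : filter (pred1 s_sharp) y = [::] <-> nosharp y.
  rewrite /nosharp -has_pred1 has_filter negbK; split=> [->|/eqP] //.
split.
  by move=> [/hf h [a [_ [b [_ hz]]]]]; apply/blockP; split=> //; exists a, b.
move=> /blockP[/hf h [a [b hz]]]; split=> //; rewrite hz !size_cat /= !size_cat /=.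
by exists a; split; [lia|exists b; split; [lia|]].
Qed.

Lemma DD_row f g h : CC f -> CC g -> CC h -> DD (fun e => row (f e) (g e) (h e)).
Proof.
apply: DD_sub3.
apply: (Dec_ext (P := fun e => (exists s, size s <= size (nth [::] e 2) /\ nth [::] e 2 = s ++ [:: s_sharp]) /\
  ((exists s, size s <= size (nth [::] e 2) /\ nth [::] e 2 = s_sharp :: s) /\
  ((forall y, size y <= size (nth [::] e 2) -> block (nth [::] e 2) y ->
     block (nth [::] e 0 ++ [:: s_sharp]) y) /\
  (map (fun _ => b0) (filter (pred1 s_sharp) (nth [::] e 2)) = b0 :: nth [::] e 1 /\
   [:: s_sharp; b0] ++ field 2 (nth [::] e 2) = field 0 (nth [::] e 2) ++ [:: b0; s_sharp]))))).
  by move=> e; split=> [[h1 [h2 [h3 [h4 h5]]]]|[h1 h2 h3 h4 h5]].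
by ddec; apply: DD_block; ccomp.
Qed.

(** * Walks through strings of bounded length *)

Section Walk.
Variables (R : str -> str -> Prop) (n : nat).

Fixpoint walk m u v : Prop :=
  if m is m'.+1 then exists w, size w <= n /\ (R u w /\ walk m' w v) else u = v.

Lemma walk_add a b u v : 0 < a ->
  walk (a + b) u v <-> exists w, size w <= n /\ (walk a u w /\ walk b w v).
Proof.
case: a => // a _; elim: a u => [|a IH] u.
  split=> [[w [h1 [h2 h3]]]|[w [h1 [[w' [h2 [h3 e]]] h4]]]].
    by exists w; split=> //; split=> //; exists w.
  by exists w; split=> //; split=> //; rewrite -e.
split=> [[w [h1 [h2 /IH [w' [h3 [h4 h5]]]]]]|[w [h1 [[w' [h2 [h3 h4]]] h5]]]].
  by exists w'; split=> //; split=> //; exists w.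
by exists w'; split=> //; split=> //; apply/IH; exists w; split.
Qed.

Lemma reach_walk d u v : size v <= n -> reach_in R n d u v <-> walk (2 ^ d) u v.
Proof.
elim: d u v => [|d IH] u v hv.
  by rewrite /=; split=> [h|[w [_ [h <-]]]] //; exists v.
rewrite /= expnS mul2n -addnn walk_add ?expn_gt0 //.
by split=> -[m [hm [/(IH _ _ hm) h1 /(IH _ _ hv) h2]]]; exists m.
Qed.
End Walk.

Lemma walk_ext (R R' : str -> str -> Prop) n m u v :
  (forall u v, R u v -> R' u v) -> walk R n m u v -> walk R' n m u v.
Proof.
move=> h; elim: m u => //= m IH u [w [h1 [h2 h3]]]; exists w; split=> //; split; auto.
Qed.

Lemma walk_path (e : rel str) n m u v : walk (fun x y => e x y) n m u v <->
  exists p, [/\ size p = m, path e u p, last u p = v & all (fun s => size s <= n) p].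
Proof.
elim: m u => [|m IH] u /=.
  split; first by move=> ->; exists [::].
  by move=> [[|w p] []].
split=> [[w [h1 [h2 /IH [p [h3 h4 h5 h6]]]]]|[[|w p] [] //= [h1] /andP[h2 h3] h4 /andP[h5 h6]]].
  by exists (w :: p); rewrite /= h3 h2 h4 h1 h6.
by exists w; split=> //; split=> //; apply/IH; exists p.
Qed.

(** A walk shortens to a simple path. Strings of length at most [n], padded by [None], embed into
    [n]-tuples over five symbols, and [5 ^ n <= 2 ^ (3 * n)]. *)
Lemma walk_short (e : rel str) n m u v : size u <= n -> walk (fun x y => e x y) n m u v ->
  exists2 m', m' <= 2 ^ (3 * n) & walk (fun x y => e x y) n m' u v.
Proof.
move=> hu /walk_path[p [_ hp hl hn]].
move: hl; case/shortenP: hp => p' hp' hu' hsub hl.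
have hn' : all (fun s => size s <= n) (u :: p').
  by rewrite /= hu; apply/allP => x /hsub hx; exact: (allP hn).
exists (size p'); last first.
  by apply/walk_path; exists p'; split=> //; move: hn' => /= /andP[].
pose pad (s : str) : n.-tuple (option 'I_4) := [tuple onth s i | i < n].
have inj : {in u :: p' &, injective pad}.
  move=> s t /(allP hn') hs /(allP hn') ht hst; apply: eq_from_onth_le => i.
  rewrite leq_max => hi; have hin : i < n by lia.
  by have := congr1 (fun w => tnth w (Ordinal hin)) hst; rewrite !tnth_mktuple.
have hm : uniq (map pad (u :: p')) by rewrite map_inj_in_uniq.
have := max_card (mem (map pad (u :: p'))); rewrite (card_uniqP hm) size_map /=.
rewrite card_tuple card_option card_ord => h; apply: leq_trans (ltnW h) _.
by rewrite expnM; case: (n) => // n'; rewrite leq_exp2r.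
Qed.

Lemma walk_refl (R : str -> str -> Prop) n m u v :
  walk (fun x y => R x y \/ x = y) n m u v -> exists m', walk R n m' u v.
Proof.
elim: m u => [|m IH] u /=; first by exists 0.
move=> [w [h1 [[h2|->] /IH [m' h3]]]]; last by exists m'.
by exists m'.+1, w.
Qed.

(** The midpoint recursion finds only walks of one fixed length; loops at all vertices make up for
    the missing steps. *)
Lemma walk_pad (R : str -> str -> Prop) n m m' u v : size v <= n -> m' <= m ->
  walk R n m' u v -> walk (fun x y => R x y \/ x = y) n m u v.
Proof.
move=> hv; elim: m' m u => [|m' IH] m u.
  by move=> _ /= ->; elim: m => //= m IH; exists v; split=> //; split=> //; right.
case: m => // m hm [w [h1 [h2 h3]]]; exists w; split=> //; split; first by left.
exact: IH.
Qed.

(** * Tilings as chains of rows *)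

Section Chain.
Variables (T : seq tile) (W : nat).
Hypothesis W0 : 0 < W.

Definition okrow (ts : seq tile) :=
  [/\ size ts = W, {subset ts <= T} & 0 :: map tright ts = rcons (map tleft ts) 0].

Fixpoint chain m (cs : seq color) : Prop :=
  if m is m'.+1 then exists ts, okrow ts /\ (map ttop ts = cs /\ chain m' (map tbottom ts))
  else cs = nseq W 0.

Lemma okrow_mkseq (f : nat -> tile) : okrow (mkseq f W) <->
  [/\ forall j, j < W -> f j \in T, tleft (f 0) = white, tright (f W.-1) = white &
      forall j, j.+1 < W -> tright (f j) = tleft (f j.+1)].
Proof.
have e1 : 0 :: map tright (mkseq f W) = mkseq (fun j => if j is j'.+1 then tright (f j') else 0) W.+1.
  by rewrite /mkseq /= -map_comp -[in RHS](add1n 0) iotaDl -map_comp.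
have e2 : rcons (map tleft (mkseq f W)) 0 = mkseq (fun j => if j < W then tleft (f j) else 0) W.+1.
  rewrite mkseqS ltnn; congr rcons; rewrite /mkseq -map_comp; apply/eq_in_map => j.
  by rewrite mem_iota add0n => /= ->.
rewrite /okrow e1 e2; split.
  move=> [_ hs h]; have hj j : j < W.+1 -> (if j is j'.+1 then tright (f j') else 0) =
      (if j < W then tleft (f j) else 0).
    by move=> hj; have := congr1 (fun s => nth 0 s j) h; rewrite !nth_mkseq.
  split.
  - by move=> j jW; apply: hs; apply: map_f; rewrite mem_iota.
  - by have := hj 0 isT; rewrite W0 => <-.
  - by have := hj W (leqnn _); rewrite ltnn; case: (W) W0 => // W' _ /= ->.
  by move=> j jW; have := hj j.+1 (ltnW jW); rewrite jW.
move=> [h1 h2 h3 h4]; split; first by rewrite size_mkseq.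
  by move=> t /mapP[j]; rewrite mem_iota => /= hj ->; exact: h1.
apply/eq_in_map => -[|j]; rewrite mem_iota add0n => /= hj; first by rewrite W0 h2.
by case: ltnP => h; [exact: h4|by move: h3; rewrite (_ : W.-1 = j) //; lia].
Qed.

Lemma chain_fun m cs : chain m cs <-> exists (rho : nat -> nat -> tile) (kap : nat -> seq color),
  [/\ kap 0 = cs, kap m = nseq W 0 & forall i, i < m ->
   [/\ okrow (mkseq (rho i) W), map ttop (mkseq (rho i) W) = kap i &
       map tbottom (mkseq (rho i) W) = kap i.+1]].
Proof.
elim: m cs => [|m IH] cs /=.
  split=> [->|[rho [kap [<- <-]]]] //; exists (fun _ _ => (0, 0, 0, 0)), (fun _ => nseq W 0).
  by split.
split.
  move=> [ts [h1 [h2 /IH [rho [kap [h3 h4 h5]]]]]].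
  have hts : mkseq (nth (0, 0, 0, 0) ts) W = ts by case: h1 => <- _ _; exact: mkseq_nth.
  exists (fun i => if i is i'.+1 then rho i' else nth (0, 0, 0, 0) ts),
    (fun i => if i is i'.+1 then kap i' else cs).
  by split=> // -[|i] hi; [rewrite hts|exact: h5].
move=> [rho [kap [h1 h2 h3]]]; have [h4 h5 h6] := h3 0 isT.
exists (mkseq (rho 0) W); split=> //; split; first by rewrite h5.
apply/IH; exists (fun i => rho i.+1), (fun i => kap i.+1); split=> // i hi.
exact: h3.
Qed.

(** [kap i] lists the colours on the line above row [i]. Rows and columns of [rho] count from 0,
    those of [tau] from 1. *)
Lemma tiling_chain H t0 : 0 < H ->
  (exists tau, is_tiling T H W tau /\ tau 1 1 = t0) <-> exists (rho : nat -> nat -> tile) (kap : nat -> seq color),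
  [/\ kap 0 = nseq W 0, kap H = nseq W 0, rho 0 0 = t0 & forall i, i < H ->
   [/\ okrow (mkseq (rho i) W), map ttop (mkseq (rho i) W) = kap i &
       map tbottom (mkseq (rho i) W) = kap i.+1]].
Proof.
move=> H0; split.
  move=> [tau [[h1 [h2 [h3 [h4 h5]]]] h6]].
  exists (fun i j => tau i.+1 j.+1), (fun i => if i < H then
     map ttop (mkseq (fun j => tau i.+1 j.+1) W) else nseq W 0).
  have hw f : (forall j, j < W -> f j = white) -> map f (iota 0 W) = nseq W 0.
    move=> hf; apply: (@eq_from_nth _ 0) => [|j]; rewrite size_map size_iota ?size_nseq // => hj.
    by rewrite (nth_map 0) ?size_iota // nth_iota // nth_nseq hj hf.
  split=> //.
  - case: ltnP => // hH; rewrite /mkseq -map_comp; apply: hw => j hj /=.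
    by have [|-> _] := h3 j.+1.
  - by rewrite ltnn.
  move=> i hi; split.
  - apply/okrow_mkseq; split.
    + by move=> j hj; apply: h1; rewrite ?hi.
    + by have [|-> _] := h2 i.+1.
    + by rewrite prednK //; have [|_ ->] := h2 i.+1.
    by move=> j hj; apply: h4.
  - by rewrite hi.
  case: ltnP => hH.
    rewrite /mkseq -!map_comp; apply/eq_in_map => j; rewrite mem_iota add0n => /= hj.
    by rewrite h5.
  have -> : i.+1 = H by lia.
  rewrite /mkseq -map_comp; apply: hw => j hj /=.
  by have [|_ ->] := h3 j.+1.
move=> [rho [kap [h1 h2 h3 h4]]]; exists (fun i j => rho i.-1 j.-1); split=> //.
have hok i : i < H -> _ := fun hi => proj1 (okrow_mkseq (rho i)) (let: And3 a _ _ := h4 i hi in a).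
have htop i j : i < H -> j < W -> ttop (rho i j) = nth 0 (kap i) j.
  by move=> hi hj; have [_ <- _] := h4 i hi; rewrite -map_comp nth_mkseq.
have hbot i j : i < H -> j < W -> tbottom (rho i j) = nth 0 (kap i.+1) j.
  by move=> hi hj; have [_ _ <-] := h4 i hi; rewrite -map_comp nth_mkseq.
split; [|split; [|split; [|split]]].
- move=> [|i] [|j] // hi hj; have [h _ _ _] := hok i hi; exact: h.
- by move=> [|i] // hi; have [_ ha hb _] := hok i hi.
- move=> [|j] // hj; rewrite /= htop // h1 hbot ?prednK // h2 nth_nseq.
  by rewrite (_ : j < W).
- by move=> [|i] [|j] // hi hj; have [_ _ _ h] := hok i hi; exact: h.
by move=> [|i] [|j] // hi hj; rewrite /= hbot ?htop //; lia.
Qed.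

End Chain.

(** Only its length is used: a tile code together with its [#] is at most as long as the input [x],
    and the last copy of [x] pays for the closing [#]. *)
Definition rowbound (u x : str) : str := flatten (nseq (size u) x) ++ x.
Definition white_row (u : str) : str := s_sharp :: flatten (nseq (size u) [:: b0; s_sharp]).

(* The empty string is the start vertex: it leads to the rows whose first tile is [y0]. *)
Definition edge (x u y0 r U V : str) : Prop :=
  exists z, size z <= size (rowbound u x) /\ (row r u z /\ (field 3 z = V /\
    (field 1 z = U \/ (U = [::] /\ (field 1 z = white_row u /\
       exists s, size s <= size z /\ z = s_sharp :: y0 ++ s_sharp :: s))))).

Lemma size_field i z : size (field i z) <= size z.
Proof.
rewrite /field; elim: z b0 => //= a z IH q; rewrite size_cat -[(size z).+1]add1n; apply: leq_add => //.
by rewrite /field_step; do !case: ifP.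
Qed.

Lemma white_rowE W : white_row (nseq W b0) = colrow (nseq W 0).
Proof.
rewrite /white_row size_nseq; elim: W => [|W IH] //=.
by rewrite colrow_cons -IH bin0.
Qed.

Lemma row_uniq ts ts' : joinb (map enc_tile ts) ++ [:: s_sharp] = joinb (map enc_tile ts') ++ [:: s_sharp] ->
  ts = ts'.
Proof. by move/joinb_inj => h; apply: (inj_map enc_tile_inj); apply: h; exact: encs_nosharp. Qed.

Section Instance.
Variables (x y0 : str) (T : seq tile) (t0 : tile) (W : nat).
Hypothesis W0 : 0 < W.
Hypothesis hy0 : y0 = enc_tile t0.
Hypothesis hx : forall t, t \in T -> size (enc_tile t) < size x.
Hypothesis hx0 : 0 < size x.
Let r := joinb (map enc_tile T).
Let u := nseq W b0.
Let n := size (rowbound u x).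

Lemma row_size ts : size ts = W -> {subset ts <= T} ->
  size (joinb (map enc_tile ts) ++ [:: s_sharp]) <= n.
Proof.
rewrite /n /rowbound !size_cat addn1 size_nseq => <- h.
suff : size (joinb (map enc_tile ts)) <= size (flatten (nseq (size ts) x)) by lia.
elim: ts h => //= t ts IH h; rewrite -/(joinb _) size_cat [leqRHS]size_cat -addSn leq_add //.
  by apply: hx; apply: h; exact: mem_head.
by apply: IH => s hs; apply: h; rewrite inE hs orbT.
Qed.

Lemma edge_col cs V : edge x u y0 r (colrow cs) V <-> exists ts,
  [/\ okrow T W ts, map ttop ts = cs & V = colrow (map tbottom ts)].
Proof.
have e1 ts : field 1 (joinb (map enc_tile ts) ++ [:: s_sharp]) = colrow (map ttop ts).
  by rewrite field_row // /colrow -map_comp.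
have e3 ts : field 3 (joinb (map enc_tile ts) ++ [:: s_sharp]) = colrow (map tbottom ts).
  by rewrite field_row // /colrow -map_comp.
split.
  move=> [z [_ [/rowP[ts [h1 h2 h3 ->]]]]] []; rewrite e3 e1 => <- [/colrow_inj h|[]].
    by exists ts.
  by move/colrow_nonempty.
move=> [ts [[h1 h2 h3] <- ->]]; exists (joinb (map enc_tile ts) ++ [:: s_sharp]).
split; first exact: row_size.
by split; [apply/rowP; exists ts|split; [exact: e3|left; exact: e1]].
Qed.

Lemma edge_start V : edge x u y0 r [::] V <-> exists ts,
  [/\ okrow T W ts, map ttop ts = nseq W 0, nth (0, 0, 0, 0) ts 0 = t0 & V = colrow (map tbottom ts)].
Proof.
have e1 ts : field 1 (joinb (map enc_tile ts) ++ [:: s_sharp]) = colrow (map ttop ts).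
  by rewrite field_row // /colrow -map_comp.
have e3 ts : field 3 (joinb (map enc_tile ts) ++ [:: s_sharp]) = colrow (map tbottom ts).
  by rewrite field_row // /colrow -map_comp.
split.
  move=> [z [_ [/rowP[ts [h1 h2 h3 ->]]]]] []; rewrite e3 e1 => <- [/colrow_nonempty //|[_]].
  rewrite white_rowE => -[/colrow_inj h4 [s [_ h5]]]; exists ts; split=> //.
  case: ts h1 h5 {h2 h3 h4} => [|t ts] h1 /=; first by move: W0; rewrite -h1.
  have [s' hs'] := joinb_end (map enc_tile ts).
  rewrite -/(joinb _) -catA hs' hy0 => -[/(split_sharp (enc_tile_nosharp _) (enc_tile_nosharp _))].
  by case=> /enc_tile_inj.
move=> [ts [[h1 h2 h3] h4 h5 ->]]; exists (joinb (map enc_tile ts) ++ [:: s_sharp]).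
split; first exact: row_size.
split; first by apply/rowP; exists ts.
split; first exact: e3.
right; split=> //; rewrite e1 h4 white_rowE; split=> //.
case: ts h1 h5 {h2 h3 h4} => [|t ts] h1 /=; first by move: W0; rewrite -h1.
move=> ->; have [s' hs'] := joinb_end (map enc_tile ts).
by rewrite -/(joinb _) -catA hs' -hy0; exists s'; rewrite size_cat /=; split=> //; lia.
Qed.

Lemma colrow_bottom_size ts : okrow T W ts -> size (colrow (map tbottom ts)) <= n.
Proof.
move=> [h1 h2 h3]; apply: leq_trans (row_size h1 h2).
have <- : field 3 (joinb (map enc_tile ts) ++ [:: s_sharp]) = colrow (map tbottom ts).
  by rewrite field_row // /colrow -map_comp.
exact: size_field.
Qed.

Lemma walk_chain m cs : walk (edge x u y0 r) n m (colrow cs) (colrow (nseq W 0)) <-> chain T W m cs.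
Proof.
elim: m cs => [|m IH] cs /=; first by split=> [/colrow_inj|->].
split.
  by move=> [V [_ [/edge_col[ts [h1 h2 ->]] /IH h3]]]; exists ts.
move=> [ts [h1 [h2 /IH h3]]]; exists (colrow (map tbottom ts)); split; first exact: colrow_bottom_size.
by split=> //; apply/edge_col; exists ts.
Qed.

Lemma walk_tiling H : 0 < H ->
  walk (edge x u y0 r) n H [::] (colrow (nseq W 0)) <->
  exists tau, is_tiling T H W tau /\ tau 1 1 = t0.
Proof.
move=> H0; rewrite (tiling_chain T W0 t0 H0); case: H H0 => // m _; split.
  move=> [V [_ [/edge_start[ts [h1 h2 h3 ->]] /walk_chain/chain_fun[rho [kap [h4 h5 h6]]]]]].
  have hts : mkseq (nth (0, 0, 0, 0) ts) W = ts by case: h1 => <- _ _; exact: mkseq_nth.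
  exists (fun i => if i is i'.+1 then rho i' else nth (0, 0, 0, 0) ts),
    (fun i => if i is i'.+1 then kap i' else nseq W 0).
  by split=> // -[|i] hi; [rewrite hts|exact: h6].
move=> [rho [kap [h1 h2 h3 h4]]]; have [h5 h6 h7] := h4 0 isT.
exists (colrow (kap 1)); split; first by rewrite -h7; exact: colrow_bottom_size.
split.
  apply/edge_start; exists (mkseq (rho 0) W); rewrite -h7; split=> //; first by rewrite h6.
  by rewrite nth_mkseq.
apply/walk_chain/chain_fun; exists (fun i => rho i.+1), (fun i => kap i.+1); split=> // i hi.
exact: h4.
Qed.

End Instance.

(** * Deciding determinism and parsing instances *)

Definition coldet (x r C : str) : Prop :=
  block C [:: b0] /\
  ((forall y, size y <= size x -> block (r ++ [:: s_sharp]) y ->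
      (block C (field 1 y) <-> ~ block C (field 3 y))) /\
  ((forall y, size y <= size x -> forall y', size y' <= size x ->
      block (r ++ [:: s_sharp]) y -> block (r ++ [:: s_sharp]) y' ->
      field 0 y = field 0 y' -> field 1 y = field 1 y' -> block C (field 0 y) -> y = y') /\
  (forall y, size y <= size x -> forall y', size y' <= size x ->
      block (r ++ [:: s_sharp]) y -> block (r ++ [:: s_sharp]) y' ->
      field 2 y = field 2 y' -> field 1 y = field 1 y' -> ~ block C (field 2 y) -> y = y'))).

(** [C] lists the colours in Col. It suffices to list white and colours of the tile set, and four
    colours separated by [#] take as much room as their tile; this gives the length of [x] plus
    4. *)
Definition detf (x r : str) : Prop :=
  exists C, size C <= size (x ++ [:: b0; b0; b0; b0]) /\ coldet x r C.

Definition tcolors (t : tile) : seq color := [:: tleft t; ttop t; tright t; tbottom t].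

Lemma size_colrow_cons c cs : size (colrow (c :: cs)) = (size (bin c) + size (colrow cs)).+1.
Proof. by rewrite colrow_cons -[LHS]/(size (bin c ++ colrow cs)).+1 size_cat. Qed.

Lemma size_colrow_filter (p : pred color) cs : size (colrow (filter p cs)) <= size (colrow cs).
Proof.
elim: cs => // c cs IH; rewrite [filter _ _]/= [leqRHS]size_colrow_cons.
by case: (p c); rewrite ?size_colrow_cons; lia.
Qed.

Lemma size_tcolors T : size (colrow (0 :: flatten (map tcolors T))) = (size (joinb (map enc_tile T))).+3.
Proof.
rewrite size_colrow_cons bin0.
suff : size (colrow (flatten (map tcolors T))) = (size (joinb (map enc_tile T))).+1 by move=> ->; rewrite add1n.
elim: T => [|t T IH] //; rewrite !map_cons joinb_cons -[flatten _]/(_ :: _ :: _ :: _ :: _).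
rewrite !size_colrow_cons IH -[size (_ :: _)]/(size (_ ++ joinb _)).+1 size_cat.
rewrite /enc_tile; set z := size (joinb _); move: (tleft t) (ttop t) (tright t) (tbottom t) z => a b c d z.
by rewrite size_cat /= size_cat /= size_cat /=; lia.
Qed.

Lemma detfP x T : (forall t, t \in T -> size (enc_tile t) <= size x) ->
  size (joinb (map enc_tile T)) < size x + 2 ->
  detf x (joinb (map enc_tile T)) <-> deterministic T.
Proof.
move=> hx hr.
have hblk y : block (joinb (map enc_tile T) ++ [:: s_sharp]) y = (y \in map enc_tile T).
  by rewrite block_joinb ?encs_nosharp.
split.
  move=> [C [_ [h1 [h2 [h3 h4]]]]]; exists (fun c => block C (bin c)); split; first by rewrite bin0.
  split.
    move=> t ht; have := h2 (enc_tile t) (hx t ht); rewrite hblk map_f // !field_tile // => /(_ isT) h.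
    by rewrite /=; split=> [/h/negP|/negP/h].
  split.
    move=> c c' hc t1 t2 i1 i2 l1 p1 l2 p2; apply: enc_tile_inj.
    apply: (h3 _ (hx _ i1) _ (hx _ i2)); rewrite ?hblk ?map_f // !field_tile //= ?l1 ?l2 ?p1 ?p2 //.
  move=> c c' hc t1 t2 i1 i2 l1 p1 l2 p2; apply: enc_tile_inj.
  apply: (h4 _ (hx _ i1) _ (hx _ i2)); rewrite ?hblk ?map_f // !field_tile //= ?l1 ?l2 ?p1 ?p2 //.
  exact/negP.
move=> [Col [h1 [h2 [h3 h4]]]].
pose cs := 0 :: flatten (map tcolors T); exists (colrow (filter Col cs)).
split.
  apply: leq_trans (size_colrow_filter _ _) _; rewrite size_tcolors size_cat /=; lia.
have hC c : c \in cs -> block (colrow (filter Col cs)) (bin c) = Col c.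
  by move=> hc; rewrite block_joinb ?bins_nosharp // (mem_map bin_inj) mem_filter hc andbT.
have hcs t c : t \in T -> c \in tcolors t -> c \in cs.
  by move=> ht hc; rewrite inE; apply/orP; right; apply/flattenP; exists (tcolors t) => //; exact: map_f.
have hin t i : t \in T -> tile_field i t \in cs.
  move=> ht; apply: (hcs t) => //; case: i => [|[|[|i]]]; rewrite /tcolors /= !inE eqxx ?orbT //.
split; first by rewrite -bin0 hC ?mem_head.
split.
  move=> y _; rewrite hblk => /mapP[t ht ->]; rewrite !field_tile // !hC ?hin //.
  by have [a b] := h2 t ht; split=> [/a/negP|/negP/b].
split.
  move=> y _ y' _; rewrite !hblk => /mapP[t ht ->] /mapP[t' ht' ->]; rewrite !field_tile // hC ?hin //.
  by move=> /bin_inj /= l1 /bin_inj /= l2 hcol; congr enc_tile; apply: (h3 _ _ hcol).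
move=> y _ y' _; rewrite !hblk => /mapP[t ht ->] /mapP[t' ht' ->]; rewrite !field_tile // hC ?hin //.
by move=> /bin_inj /= l1 /bin_inj /= l2 /negP hcol; congr enc_tile; apply: (h4 _ _ hcol).
Qed.

Lemma CC_rowbound f g : CC f -> CC g -> CC (fun e => rowbound (f e) (g e)).
Proof. by move=> hf hg; apply: C_cat (C_repeat hf hg) hg. Qed.

Lemma CC_white f : CC f -> CC (fun e => white_row (f e)).
Proof. by move=> hf; apply: C_push; apply: C_repeat hf (C_const _ _). Qed.

Ltac ddec2 := repeat first
  [ assumption | apply: DD_block | apply: DD_row | apply: DD_tform | apply: Dec_and | apply: Dec_or
  | apply: Dec_not | apply: Dec_iff | apply: DD_head | apply: DD_ex | apply: DD_all
  | apply: Dec_eq | apply: Dec_imp | apply: CC_rowbound | apply: CC_white ]; ccomp.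

Lemma DD_edge fx fu fy fr fU fV : CC fx -> CC fu -> CC fy -> CC fr -> CC fU -> CC fV ->
  DD (fun e => edge (fx e) (fu e) (fy e) (fr e) (fU e) (fV e)).
Proof.
move=> hx hu hy hr hU hV.
have h : DD (fun e => edge (nth [::] e 0) (nth [::] e 1) (nth [::] e 2) (nth [::] e 3)
    (nth [::] e 4) (nth [::] e 5)).
  by rewrite /edge; ddec2; apply: CC_rowbound; ccomp.
exact: (Dec_comp (F := fun e => [:: fx e; fu e; fy e; fr e; fU e; fV e])
  (Comp_cons hx (Comp_cons hu (Comp_cons hy (Comp_cons hr (Comp_cons hU hV))))) h).
Qed.

Lemma DD_detf fx fr : CC fx -> CC fr -> DD (fun e => detf (fx e) (fr e)).
Proof. by apply: DD_sub2; rewrite /detf /coldet; ddec2. Qed.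

(** Splits [x] into unary number, start tile and tile list, and thereby rejects strings that code no
    valid instance. *)
Definition fits_instance (x p y r : str) : Prop :=
  x = p ++ s_sharp :: y ++ r /\ (filter (predC1 s_mark) p = [::] /\ (tform y /\
  ((ohead r = Some s_sharp \/ r = [::]) /\
  ((forall b, size b <= size r -> block (r ++ [:: s_sharp]) b -> tform b) /\ detf x r)))).

Lemma DD_fits fx fp fy fr : CC fx -> CC fp -> CC fy -> CC fr ->
  DD (fun e => fits_instance (fx e) (fp e) (fy e) (fr e)).
Proof.
move=> hx hp hy hr.
have h : DD (fun e => fits_instance (nth [::] e 0) (nth [::] e 1) (nth [::] e 2) (nth [::] e 3)).
  rewrite /fits_instance; do 5!(apply: Dec_and; first by ddec2).
  by apply: DD_detf; ccomp.
exact: (Dec_comp (F := fun e => [:: fx e; fp e; fy e; fr e])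
  (Comp_cons hx (Comp_cons hp (Comp_cons hy hr))) h).
Qed.

Lemma encodeE n T t0 : encode n T t0 =
  nseq n s_mark ++ s_sharp :: enc_tile t0 ++ joinb (map enc_tile T).
Proof. by rewrite /encode /joinb -map_comp. Qed.

Lemma size_encode n T t0 :
  size (encode n T t0) = n + (size (enc_tile t0) + size (joinb (map enc_tile T))).+1.
Proof. by rewrite encodeE size_cat size_nseq /= size_cat. Qed.

Lemma size_in_joinb T t : t \in T -> size (enc_tile t) < size (joinb (map enc_tile T)).
Proof.
elim: T => //= s T IH; rewrite inE -/(joinb _) size_cat.
by case/orP=> [/eqP ->|/IH]; [exact: leq_addr|set X := size (joinb _); lia].
Qed.

Lemma fitsP x p y r : fits_instance x p y r <-> exists n T t0,
  [/\ x = encode n T t0, p = nseq n s_mark, y = enc_tile t0, r = joinb (map enc_tile T) & deterministic T].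
Proof.
have hdet n T t0 : detf (encode n T t0) (joinb (map enc_tile T)) <-> deterministic T.
  apply: detfP => [t /size_in_joinb|]; rewrite size_encode; lia.
split.
  move=> [hx [hp [/tformP[t0 ht0] [hr [/(blocks_tiles hr)[T hT] hd]]]]].
  have hp' : p = nseq (size p) s_mark.
    by apply/all_pred1P; move/eqP: hp; rewrite -(negbK (_ == _)) -has_filter has_predC negbK.
  have e : x = encode (size p) T t0 by rewrite encodeE hx ht0 hT -hp'.
  exists (size p), T, t0; split=> //; apply/(hdet (size p) T t0); rewrite -e -hT; exact: hd.
move=> [n [T [t0 [-> -> -> -> hd]]]].
have hh : ohead (joinb (map enc_tile T)) = Some s_sharp \/ joinb (map enc_tile T) = [::].
  by case: T {hd} => [|t T]; [right|left].
split; first exact: encodeE.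
split; first by apply/eqP; rewrite -(negbK (_ == _)) -has_filter has_predC negbK all_nseq /= eqxx orbT.
split; first by apply/tformP; exists t0.
by split=> //; split; [apply/blocks_tiles => //; exists T|apply/hdet].
Qed.

Lemma nseq_split n m (s s' : str) : nseq n s_mark ++ s_sharp :: s = nseq m s_mark ++ s_sharp :: s' ->
  n = m /\ s = s'.
Proof.
elim: n m => [|n IH] [|m] //=; first by case.
- by case=> /eqP; rewrite /s_sharp /s_mark neq_inord.
- by case=> /eqP; rewrite /s_sharp /s_mark neq_inord.
by case=> /IH[-> ->].
Qed.

Lemma encode_inj n T t0 n' T' t0' : encode n T t0 = encode n' T' t0' ->
  [/\ n = n', T = T' & t0 = t0'].
Proof.
rewrite !encodeE => /nseq_split[-> h].
have : enc_tile t0 ++ joinb (map enc_tile T) ++ [:: s_sharp] =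
    enc_tile t0' ++ joinb (map enc_tile T') ++ [:: s_sharp] by rewrite !catA h.
have [r hr] := joinb_end (map enc_tile T); have [r' hr'] := joinb_end (map enc_tile T').
rewrite hr hr' => /(split_sharp (enc_tile_nosharp _) (enc_tile_nosharp _)) [/enc_tile_inj -> e].
by split=> //; apply: row_uniq; rewrite hr hr' e.
Qed.

(** Total on all strings, because the padding has to be produced before the input is parsed. *)
Definition marks (x : str) : str :=
  transduce (fun q a => if (q == b1) && (a == s_mark) then (b1, [:: a]) else (b0, [::]))
    (fun _ => [::]) b1 x.

Lemma marks_encode n T t0 : marks (encode n T t0) = nseq n s_mark.
Proof.
rewrite encodeE /marks; set d := (fun q a => _).
have h0 l : transduce d (fun _ => [::]) b0 l = [::].
  by elim: l => //= a l IH; rewrite {1 3}/d (negbTE b01) /= IH.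
elim: n => [|n IH]; last by rewrite /= {1 3}/d !eqxx /= IH.
have hs : (s_sharp == s_mark) = false by rewrite /s_sharp /s_mark neq_inord.
by rewrite cat0s [LHS]/= (_ : d b1 s_sharp = (b0, [::])) /= ?h0 // /d hs andbF.
Qed.

(** * Space bounds for the two languages *)

Section Membership.
Variables (k : nat) (P : nat -> seq tile -> tile -> Prop) (Q : str -> str -> str -> str -> Prop).
Hypothesis k0 : 0 < k.
Hypothesis DDQ : DD (fun e => Q (nth [::] e 4) (nth [::] e 3) (nth [::] e 1) (nth [::] e 0)).
Hypothesis PQ : forall n T t0, deterministic T ->
  P n T t0 <-> Q (encode n T t0) (nseq (expk k n) b0) (enc_tile t0) (joinb (map enc_tile T)).
Hypothesis Pdet : forall n T t0, P n T t0 -> deterministic T.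

Lemma lang_in_kEXPSPACE : in_kEXPSPACE k (lang P).
Proof.
pose F (e : env) := exists p, size p <= size (nth [::] e 1) /\ exists y, size y <= size (nth [::] e 1) /\
  exists r, size r <= size (nth [::] e 1) /\
   (fits_instance (nth [::] e 1) p y r /\ Q (nth [::] e 1) (nth [::] e 0) y r).
apply: (@in_kEXPSPACE_intro 'I_4 b0 b1 b01 k (lang P) F (fun e => marks (nth [::] e 0))).
- by apply: C_transduce; ccomp.
- rewrite /F; do 3!(apply: DD_ex; first by ccomp); apply: Dec_and; first by apply: DD_fits; ccomp.
  by apply: Dec_ext DDQ => e; rewrite !nth_behead.
move=> x; rewrite /F /=; split.
  move=> [n [T [t0 [-> hP]]]]; have hd := Pdet hP.
  exists (nseq n s_mark); rewrite marks_encode size_encode !size_nseq; split; first by lia.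
  exists (enc_tile t0); split; first by lia.
  exists (joinb (map enc_tile T)); split; first by lia.
  by split; [apply/fitsP; exists n, T, t0|apply/PQ].
move=> [p [_ [y [_ [r [_ [/fitsP[n [T [t0 [-> _ -> -> hd]]]]]]]]]]].
by rewrite marks_encode size_nseq => /(PQ _ _ hd) h; exists n, T, t0.
Qed.
End Membership.

Theorem detTILING_in_kEXPSPACE k : 0 < k ->
  in_kEXPSPACE k (lang (detTILING (fun n => expk k.+1 n) (fun n => expk k n))).
Proof.
move=> k0.
(* Recursion depth [size u], which is [expk k n], means walks of length exactly [expk k.+1 n]. *)
apply: (@lang_in_kEXPSPACE k _ (fun x u y r => reach_in (edge x u y r) (size (rowbound u x))
   (size u) [::] (white_row u)) k0).
- refine (Dec_reach (A := 'I_4) (a0 := b0) (a1 := b1) b01 (R := fun U V e => edge (nth [::] e 4) (nth [::] e 3) (nth [::] e 1) (nth [::] e 0) U V)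
     (f := fun e => rowbound (nth [::] e 3) (nth [::] e 4)) (g := fun e => nth [::] e 3)
     (u := fun e => [::]) (v := fun e => white_row (nth [::] e 3)) _ _ _ _ _).
  + by apply: CC_rowbound; ccomp.
  + by ccomp.
  + by ccomp.
  + by apply: CC_white; ccomp.
  apply: (@DD_edge (fun e => nth [::] (behead (behead e)) 4) (fun e => nth [::] (behead (behead e)) 3)
    (fun e => nth [::] (behead (behead e)) 1) (fun e => nth [::] (behead (behead e)) 0)); ccomp.
- move=> n T t0 hd; set x := encode _ _ _; set u := nseq _ b0.
  have W0 : 0 < expk k n by case: (k) k0 => // k' _; rewrite /= expn_gt0.
  have hx t : t \in T -> size (enc_tile t) < size x.
    by move=> /size_in_joinb h; rewrite size_encode; lia.
  have hx0 : 0 < size x by rewrite size_encode addnS.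
  have hwhite : size (white_row u) <= size (rowbound u x).
    rewrite /white_row /rowbound size_cat /= -addn1 leq_add // !size_flatten /shape !map_nseq !sumn_nseq.
    by rewrite leq_mul2r; apply/orP; right; rewrite size_encode; case: (bin_nonempty (tleft t0)) => a [s e]; rewrite /enc_tile e /=; lia.
  rewrite reach_walk // white_rowE.
  have := @walk_tiling x (enc_tile t0) T t0 (expk k n) W0 erefl hx hx0 (2 ^ size u).
  rewrite -/u expn_gt0 => /(_ isT) ->; rewrite /detTILING /u size_nseq.
  by split=> [[_ //]|h]; split.
by move=> n T t0 [].
Qed.

Theorem detTILING_star_in_kEXPSPACE k : 0 < k ->
  in_kEXPSPACE k (lang (detTILING_star (fun n => expk k n))).
Proof.
move=> k0.
(* Its length is the recursion depth: three times the bound on the vertices, as in [walk_short]. *)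
pose R3 (u x : str) := rowbound u x ++ rowbound u x ++ rowbound u x.
have hedge : DD (fun e => edge (nth [::] e 0) (nth [::] e 1) (nth [::] e 2) (nth [::] e 3)
    (nth [::] e 4) (nth [::] e 5)) by apply: DD_edge; ccomp.
apply: (@lang_in_kEXPSPACE k _ (fun x u y r => reach_in (fun U V => edge x u y r U V \/ U = V)
   (size (rowbound u x)) (size (R3 u x)) [::] (white_row u)) k0).
- refine (Dec_reach (A := 'I_4) (a0 := b0) (a1 := b1) b01 (R := fun U V e => edge (nth [::] e 4) (nth [::] e 3) (nth [::] e 1) (nth [::] e 0) U V \/ U = V)
     (f := fun e => rowbound (nth [::] e 3) (nth [::] e 4)) (g := fun e => R3 (nth [::] e 3) (nth [::] e 4))
     (u := fun e => [::]) (v := fun e => white_row (nth [::] e 3)) _ _ _ _ _).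
  + by apply: CC_rowbound; ccomp.
  + by apply: CC_cat; [|apply: CC_cat]; apply: CC_rowbound; ccomp.
  + by ccomp.
  + by apply: CC_white; ccomp.
  apply: Dec_or; last by apply: Dec_eq; ccomp.
  apply: (@DD_edge (fun e => nth [::] (behead (behead e)) 4) (fun e => nth [::] (behead (behead e)) 3)
    (fun e => nth [::] (behead (behead e)) 1) (fun e => nth [::] (behead (behead e)) 0)); ccomp.
- move=> n T t0 hd; set x := encode _ _ _; set u := nseq _ b0.
  have W0 : 0 < expk k n by case: (k) k0 => // k' _; rewrite /= expn_gt0.
  have hx t : t \in T -> size (enc_tile t) < size x.
    by move=> /size_in_joinb h; rewrite size_encode; lia.
  have hx0 : 0 < size x by rewrite size_encode addnS.
  have hwhite : size (white_row u) <= size (rowbound u x).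
    rewrite /white_row /rowbound size_cat /= -addn1 leq_add // !size_flatten /shape !map_nseq !sumn_nseq.
    by rewrite leq_mul2r; apply/orP; right; rewrite size_encode; case: (bin_nonempty (tleft t0)) => a [s e]; rewrite /enc_tile e /=; lia.
  have [q [_ qP]] := hedge.
  pose E : rel str := fun U V => q [:: x; u; enc_tile t0; joinb (map enc_tile T); U; V].
  have hE U V : E U V <-> edge x u (enc_tile t0) (joinb (map enc_tile T)) U V.
    exact: (qP [:: x; u; enc_tile t0; joinb (map enc_tile T); U; V]).
  have key := @walk_tiling x (enc_tile t0) T t0 (expk k n) W0 erefl hx hx0.
  rewrite -/u in key; rewrite reach_walk //; move: hwhite; rewrite white_rowE => hwhite; split.
    move=> [_ [H [tau [H0 [h1 h2]]]]].
    have /(key H H0) hw : exists tau, is_tiling T H (expk k n) tau /\ tau 1 1 = t0 by exists tau.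
    have hw' := walk_ext (fun U V => proj2 (hE U V)) hw.
    have [m' hm' hw2] := @walk_short E (size (rowbound u x)) H [::] _ isT hw'.
    have hw3 := walk_ext (fun U V => proj1 (hE U V)) hw2.
    have hR (rb : str) : size (rb ++ rb ++ rb) = 3 * size rb by rewrite !size_cat; lia.
    by apply: walk_pad hwhite _ hw3; rewrite /R3 hR.
  move=> /walk_refl[m hm]; split=> //; case: m hm => [/= h|m hm].
    by case: (@colrow_nonempty (nseq (expk k n) 0)); rewrite -h.
  have [tau [h1 h2]] := proj1 (key m.+1 isT) hm.
  by exists m.+1, tau.
by move=> n T t0 [].
Qed.

(** * Hardness *)

End TilingStrings.

(* Vertical colours are [FMk], [FW] and [FV p c], where [p] is the parity of the row
   and [c] a tape cell (leftmost?, letter, head state).  Horizontal colours: [FZl] left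
   of the head, [FW] (white) right of it, [FR], [FL] for the head crossing rightwards,
   leftwards, [FFin] in the last row, [FD], [FE] padding the first row with blanks. *)
Section Colours.
Variables (Q Gamma : finType).

Definition cell : finType := (bool * Gamma * option Q)%type.

Inductive fcol := FW | FMk | FZl | FFin | FD | FE | FR of Q | FL of Q | FV of bool & cell.

Definition fcol_code (c : fcol) : 'I_6 + (Q + Q) + (bool * cell) :=
  match c with
  | FW => inl (inl (inord 0)) | FMk => inl (inl (inord 1)) | FZl => inl (inl (inord 2))
  | FFin => inl (inl (inord 3)) | FD => inl (inl (inord 4)) | FE => inl (inl (inord 5))
  | FR q => inl (inr (inl q)) | FL q => inl (inr (inr q)) | FV p x => inr (p, x)
  end.
Definition fcol_decode (k : 'I_6 + (Q + Q) + (bool * cell)) : fcol :=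
  match k with
  | inl (inl i) => match val i with 0 => FW | 1 => FMk | 2 => FZl | 3 => FFin | 4 => FD | _ => FE end
  | inl (inr (inl q)) => FR q | inl (inr (inr q)) => FL q | inr (p, x) => FV p x
  end.
Lemma fcol_codeK : cancel fcol_code fcol_decode.
Proof. by case=> //=; rewrite inordK. Qed.
HB.instance Definition _ := Finite.copy fcol (can_type fcol_codeK).

Definition in_Col (c : fcol) : bool :=
  match c with FW | FR _ | FL _ => true | FV p _ => ~~ p | _ => false end.

Variable delta : Q -> Gamma -> Q * Gamma * dir.
Variables (fin : Q) (blank : Gamma).

Definition blank_col : fcol := FV true (false, blank, None).

(** The tiles from [FW] on the left to [FZl] on the right form the first column, between the white
    border and the cells; downwards they alternate between [FMk] and [FW]. The tiles with a cell on
    top and [FW] below close the tiling; they demand parity [true], that is, a top in Col', since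
    white lies in Col. *)
Definition fok (l t r b : fcol) : bool :=
  match t with
  | FW => match l, r with
          | FW, FZl => b == FMk
          | FD, FW | FD, FE | FE, FW => b == blank_col
          | _, _ => false
          end
  | FMk => [&& l == FW, r == FZl & b == FW]
  | FV p (f, a, None) =>
    match l, r with
    | FZl, FZl | FW, FW => b == FV (~~ p) (f, a, None)
    | FR s, FW | FZl, FL s => b == FV (~~ p) (f, a, Some s)
    | FFin, FFin | FFin, FW => p && (b == FW)
    | _, _ => false
    end
  | FV p (f, a, Some s) =>
    let: (s', a', d) := delta s a in
    (match d with
     | DR => [&& l == FZl, r == FR s' & b == FV (~~ p) (f, a', None)]
     | DS => [&& l == FZl, r == FW & b == FV (~~ p) (f, a', Some s')]
     | DL => if f then [&& l == FZl, r == FW & b == FV (~~ p) (f, a', Some s')]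
             else [&& l == FL s', r == FW & b == FV (~~ p) (f, a', None)]
     end) || [&& p, f, s == fin, l == FZl, r == FFin & b == FW]
  | _ => false
  end.

Lemma fok_parity l t r b : fok l t r b -> in_Col t = ~~ in_Col b.
Proof.
case: t => //=.
- by case: l => //; case: r => // /eqP ->.
- by case/and3P => _ _ /eqP ->.
move=> p [[f a] [s|]].
  case: (delta s a) => [[s' a'] d] /orP[|/and5P[-> _ _ _ /andP[_ /eqP ->]]] //.
  by case: d; [case: f|..] => /and3P[_ _ /eqP ->] /=; rewrite ?negbK.
case: l => [||||||s|s|q c]; case: r => [||||||s'|s'|q' c'] //=;
  try (by move=> /eqP ->; rewrite /= negbK); by case/andP=> -> /eqP ->.
Qed.

Lemma fok_left l t r b r' b' : in_Col l -> fok l t r b -> fok l t r' b' -> r = r' /\ b = b'.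
Proof.
case: t => //=.
- by case: l => // _; case: r => // /eqP ->; case: r' => // /eqP ->.
- by move=> _ /and3P[_ /eqP -> /eqP ->] /and3P[_ /eqP -> /eqP ->].
move=> p [[f a] [s|]].
  case: (delta s a) => [[s' a'] d] hl.
  case/orP=> [h|/and5P[_ _ _ /eqP hz _]]; last by rewrite hz in hl.
  case/orP=> [|/and5P[_ _ _ /eqP hz _]]; last by rewrite hz in hl.
  by move: h; case: d; [case: (f)|..] => /and3P[_ /eqP -> /eqP ->] /and3P[_ /eqP -> /eqP ->].
by case: l => // [|s] _; case: r => // /eqP ->; case: r' => // /eqP ->.
Qed.

(** A head cell with right side in Col' can only be the closing one, with [FFin]: machine steps
    leave [FR] or white on the right of the head cell, both in Col. *)
Lemma fok_right l t r b l' b' : ~~ in_Col r -> fok l t r b -> fok l' t r b' -> l = l' /\ b = b'.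
Proof.
case: t => //=.
- by move=> hr; case: l => //; case: r hr => // _ /eqP ->; case: l' => // /eqP ->.
- by move=> _ /and3P[/eqP -> _ /eqP ->] /and3P[/eqP -> _ /eqP ->].
move=> p [[f a] [s|]].
  case: (delta s a) => [[s' a'] d] hr.
  have hn : (match d with
     | DR => [&& l == FZl, r == FR s' & b == FV (~~ p) (f, a', None)]
     | DS => [&& l == FZl, r == FW & b == FV (~~ p) (f, a', Some s')]
     | DL => if f then [&& l == FZl, r == FW & b == FV (~~ p) (f, a', Some s')]
             else [&& l == FL s', r == FW & b == FV (~~ p) (f, a', None)]
     end) = false.
    by apply/negbTE/negP; case: d; [case: (f)|..] => /and3P[_ /eqP hz _]; rewrite hz in hr.
  have hn' : (match d with
     | DR => [&& l' == FZl, r == FR s' & b' == FV (~~ p) (f, a', None)]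
     | DS => [&& l' == FZl, r == FW & b' == FV (~~ p) (f, a', Some s')]
     | DL => if f then [&& l' == FZl, r == FW & b' == FV (~~ p) (f, a', Some s')]
             else [&& l' == FL s', r == FW & b' == FV (~~ p) (f, a', None)]
     end) = false.
    by apply/negbTE/negP; case: d {hn}; [case: (f)|..] => /and3P[_ /eqP hz _]; rewrite hz in hr.
  rewrite hn hn' /= => /and5P[_ _ _ /eqP -> /andP[_ /eqP ->]].
  by case/and5P=> _ _ _ /eqP -> /andP[_ /eqP ->].
move=> hr; case: l => [||||||s|s|q c]; case: r hr => [||||||s'|s'|q' c'] //= _;
  case: l' => [||||||s2|s2|q2 c2] //=;
  (by move=> /eqP -> /eqP ->) || (by case/andP=> _ /eqP -> /andP[_ /eqP ->]).
Qed.

Definition fnum (c : fcol) : nat := if c == FW then 0 else (enum_rank c).+1.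
(** The offset exceeds every [fnum], so labels and fixed colours never clash and a single threshold
    puts all labels into Col. *)
Definition inum (r : nat) : nat := 2 ^ (#|{: fcol}|.+1 + r).

Lemma fnum_white : white = fnum FW.
Proof. by rewrite /fnum eqxx. Qed.

Lemma fnum_inj : injective fnum.
Proof.
move=> c d; rewrite /fnum; case: (c =P FW) => [->|_]; case: (d =P FW) => [->|_] //.
by case=> /val_inj/enum_rank_inj.
Qed.

Lemma fnum_lt c r : fnum c < inum r.
Proof.
apply: leq_trans (_ : #|{: fcol}|.+1 < _).
  by rewrite /fnum ltnS; case: eqP => // _; exact: ltnW (ltn_ord _).
by apply: leq_trans (ltn_expl _ (isT : 1 < 2)) _; rewrite leq_exp2l // leq_addr.
Qed.

Lemma fnum_inum c r : (fnum c == inum r) = false.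
Proof. by apply/negbTE; rewrite neq_ltn fnum_lt. Qed.

Lemma inum_inj : injective inum.
Proof. by move=> r r' /eqP; rewrite /inum eqn_exp2l // eqn_add2l => /eqP. Qed.

Definition ftile (x : fcol * fcol * fcol * fcol) : tile :=
  (fnum x.1.1.1, fnum x.1.1.2, fnum x.1.2, fnum x.2).

Definition ftiles : seq tile :=
  [seq ftile x | x <- enum {: fcol * fcol * fcol * fcol} & fok x.1.1.1 x.1.1.2 x.1.2 x.2].

Lemma ftilesP x : x \in ftiles <-> exists l t r b, fok l t r b /\ x = (fnum l, fnum t, fnum r, fnum b).
Proof.
split.
  by case/mapP=> [[[[l t] r] b]]; rewrite mem_filter => /andP[/= h _] ->; exists l, t, r, b.
move=> [l [t [r [b [h ->]]]]]; apply/mapP; exists (l, t, r, b) => //.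
by rewrite mem_filter mem_enum /= h.
Qed.

(* First row: cell 0, then the letters [a :: w], then the pair of blank tiles that
   [FD], [inum 0] repeat. *)
Definition itile (l r : nat) (b : fcol) : tile := (l, fnum FW, r, fnum b).

Fixpoint chain_tiles (w : seq Gamma) : seq tile :=
  if w is a :: w' then itile (inum (size w)) (inum (size w')) (FV true (false, a, None)) :: chain_tiles w'
  else [::].

Variable q0 : Q.

Definition first_tile (w : seq Gamma) : tile :=
  itile (fnum FZl) (inum (size w).-1) (FV true (true, head blank w, Some q0)).

(** The blanks may have to end at any column. Determinism leaves such a choice at a left side in
    Col', and [FD] is one: after it comes [inum 0] to go on, white to stop, or [FE] to stop one tile
    later, which takes care of the parity. *)
Definition blank_tiles : seq tile :=
  [:: itile (inum 0) (fnum FD) blank_col; itile (fnum FD) (inum 0) blank_col].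

Definition tileset (w : seq Gamma) : seq tile :=
  blank_tiles ++ ftiles ++ first_tile w :: chain_tiles (behead w).

Definition tile00 : tile := (fnum FW, fnum FW, fnum FZl, fnum FMk).

Lemma chain_tilesP w x : x \in chain_tiles w <-> exists2 r, r < size w &
  x = itile (inum r.+1) (inum r) (FV true (false, nth blank w (size w - r.+1), None)).
Proof.
elim: w x => [|a w IH] x /=; first by split=> // -[].
rewrite inE; split.
  case/orP=> [/eqP ->|/IH[r hr ->]]; first by exists (size w); rewrite ?subnn.
  by exists r; rewrite ?subSS; [exact: ltnW|rewrite (_ : size w - r = (size w - r.+1).+1) //; lia].
move=> [r]; rewrite ltnS leq_eqVlt => /orP[/eqP ->|hr] ->; first by rewrite subSS subnn eqxx.
apply/orP; right; apply/IH; exists r => //.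
by rewrite subSS (_ : size w - r = (size w - r.+1).+1) //; lia.
Qed.

Inductive tile_spec (w : seq Gamma) : tile -> Prop :=
| SpecF l t r b : fok l t r b -> tile_spec w (fnum l, fnum t, fnum r, fnum b)
| SpecFirst : tile_spec w (first_tile w)
| SpecChain r : r.+1 < size w -> tile_spec w (itile (inum r.+1) (inum r)
    (FV true (false, nth blank w ((size w).-1 - r), None)))
| SpecID : tile_spec w (itile (inum 0) (fnum FD) blank_col)
| SpecDI : tile_spec w (itile (fnum FD) (inum 0) blank_col).

Lemma tilesetP w x : x \in tileset w <-> tile_spec w x.
Proof.
have hn r : r.+1 < size w ->
    nth blank (behead w) (size (behead w) - r.+1) = nth blank w ((size w).-1 - r).
  move=> hr; rewrite nth_behead size_behead; congr nth.
  by case: (size w) hr => //= n; lia.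
rewrite /tileset /blank_tiles mem_cat mem_cat !inE; split.
  case/or3P=> [/orP[/eqP ->|/eqP ->]|/ftilesP[l [t [r [b [h ->]]]]]|/orP[/eqP ->|/chain_tilesP[r hr ->]]].
  - exact: SpecID.
  - exact: SpecDI.
  - exact: SpecF.
  - exact: SpecFirst.
  rewrite size_behead in hr; rewrite hn; last by lia.
  by apply: SpecChain; lia.
case=> [l t r b h||r hr||]; rewrite ?eqxx ?orbT //.
  by apply/or3P/Or32; apply/ftilesP; exists l, t, r, b.
apply/or3P/Or33/orP; right; apply/chain_tilesP; exists r; first by rewrite size_behead; lia.
by rewrite hn.
Qed.

Definition Col (n : color) : bool := [exists c : fcol, (fnum c == n) && in_Col c] || (2 ^ #|{: fcol}|.+1 <= n).

Lemma Col_fnum c : Col (fnum c) = in_Col c.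
Proof.
rewrite /Col; have := fnum_lt c 0; rewrite /inum addn0 ltnNge => /negbTE ->; rewrite orbF.
by apply/existsP/idP => [[d /andP[/eqP/fnum_inj ->]]|h] //; exists c; rewrite eqxx.
Qed.

Lemma Col_inum r : Col (inum r).
Proof. by rewrite /Col orbC leq_exp2l ?leq_addr. Qed.

Lemma tileset_deterministic w : deterministic (tileset w).
Proof.
exists Col; split; first by rewrite fnum_white Col_fnum.
split.
  move=> t /tilesetP[l t' r b /fok_parity h||r _||]; rewrite /ttop /tbottom /= !Col_fnum //=.
  by rewrite h; case: in_Col.
have nfi c r : fnum c = inum r -> False by move/eqP; rewrite fnum_inum.
have nif c r : inum r = fnum c -> False by move/eqP; rewrite eq_sym fnum_inum.
have clash := (Col_fnum, Col_inum).
split.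
  move=> c c' hc t1 t2 /tilesetP[l t r b h||r hr||] /tilesetP[l2 t2' r2 b2 h2||r2 hr2||];
    rewrite /tleft /ttop /=; move=> e1 p1 e2 p2; subst c c'; move: hc;
    repeat match goal with
    | h : fnum _ = fnum _ |- _ => move/fnum_inj: h => h; try subst
    | h : inum _ = inum _ |- _ => move/inum_inj: h => h; try discriminate h
    | h : fnum _ = inum _ |- _ => by case: (nfi _ _ h)
    | h : inum _ = fnum _ |- _ => by case: (nif _ _ h)
    end; try (by rewrite clash); try by [].
    by rewrite Col_fnum => hc; have [-> ->] := fok_left hc h h2.
  by case: e2 => ->.
move=> c c' hc t1 t2 /tilesetP[l t r b h||r hr||] /tilesetP[l2 t2' r2 b2 h2||r2 hr2||];
  rewrite /tright /ttop /=; move=> e1 p1 e2 p2; subst c c'; move: hc; try (by rewrite clash);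
  repeat match goal with
  | h : fnum _ = fnum _ |- _ => move/fnum_inj: h => h; try subst
  | h : fnum _ = inum _ |- _ => by case: (nfi _ _ h)
  | h : inum _ = fnum _ |- _ => by case: (nif _ _ h)
  end; try by [].
- by rewrite Col_fnum => hc; have [-> ->] := fok_right hc h h2.
- by case: (l) h.
by case: (l2) h2.
Qed.

End Colours.

(** * Rows of a tiling as steps of the machine *)

Section Simulation.
Variables (Q Gamma : finType) (delta : Q -> Gamma -> Q * Gamma * dir) (fin q0 : Q) (blank : Gamma).
Hypothesis delta_fin : forall a, delta fin a = (fin, a, DL).
Local Notation fcol := (fcol Q Gamma).
Local Notation FW := (FW Q Gamma).
Local Notation FMk := (FMk Q Gamma).
Local Notation FZl := (FZl Q Gamma).
Local Notation FFin := (FFin Q Gamma).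
Local Notation FD := (FD Q Gamma).
Local Notation FE := (FE Q Gamma).
Local Notation fok := (fok delta fin blank).
Local Notation fnum := (@fnum Q Gamma).
Local Notation inum := (@inum Q Gamma).

Record conf := Conf { cstate : Q; ctape : nat -> Gamma; chead : nat }.

Definition cstep (c : conf) : conf :=
  let: (s', a', d) := delta (cstate c) (ctape c (chead c)) in
  Conf s' (fun i => if i == chead c then a' else ctape c i) (move (chead c) d).

Definition cellc (c : conf) (j : nat) : cell Q Gamma :=
  (j == 0, ctape c j, if j == chead c then Some (cstate c) else None).

(* The colour between cells [j - 1] and [j] in the row simulating the step from [c]. *)
Definition bcol (c : conf) (j : nat) : fcol :=
  let: (s', a', d) := delta (cstate c) (ctape c (chead c)) in
  match d with
  | DR => if j <= chead c then FZl else if j == (chead c).+1 then FR Gamma s' else FW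
  | DL => if chead c is h.+1 then
            (if j <= h then FZl else if j == h.+1 then FL Gamma s' else FW)
          else if j <= chead c then FZl else FW
  | DS => if j <= chead c then FZl else FW
  end.

Lemma fok_cell c p j :
  fok (bcol c j) (FV p (cellc c j)) (bcol c j.+1) (FV (~~ p) (cellc (cstep c) j)).
Proof.
rewrite /bcol /cstep /cellc; case: c => s tp h /=.
case e: (delta s (tp h)) => [[s' a'] d] /=.
case: (j =P h) => [->|/eqP hj].
  rewrite e; case: d e => e /=.
  - case: h e => [|h] e /=; first by rewrite !eqxx.
    have f1 : (h.+1 < h) = false by lia.
    have f2 : (h.+2 == h.+1) = false by lia.
    have f3 : (h.+1 == h) = false by lia.
    by rewrite f1 f2 f3 ltnn !eqxx.
  - by rewrite leqnn ltnn (ltn_eqF (ltnSn h)) !eqxx.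
  by rewrite leqnn ltnn !eqxx.
case: d e => e /=.
- case: h hj e => [|h] hj e /=.
    by case: j hj => //= j _; rewrite eqxx.
  case: (ltngtP j h) => hjh.
  + by rewrite eqxx.
  + by rewrite (negbTE hj) eqSS (gtn_eqF hjh) eqxx.
  by rewrite hjh eqxx /= eqxx.
- rewrite eqSS; case: (ltngtP j h) hj => // hjh _.
    by have -> : (j == h.+1) = false by lia; rewrite eqxx.
  by case: (j == h.+1); rewrite eqxx.
by case: (ltngtP j h) hj => // hjh _; rewrite eqxx.
Qed.

(** Complements [fok_right]: [FL s] lies in Col, yet on the right of a cell without head it still
    determines the tile. *)
Lemma fok_right_plain l l' p f a r b b' : (r = FZl \/ exists s, r = FL Gamma s) ->
  fok l (FV p (f, a, None)) r b -> fok l' (FV p (f, a, None)) r b' -> l = l' /\ b = b'.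
Proof. by case=> [->|[s ->]] /=; case: l => // /eqP ->; case: l' => // /eqP ->. Qed.

(** The row is forced from the head outwards: the head tile by the transition, the cells on its left
    by their right sides, those on its right by their left sides. A state other than [fin] excludes
    the closing tile. *)
Lemma row_step c p m (l r b : nat -> fcol) : chead c < m -> cstate c != fin ->
  (forall j, j < m -> fok (l j) (FV p (cellc c j)) (r j) (b j)) ->
  (forall j, j.+1 < m -> r j = l j.+1) ->
  forall j, j < m -> [/\ l j = bcol c j, r j = bcol c j.+1 & b j = FV (~~ p) (cellc (cstep c) j)].
Proof.
move=> hm hfin hok hadj.
have hhead : [/\ l (chead c) = bcol c (chead c), r (chead c) = bcol c (chead c).+1 &
   b (chead c) = FV (~~ p) (cellc (cstep c) (chead c))].
  have := hok _ hm; rewrite /bcol /cstep /cellc; case: (c) hfin => s tp h /= hfin.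
  case e: (delta s (tp h)) => [[s' a'] d] /=; rewrite eqxx /= e (negbTE hfin) !andbF orbF.
  case: d e => e; rewrite /= ?leqnn ?ltnn ?eqxx.
  - case: h e => [|h] e /= /and3P[/eqP -> /eqP -> /eqP ->] //.
    have f1 : (h.+1 < h) = false by lia.
    have f2 : (h.+2 == h.+1) = false by lia.
    have f3 : (h.+1 == h) = false by lia.
    by rewrite f1 f2 f3 ltnn eqxx.
  - by move=> /and3P[/eqP -> /eqP -> /eqP ->]; rewrite (ltn_eqF (ltnSn h)).
  by move=> /and3P[/eqP -> /eqP -> /eqP ->].
have hleft : forall i, i <= chead c -> let j := chead c - i in
   [/\ l j = bcol c j, r j = bcol c j.+1 & b j = FV (~~ p) (cellc (cstep c) j)].
  elim=> [|i IH] hi j; first by rewrite /j subn0.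
  have [IHl _ _] := IH (ltnW hi).
  have hj : chead c - i = j.+1 by rewrite /j; lia.
  rewrite hj in IHl; have hjm : j.+1 < m by rewrite /j; lia.
  have hr : r j = bcol c j.+1 by rewrite hadj.
  have := hok j (ltnW hjm); have := fok_cell c p j; rewrite hr.
  have hjh : j < chead c by rewrite /j; lia.
  have : cellc c j = (j == 0, ctape c j, None) by rewrite /cellc (ltn_eqF hjh).
  have : bcol c j.+1 = FZl \/ exists s, bcol c j.+1 = FL Gamma s.
    rewrite /bcol; case: (delta _ _) => [[s' a'] d]; case: d; rewrite ?hjh; [|by left|by left].
    case: (chead c) hjh => // h; rewrite ltnS leq_eqVlt eqSS => /orP[/eqP ->|->]; last by left.
    by rewrite ltnn eqxx; right; exists s'.
  move=> hr' -> h1 h2; have [-> ->] := fok_right_plain hr' h2 h1.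
  by [].
have hright : forall i, chead c + i < m -> let j := chead c + i in
   [/\ l j = bcol c j, r j = bcol c j.+1 & b j = FV (~~ p) (cellc (cstep c) j)].
  elim=> [|i IH] hi j; first by rewrite /j addn0.
  rewrite /j addnS in hi *; have [_ IHr _] := IH (ltnW hi).
  have hl : l (chead c + i).+1 = bcol c (chead c + i).+1 by rewrite -hadj.
  have := hok _ hi; have := fok_cell c p (chead c + i).+1; rewrite hl => h1 h2.
  have hc : in_Col (bcol c (chead c + i).+1).
    have: chead c < (chead c + i).+1 by rewrite ltnS leq_addr.
    move: (chead c + i).+1 => k hk; rewrite /bcol; case: (delta _ _) => [[s' a'] d].
    case: d; last by rewrite leqNgt hk.
      case: (chead c) hk => [|h'] hk; first by rewrite leqNgt hk.
      have f1 : (k <= h') = false by lia.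
      have f2 : (k == h'.+1) = false by lia.
      by rewrite f1 f2.
    by rewrite leqNgt hk /=; case: eqP.
  by have [-> ->] := fok_left hc h2 h1.
move=> j hj; case: (leqP j (chead c)) => h.
  by have := hleft (chead c - j) (leq_subr _ _); rewrite /= subKn.
by have := hright (j - chead c); rewrite /= subnKC ?(ltnW h) //; apply.
Qed.

Variable w : seq Gamma.
Local Notation tileset := (tileset delta fin blank q0 w).
Local Notation tile_spec := (tile_spec delta fin blank q0 w).
Local Notation tile00 := (tile00 Q Gamma).

Definition conf0 : conf := Conf q0 (fun i => nth blank w i) 0.
Definition confn i := iter i cstep conf0.

Lemma nfi (c : fcol) r : fnum c = inum r -> False.
Proof. by move/eqP; rewrite fnum_inum. Qed.

Lemma tile_top_cell t p c : t \in tileset -> ttop t = fnum (FV p c) ->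
  exists l r b, fok l (FV p c) r b /\ t = (fnum l, fnum (FV p c), fnum r, fnum b).
Proof.
case/tilesetP=> [l t' r b h||r _||]; rewrite [ttop _]/= => /fnum_inj // e.
by exists l, r, b; rewrite -e.
Qed.

Lemma tile_top_mark t : t \in tileset -> ttop t = fnum FMk ->
  t = (fnum FW, fnum FMk, fnum FZl, fnum FW).
Proof.
case/tilesetP=> [l t' r b h||r _||]; rewrite /ttop /= => /fnum_inj // e; subst t'.
by case/and3P: h => /eqP -> /eqP -> /eqP ->.
Qed.

Lemma tile_white_white t : t \in tileset -> tleft t = fnum FW -> ttop t = fnum FW -> t = tile00.
Proof.
case/tilesetP=> [l t' r b h||r _||]; rewrite /ttop /tleft /=.
- by move=> /fnum_inj e1 /fnum_inj e2; subst; case: (r) h => // /eqP ->.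
- by move/fnum_inj.
- by move/esym/nfi.
- by move/esym/nfi.
by move/fnum_inj.
Qed.

Lemma tile_FR_top t s : t \in tileset -> tleft t = fnum (FR Gamma s) ->
  ttop t = fnum FW \/ ttop t = fnum FMk -> False.
Proof.
case/tilesetP=> [l t' r b h||r _||]; rewrite /ttop /tleft /=.
- by move=> /fnum_inj e1 [] /fnum_inj e2; subst.
- by move/fnum_inj.
- by move/esym/nfi.
- by move/esym/nfi.
by move/fnum_inj.
Qed.

Lemma bcol_end c m : chead c < m ->
  bcol c m = FW \/ (exists s, bcol c m = FR Gamma s) /\ m = (chead c).+1.
Proof.
move=> hm; rewrite /bcol; case: (delta _ _) => [[s' a'] d]; case: d.
- case: (chead c) hm => [|h] hm; left; first by rewrite leqNgt hm.
  have f1 : (m <= h) = false by lia.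
  have f2 : (m == h.+1) = false by lia.
  by rewrite f1 f2.
- rewrite leqNgt hm /=; case: eqP => [e|_]; last by left.
  by right; split=> //; exists s'.
by left; rewrite leqNgt hm.
Qed.

Definition finv (n : nat) : fcol := odflt FW [pick c | fnum c == n].

Lemma finvK (c : fcol) : finv (fnum c) = c.
Proof.
rewrite /finv; case: pickP => [d /eqP/fnum_inj //|/(_ c)].
by rewrite eqxx.
Qed.

(** * A tiling yields an accepting computation *)

Section Soundness.
Variables (H W : nat) (tau : nat -> nat -> tile).
Hypothesis htau : is_tiling tileset H W tau.
Hypothesis h00 : tau 1 1 = tile00.
Hypotheses (H0 : 0 < H) (W0 : 0 < W).
Hypothesis hfin : forall i, cstate (confn i) != fin.

Let inT i j : i < H -> j < W -> tau i.+1 j.+1 \in tileset.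
Proof. by move=> hi hj; case: htau => h _; apply: h. Qed.

Let lborder i : i < H -> tleft (tau i.+1 1) = fnum FW.
Proof. by move=> hi; case: htau => _ [h _]; have [|-> _] := h i.+1; last exact: fnum_white. Qed.

Let rborder i : i < H -> tright (tau i.+1 W) = fnum FW.
Proof. by move=> hi; case: htau => _ [h _]; have [|_ ->] := h i.+1; last exact: fnum_white. Qed.

Let tborder j : j < W -> ttop (tau 1 j.+1) = fnum FW.
Proof. by move=> hj; case: htau => _ [_ [h _]]; have [|-> _] := h j.+1; last exact: fnum_white. Qed.

Let bborder j : j < W -> tbottom (tau H j.+1) = fnum FW.
Proof. by move=> hj; case: htau => _ [_ [h _]]; have [|_ ->] := h j.+1; last exact: fnum_white. Qed.

Let hadj i j : i < H -> j.+1 < W -> tright (tau i.+1 j.+1) = tleft (tau i.+1 j.+2).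
Proof. by move=> hi hj; case: htau => _ [_ [_ [h _]]]; apply: h. Qed.

Let vadj i j : i.+1 < H -> j < W -> tbottom (tau i.+1 j.+1) = ttop (tau i.+2 j.+1).
Proof. by move=> hi hj; case: htau => _ [_ [_ [_ h]]]; apply: h. Qed.

Let seg m := (0 < m) && (tright (tau 1 m.+1) == fnum FW).

Let seg_exists : exists m, seg m.
Proof.
exists W.-1; rewrite /seg prednK // rborder // eqxx andbT.
by case: (W) rborder W0 => // -[|//] /(_ 0 H0); rewrite h00 => /fnum_inj.
Qed.

(* Two tilings of the same height can be put side by side, so a tiling may contain
   several computations; the first one occupies columns [1, ..., m + 1]. *)
Let m := ex_minn seg_exists.

Let m_seg : seg m.
Proof. by rewrite /m; case: ex_minnP. Qed.

Let m0 : 0 < m.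
Proof. by case/andP: m_seg. Qed.

Let mW : m < W.
Proof.
rewrite /m; case: ex_minnP => k _ /(_ W.-1); have := seg_exists.
have hs : seg W.-1.
  rewrite /seg prednK // rborder // eqxx andbT.
  by case: (W) rborder W0 => // -[|//] /(_ 0 H0); rewrite h00 => /fnum_inj.
by move=> _ /(_ hs); lia.
Qed.

Let m_min j : j.+1 < m -> tright (tau 1 j.+2) <> fnum FW.
Proof.
rewrite /m; case: ex_minnP => k _ hmin hj e.
by have := hmin j.+1; rewrite /seg e eqxx => /(_ isT); lia.
Qed.

(** Possible left sides above cell [j]. Past the input the position within the alternation is left
    open, as all these tiles carry a blank. *)
Let row1_left j (L : nat) :=
  if j is j'.+1 then
    if j' <= (size w).-1 then L = inum ((size w).-1 - j')
    else [\/ L = inum 0, L = fnum FD | L = fnum FE]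
  else L = fnum FZl.

Let row1 j : j < m -> row1_left j (tleft (tau 1 j.+2)) /\
  tbottom (tau 1 j.+2) = fnum (FV true (cellc conf0 j)).
Proof.
have cell_blank j' : size w <= j'.+1 -> blank_col Q blank = FV true (cellc conf0 j'.+1).
  by move=> h; rewrite /cellc /= nth_default.
have key j' : j' < m -> row1_left j' (tleft (tau 1 j'.+2)) ->
    tbottom (tau 1 j'.+2) = fnum (FV true (cellc conf0 j')) /\
    (tright (tau 1 j'.+2) <> fnum FW -> row1_left j'.+1 (tright (tau 1 j'.+2))).
  move=> hj'; have hW : j'.+1 < W by have := mW; lia.
  have := tborder hW; have /tilesetP := inT H0 hW; move: (tau 1 j'.+2) => t.
  case=> [l t' r b h||r hr||]; rewrite /ttop /tleft /tbottom /tright /= => /fnum_inj e0; subst.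
  - case: j' {hj' hW} => [|j'] /=; first by move/fnum_inj => e; subst l; case: (r) h.
    case: (leqP j' (size w).-1) => hj; first by move/nfi.
    case=> [/nfi //|/fnum_inj e|/fnum_inj e]; subst l.
      have hb : b = blank_col Q blank by case: (r) h => // /eqP.
      rewrite hb -cell_blank; last by lia.
      split=> //; case: (r) h => // _ _.
      by rewrite (_ : (j' < (size w).-1) = false); [constructor 3|lia].
    have hb : b = blank_col Q blank by case: (r) h => // /eqP.
    rewrite hb -cell_blank; last by lia.
    by split=> //; case: (r) h => // _ [].
  - case: j' {hj' hW} => [|j'] /=.
      move=> _; split; last by rewrite subn0.
      by congr (fnum (FV true _)); rewrite /cellc /= nth0.
    case: (leqP j' (size w).-1) => hj; first by move/nfi.
    by case=> [/nfi //|/fnum_inj|/fnum_inj].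
  - case: j' {hj' hW} => [|j'] /=; first by move/esym/nfi.
    case: (leqP j' (size w).-1) => hj; last by case=> [/inum_inj//|/esym/nfi|/esym/nfi].
    move/inum_inj => e; split.
      congr (fnum (FV true _)); rewrite /cellc /=; congr (_, nth _ _ _, _); lia.
    by move=> _; rewrite (_ : j' < (size w).-1); [congr inum; lia|lia].
  - case: j' {hj' hW} => [|j'] /=; first by move/esym/nfi.
    case: (leqP j' (size w).-1) => hj.
      move/inum_inj => e; rewrite -cell_blank; last by lia.
      by split=> // _; rewrite (_ : (j' < (size w).-1) = false); [constructor 2|lia].
    move=> _; rewrite -cell_blank; last by lia.
    by split=> // _; rewrite (_ : (j' < (size w).-1) = false); [constructor 2|lia].
  case: j' {hj' hW} => [|j'] /=; first by move/fnum_inj.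
  case: (leqP j' (size w).-1) => hj; first by move/nfi.
  move=> _; rewrite -cell_blank; last by lia.
  by split=> // _; rewrite (_ : (j' < (size w).-1) = false); [constructor 1|lia].
elim: j => [|j IH] hj.
  have hl : tleft (tau 1 2) = fnum FZl by rewrite -hadj ?h00 //; have := mW; lia.
  by split=> //; have [] := key 0 hj hl.
have [IHl _] := IH (ltnW hj); have [_ hnext] := key j (ltnW hj) IHl.
have hl : row1_left j.+1 (tleft (tau 1 j.+3)).
  by rewrite -hadj //; [exact: hnext (m_min hj)|have := mW; lia].
by split=> //; have [] := key j.+1 hj hl.
Qed.

Let mark i : fcol := if odd i then FW else FMk.

(** The last clause guards the right end: if a further computation starts in column [m + 2], its
    marker column stays in step with the first one, so that no [FR] can enter it. *)
Let inv i := [/\ chead (confn i) < m,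
  forall j, j < m -> tbottom (tau i.+1 j.+2) = fnum (FV (~~ odd i) (cellc (confn i) j)),
  tbottom (tau i.+1 1) = fnum (mark i) &
  m.+1 < W -> tbottom (tau i.+1 m.+2) = fnum (mark i)].

Let inv0 : inv 0.
Proof.
split=> //; first by move=> j /row1[].
- by rewrite h00.
move=> hm; rewrite (tile_white_white (t := tau 1 m.+2)) ?inT ?tborder //.
by rewrite -hadj //; case/andP: m_seg => _ /eqP.
Qed.

Let next_mark i j : i.+1 < H -> j < W -> tbottom (tau i.+1 j.+1) = fnum (mark i) ->
  tleft (tau i.+2 j.+1) = fnum FW ->
  tbottom (tau i.+2 j.+1) = fnum (mark i.+1) /\ tright (tau i.+2 j.+1) = fnum FZl.
Proof.
move=> hi hj; rewrite vadj // /mark /=; case: (odd i) => /= ht hl.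
  by rewrite (tile_white_white (inT hi hj) hl ht).
by rewrite (tile_top_mark (inT hi hj) ht).
Qed.

Let invS i : i.+1 < H -> inv i -> inv i.+1.
Proof.
move=> hi [hh hb hm hm2]; have mW' := mW.
have [hm' hz] := next_mark hi W0 hm (lborder hi).
pose l j := finv (tleft (tau i.+2 j.+2)); pose r j := finv (tright (tau i.+2 j.+2)).
pose b j := finv (tbottom (tau i.+2 j.+2)).
have hfok j : j < m -> fok (l j) (FV (~~ odd i) (cellc (confn i) j)) (r j) (b j) /\
    tau i.+2 j.+2 = (fnum (l j), fnum (FV (~~ odd i) (cellc (confn i) j)), fnum (r j), fnum (b j)).
  move=> hj; have hjW : j.+1 < W by lia.
  have ht : ttop (tau i.+2 j.+2) = fnum (FV (~~ odd i) (cellc (confn i) j)).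
    by rewrite -vadj // hb.
  have [l' [r' [b' [h e]]]] := tile_top_cell (inT hi hjW) ht.
  by rewrite /l /r /b e /tleft /tright /tbottom /= !finvK.
have hadj' j : j.+1 < m -> r j = l j.+1 by move=> hj; rewrite /r /l hadj //; lia.
have hrow := row_step hh (hfin i) (fun j hj => proj1 (hfok j hj)) hadj'.
have hright : tright (tau i.+2 m.+1) = fnum (bcol (confn i) m).
  have hm1 : m.-1 < m by rewrite prednK.
  have [_ hr _] := hrow _ hm1; have [_ e] := hfok _ hm1.
  by rewrite prednK // in hr e; rewrite e /tright /= hr.
(* A head leaving to the right would meet the white border or a marker column, and neither accepts
   [FR]. *)
have hend : bcol (confn i) m = FW.
  case: (bcol_end hh) => // -[[s hs] _]; rewrite hs in hright.
  case: (ltngtP m.+1 W) mW' => // [hmW|e] _; last first.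
    by move: (rborder hi); rewrite -e hright => /fnum_inj.
  rewrite hadj // in hright; case: (tile_FR_top (inT hi hmW) hright).
  by rewrite -vadj // hm2 // /mark; case: odd; [left|right].
rewrite hend in hright.
have hh' : chead (confn i.+1) < m.
  have := hend; rewrite /confn iterS -/(confn i) /bcol /cstep.
  case: (delta _ _) => [[s' a'] d]; case: d => //=; first by lia.
  rewrite leqNgt hh /=; case: eqP => // hne _; lia.
split=> //.
  move=> j hj; have [_ _ hbj] := hrow j hj; have [_ e] := hfok j hj.
  by rewrite e /tbottom /= hbj.
move=> hmW; have hl : tleft (tau i.+2 m.+2) = fnum FW by rewrite -hadj.
by have [] := next_mark hi hmW (hm2 hmW) hl.
Qed.

(** The bottom border asks for white in the last row, where the invariant puts a cell. *)
Lemma no_tiling : False.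
Proof.
have hinv i : i < H -> inv i by elim: i => // i IH hi; apply: invS (IH (ltnW hi)).
have hH : H.-1 < H by rewrite prednK.
have [_ hb _ _] := hinv _ hH; have := hb 0 m0; rewrite prednK // bborder.
  by move/fnum_inj.
by have := mW; have := m0; lia.
Qed.

End Soundness.

Lemma tiling_reaches_fin H W : 0 < H -> 0 < W ->
  (exists tau, is_tiling tileset H W tau /\ tau 1 1 = tile00) -> exists i, cstate (confn i) = fin.
Proof.
move=> H0 W0 [tau [htau h00]]; apply: NNPP => hn; apply: (no_tiling htau h00 H0 W0) => i.
by apply/eqP => h; apply: hn; exists i.
Qed.

(** * An accepting computation yields a tiling *)

Section Completeness.
Variables (H W : nat).
Hypotheses (H_even : ~~ odd H) (H1 : 1 < H) (W6 : size w + 6 <= W).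
Hypothesis small : forall i, chead (confn i) < W.-1.
Hypothesis at_end : cstate (confn H.-2) = fin /\ chead (confn H.-2) = 0.

Let J := W.-1.
Let n1 := (size w).-1.

(** A countdown over the input, then [FD] and [inum 0] in turn up to the white border. [FE] replaces
    [inum 0] right before the border, which [inum 0] could not reach. *)
Definition lab (j : nat) : nat :=
  if j is j'.+1 then
    if j' <= n1 then inum (n1 - j') else
    if j == J then fnum FW else
    if odd (j' - n1) then fnum FD else if j == J.-1 then fnum FE else inum 0
  else fnum FZl.

Lemma tile_row1 j : j < J ->
  (lab j, fnum FW, lab j.+1, fnum (FV true (cellc conf0 j))) \in tileset.
Proof.
have hJ : size w + 5 <= J by rewrite /J; lia.
have hn1 : n1 <= size w by rewrite /n1; lia.
have cell_blank j' : size w <= j'.+1 -> blank_col Q blank = FV true (cellc conf0 j'.+1).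
  by move=> h; rewrite /cellc /= nth_default.
move=> hj; apply/tilesetP; case: j hj => [|j] hj.
  have -> : (lab 0, fnum FW, lab 1, fnum (FV true (cellc conf0 0))) = first_tile blank q0 w.
    by rewrite /lab /= subn0 /first_tile /itile /cellc /= nth0.
  exact: SpecFirst.
rewrite /lab; case: (ltngtP j n1) => hjn.
- rewrite (_ : n1 - j = (n1 - j.+1).+1); last by lia.
  have -> : cellc conf0 j.+1 = (false, nth blank w ((size w).-1 - (n1 - j.+1)), None).
    by rewrite /cellc /=; congr (_, nth _ _ _, _); rewrite /n1 in hjn *; lia.
  by apply: SpecChain; rewrite /n1 in hjn *; lia.
- rewrite -cell_blank; last by rewrite /n1 in hjn; lia.
  have -> : (j.+1 == J) = false by lia.
  have -> : j.+1 - n1 = (j - n1).+1 by lia.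
  rewrite /=; case: (boolP (odd (j - n1))) => ho /=.
    case: (j.+2 =P J) => hJ2; first by apply: SpecF; rewrite /= eqxx.
    by case: (j.+2 =P J.-1) => hJ1; [apply: SpecF; rewrite /= eqxx|exact: SpecDI].
  case: (j.+1 =P J.-1) => hJ1.
    have -> : (j.+2 == J) = true by lia.
    by apply: SpecF; rewrite /= eqxx.
  have -> : (j.+2 == J) = false by lia.
  exact: SpecID.
rewrite hjn subnn -cell_blank; last by rewrite /n1; lia.
have -> : (n1.+2 == J) = false by lia.
have -> : n1.+1 - n1 = 1 by lia.
exact: SpecID.
Qed.

Lemma lab_end : lab J = fnum FW.
Proof.
have hJ : size w + 5 <= J by rewrite /J; lia.
have hn1 : n1 <= size w by rewrite /n1; lia.
rewrite /lab; case: J hJ => [|J'] hJ; first by lia.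
by rewrite eqxx (_ : (J' <= n1) = false) //; lia.
Qed.

(** The head is left of [J] in the next configuration too, so no [FR] crosses the right border. *)
Lemma bcol_J i : bcol (confn i) J = FW.
Proof.
case: (bcol_end (small i)) => // -[[s hs] hm']; have := small i.+1.
have hm : J = (chead (confn i)).+1 := hm'.
rewrite /confn iterS -/(confn i) /cstep; move: hs; rewrite /bcol.
case: (delta _ _) => [[s' a'] d]; case: d => /=.
- case: (chead _) hm => [|h] hm; first by rewrite -/J hm.
  rewrite -/J hm; have -> : (h.+2 <= h) = false by lia.
  by have -> : (h.+2 == h.+1) = false by lia.
- by move=> _; rewrite -/J {1}hm ltnn.
by rewrite -/J hm ltnn.
Qed.

Lemma bcol0 c : bcol c 0 = FZl.
Proof.
rewrite /bcol; case: (delta _ _) => [[s' a'] d]; case: d => //.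
by case: (chead c).
Qed.

(** Row 1 only writes the initial configuration, so row [i] starts from [confn i.-2]; cell [j'] sits
    in column [j'.+2], behind the marker column. *)
Definition full_tiling (i j : nat) : tile :=
  match j with
  | j'.+2 =>
    if i == 1 then (lab j', fnum FW, lab j'.+1, fnum (FV true (cellc conf0 j'))) else
    let c := confn i.-2 in
    if i == H then (fnum (if j' == 0 then FZl else FFin), fnum (FV true (cellc c j')),
                    fnum (if j'.+1 == J then FW else FFin), fnum FW)
    else (fnum (bcol c j'), fnum (FV (~~ odd i) (cellc c j')), fnum (bcol c j'.+1),
          fnum (FV (~~ ~~ odd i) (cellc (cstep c) j')))
  | _ => if odd i then tile00 else (fnum FW, fnum FMk, fnum FZl, fnum FW)
  end.

Lemma fin_head_ok a : fok FZl (FV true (true, a, Some fin)) FFin FW.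
Proof. by rewrite /= delta_fin !eqxx orbT. Qed.

Lemma full_tiling_ok : is_tiling tileset H W full_tiling /\ full_tiling 1 1 = tile00.
Proof.
have eW : white = fnum FW := fnum_white Q Gamma.
have hJ : size w + 5 <= J by rewrite /J; lia.
have WJ : W = J.+1 by rewrite /J; lia.
have W2 : W = J.-1.+2 by rewrite /J; lia.
have J1 : J.-1.+1 = J by rewrite prednK //; lia.
split; last by [].
split; [|split; [|split; [|split]]].
- move=> i [|[|j]] // hi hj.
    rewrite /full_tiling; by case: (odd i); apply/tilesetP; apply: SpecF; rewrite /= !eqxx.
  rewrite /full_tiling; case: (i =P 1) => [_|hi1]; first by apply: tile_row1; lia.
  case: (i =P H) => [->|hiH].
    have [hs hh] := at_end; apply/tilesetP; apply: SpecF; rewrite /cellc hh hs.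
    by case: j hj => [|j] hj; [rewrite (_ : (1 == J) = false); [exact: fin_head_ok|lia]|case: (_ == J); rewrite /= eqxx].
  by apply/tilesetP/SpecF; exact: fok_cell.
- move=> i hi; split; first by rewrite /full_tiling eW; case: odd.
  rewrite W2 /full_tiling J1; case: (i == 1); first by rewrite eW /tright /= lab_end.
  by case: (i == H); rewrite eW /tright /= ?eqxx ?bcol_J.
- move=> [|[|j]] // hj; split; rewrite eW //.
  + by rewrite /full_tiling (negbTE H_even).
  by rewrite /full_tiling (gtn_eqF H1) eqxx.
- move=> i [|[|j]] // hi hj; rewrite /full_tiling.
    have -> : tright (if odd i then tile00 else (fnum FW, fnum FMk, fnum FZl, fnum FW)) = fnum FZl.
      by case: odd.
    case: (i == 1) => //; case: (i == H) => //.
    by rewrite /tleft /= bcol0.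
  case: (i == 1) => //; case: (i == H) => //.
  by rewrite /tright /tleft /=; have -> : (j.+1 == J) = false by lia.
move=> i [|[|j]] // hi hj; rewrite /full_tiling.
  by rewrite /=; case: odd.
case: i hi => [|[|i]] // hi.
  have -> : (2 == 1) = false by [].
  by case: (2 =P H).
have -> : (i.+3 == 1) = false by [].
have -> : (i.+2 == 1) = false by [].
have -> : (i.+2 == H) = false by lia.
case: (i.+3 =P H) => hiH.
  rewrite /tbottom /ttop /= /confn /= negbK.
  have -> : odd i = true by move: H_even; rewrite -hiH /= !negbK.
  by [].
by [].
Qed.

End Completeness.
End Simulation.

(** * From programs to polynomial-time functions *)

Lemma polyb_peval B : polyb B -> exists p, forall n, B n <= peval p n.
Proof.
by move=> [a ha]; have [p hp] := pow_peval a; exists p => n; apply: leq_trans (ha n) (hp n).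
Qed.

Section PolyTime.
Variables (Sigma Sigma' : finType).
Local Notation A := (Sigma + Sigma')%type.

(** The result is reversed into register 0 and the saved input is cleared, so that the final tape
    looks like the initial tape on [f w]. *)
Lemma poly_time_intro (f : seq Sigma -> seq Sigma') (g : seq (seq A) -> seq A) :
  @C A true g -> (forall w, g [:: map inl w] = map inr (f w)) -> poly_time_computable f.
Proof.
move=> [p [B [hB hc]]] hg.
pose c := Then (@movrev A 0 1) (Then (p [:: 1] 2) (Then (@movrev A 2 0) (clear A 1))).
pose acc (x : column A (maxreg c)) := true.
pose M n := n + B n.
pose T n := unit_cost A * n.+1 + (B n + (unit_cost A * (B n).+1 + (3 * n + 1))).
have [ps hps] : exists ps, forall n, T n * (2 * M n + 4) + 2 <= peval ps n.
  by apply: polyb_peval; rewrite /T /M; polyb.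
exists (letter A (maxreg c)), (letter_of c None), (fun x => letter_of c (Some (inl x))),
  (fun y => letter_of c (Some (inr y))), (@cmd_tm A c acc), ps.
have inl_inj : injective (@inl Sigma Sigma') by move=> x y [].
have inr_inj : injective (@inr Sigma Sigma') by move=> x y [].
split; first exact: letter_of_embedding.
split; first exact: letter_of_embedding.
move=> w; set v : seq A := map inl w.
have hv : size v = size w by rewrite size_map.
set s1 : store A := upd (upd (input_store v) 1 v) 0 [::].
have e1 : execb true (M (size w)) (@movrev A 0 1) (input_store v) (unit_cost A * (size w).+1) s1.
  have := @execb_movrev A true (M (size w)) 0 1 (input_store v) isT.
  rewrite /input_store upd_same upd_other // size_rev addn0 catrevE revK cats0 hv.
  by apply; exact: leq_addr.
have hs1 : empty_from s1 2 by move=> [|[|i]].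
have hm1 : map s1 [:: 1] = [:: v] by [].
have := hc [:: 1] 2 s1 (size w) (M (size w)) isT hs1.
rewrite hm1 /bound_all /= hv leqnn => /(_ isT (leq_addl _ _)).
rewrite hg andbT => -[_ hsz e2].
set r : seq A := map inr (f w) in hsz e2.
have e3 := @execb_movrev A true (M (size w)) 2 0 (view s1 2 [:: r]) isT.
have f1 : view s1 2 [:: r] 2 = r by rewrite view_at0.
have f2 : view s1 2 [:: r] 0 = [::] by rewrite view_lt.
rewrite f1 f2 addn0 in e3.
have {}e3 := e3 (leq_trans hsz (leq_addl _ _)).
set s3 := upd _ 2 [::] in e3.
have e4 := execb_clear true (M (size w)) 1 s3.
have f3 : s3 1 = v by [].
rewrite f3 hv in e4.
have hfinal : upd s3 1 [::] = input_store r.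
  apply: functional_extensionality => i; rewrite /input_store /s3 /view /s1 /upd /=.
  by case: i => [|[|[|i]]] //=; rewrite nth_nil.
rewrite hfinal in e4.
have [n hn ex] := execb_then e1 (execb_then e2 (execb_then e3 e4)).
have [t ht [hrun _]] := cmd_tm_run acc ex (leq_addr _ _).
exists t; split.
  apply: leq_trans ht (leq_trans _ (hps (size w))); rewrite leq_add2r leq_mul2r.
  apply/orP; right; apply: leq_trans (hn isT) _; rewrite leq_add2l leq_add2l leq_add2r.
  by rewrite leq_mul2l ltnS hsz orbT.
split; first by rewrite hrun.
move=> i _; rewrite hrun /=.
by have := init_tape (@inr Sigma Sigma') c (f w); rewrite -/r => <-.
Qed.

End PolyTime.

(** * Sweeping back after acceptance, and the halting time *)

Section Halting.
Variables (Gamma : finType) (M : TM Gamma) (blank : Gamma).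
Local Notation Q := (tm_state M).
Local Notation Q' := (option (tm_state M)).

(* After acceptance the head walks back to cell 0 in the state [None]. *)
Definition sweep_delta (s : Q') (a : Gamma) : Q' * Gamma * dir :=
  if s is Some q then
    if q == tm_acc M then (None, a, DL) else
    if q == tm_rej M then (Some q, a, DS) else
    let: (q', a', d) := @tm_delta Gamma M q a in (Some q', a', d)
  else (None, a, DL).

Lemma sweep_delta_fin a : sweep_delta None a = (None, a, DL).
Proof. by []. Qed.

Variable ws : seq Gamma.
Local Notation sweepn := (confn sweep_delta (Some (tm_start M)) blank ws).
Local Notation cstep := (cstep sweep_delta).

Definition start_cfg : config M := @Cfg Gamma M (tm_start M) (fun i => nth blank ws i) 0.
Local Notation runM := (run start_cfg).

Definition lift_cfg (c : config M) : conf Q' Gamma := Conf (Some (cf_state c)) (cf_tape c) (cf_head c).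

Lemma lift_step c : ~~ halted c -> cstep (lift_cfg c) = lift_cfg (step c).
Proof.
rewrite /halted negb_or /cstep /step /halted => /andP[h1 h2] /=.
by rewrite (negbTE h1) (negbTE h2) /=; case: (tm_delta _ _) => [[q' a'] d].
Qed.

Lemma sweepn_run t : (forall t', t' < t -> ~~ halted (runM t')) -> sweepn t = lift_cfg (runM t).
Proof.
elim: t => [|t IH] h; first by [].
rewrite /confn iterS -/(sweepn t) IH => [|t' ht']; last by apply: h; lia.
by rewrite lift_step ?h.
Qed.

Variables (S : nat) (th : nat).
Hypothesis hspace : forall t, cf_head (runM t) < S.
Hypothesis hhalt : halted (runM th).
Hypothesis hfirst : forall t, t < th -> ~~ halted (runM t).

Lemma sweepn_halt : sweepn th = lift_cfg (runM th).
Proof. exact: sweepn_run hfirst. Qed.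

Lemma sweepn_add i j : sweepn (i + j) = iter j cstep (sweepn i).
Proof. by rewrite /confn addnC iterD. Qed.

Lemma sweepn_rej : cf_state (runM th) != tm_acc M ->
  forall j, sweepn (th + j) = lift_cfg (runM th).
Proof.
move=> hacc j; rewrite sweepn_add sweepn_halt; elim: j => // j IH; rewrite iterS IH.
move: hhalt; rewrite /halted (negbTE hacc) /= /cstep /= (negbTE hacc) => -> /=.
by congr Conf; apply: functional_extensionality => i; case: eqP => // ->.
Qed.

Lemma sweepn_acc : cf_state (runM th) = tm_acc M ->
  forall j, sweepn (th + j.+1) = Conf None (cf_tape (runM th)) (cf_head (runM th) - j.+1).
Proof.
have hsame (f : nat -> Gamma) h : (fun i => if i == h then f h else f i) = f.
  by apply: functional_extensionality => i; case: eqP => // ->.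
move=> hacc j; rewrite sweepn_add sweepn_halt; elim: j => [|j IH].
  by rewrite /= /cstep /= hacc eqxx hsame subn1.
by rewrite iterS IH /cstep /= hsame !subnS.
Qed.

Lemma sweep_reaches : (exists i, cstate (sweepn i) = None) <-> cf_state (runM th) = tm_acc M.
Proof.
split; last by move=> h; exists (th + 1); rewrite sweepn_acc.
move=> [i hi]; apply/eqP; apply: contraT => hacc.
case: (leqP i th) => h.
  by move: hi; rewrite sweepn_run // => t' ht'; apply: hfirst; lia.
by move: hi; rewrite -(subnKC (ltnW h)) sweepn_rej.
Qed.

Lemma sweep_head i : chead (sweepn i) < S.
Proof.
case: (leqP i th) => h.
  rewrite sweepn_run; first exact: hspace.
  by move=> t' ht'; apply: hfirst; lia.
have hS := hspace th; rewrite -(subnKC h) addSnnS.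
case: (cf_state (runM th) =P tm_acc M) => [ha|/eqP ha]; first by rewrite sweepn_acc //=; lia.
by rewrite sweepn_rej //; exact: hspace.
Qed.

Lemma sweep_end i : cf_state (runM th) = tm_acc M -> th + S <= i ->
  cstate (sweepn i) = None /\ chead (sweepn i) = 0.
Proof.
move=> ha hi; have hS := hspace th.
rewrite (_ : i = th + (i - th).-1.+1) ?sweepn_acc //=; last by lia.
by split=> //; lia.
Qed.

Lemma tape_beyond t j : S <= j -> cf_tape (runM t) j = nth blank ws j.
Proof.
move=> hj; elim: t => // t IH; rewrite /run iterS -/(runM t) /step; case: ifP => // _.
have := hspace t; case: (tm_delta _ _) => [[q' a'] d] /= h.
by case: eqP => // e; lia.
Qed.

(* A run that repeats a configuration never halts. *)
Lemma halting_time : th <= #|Q| * S * #|Gamma| ^ S.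
Proof.
pose key (t : 'I_th) : Q * 'I_S * {ffun 'I_S -> Gamma} :=
  (cf_state (runM t), Ordinal (hspace t), [ffun j : 'I_S => cf_tape (runM t) j]).
have same s t (hs : s < th) (ht : t < th) : key (Ordinal hs) = key (Ordinal ht) -> runM s = runM t.
  move=> [h1 h2 h3]; have h4 : cf_tape (runM s) = cf_tape (runM t).
    apply: functional_extensionality => j; case: (ltnP j S) => hj; last by rewrite !tape_beyond.
    by have := congr1 (fun g : {ffun 'I_S -> Gamma} => g (Ordinal hj)) h3; rewrite !ffunE.
  by case: (runM s) (runM t) h1 h2 h4 => [q1 t1 k1] [q2 t2 k2] /= -> -> ->.
have loop s t : s < t -> t < th -> runM s = runM t -> False.
  move=> hst ht e; have hper d : runM (s + d) = runM (t + d).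
    by rewrite !(@run_add _ M) e.
  have : ~~ halted (runM (s + (th - t))) by apply: hfirst; lia.
  by rewrite hper subnKC ?(ltnW ht) // hhalt.
have key_inj : injective key.
  move=> [s hs] [t ht] /same e; apply: val_inj => /=; case: (ltngtP s t) => // h.
    by case: (loop s t h ht e).
  by case: (loop t s h hs (esym e)).
have := leq_card key key_inj; rewrite card_ord !card_prod card_ord card_ffun card_ord.
by [].
Qed.

End Halting.

(** Enlarging the argument by a constant makes the width exceed any fixed multiple of the space. *)
Lemma expk_addn k a b : 0 < k -> 2 ^ b * expk k a <= expk k (a + b).
Proof.
case: k => // k _; have hlin m : expk m a + b <= expk m (a + b).
  elim: m => // m IH /=; apply: leq_trans (_ : 2 ^ (expk m a + b) <= _); last by rewrite leq_exp2l.
  rewrite expnD; have h1 : 0 < 2 ^ expk m a by rewrite expn_gt0.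
  have h2 := ltn_expl b (isT : 1 < 2); nia.
by rewrite /= -expnD leq_exp2l // addnC.
Qed.

(** The product counts configurations with [q] states, [g] letters and [S] cells; the summand [S]
    pays for the sweep to cell 0, and 4 leaves room for the rows that perform no step. Each part is
    below a power of two with exponent linear in [S]. *)
Lemma time_bound q g S W : 0 < S -> (g + q + 6) * S <= W -> q * S * g ^ S + S + 4 <= 2 ^ W.
Proof.
move=> S0 hW; have hq := ltn_expl q (isT : 1 < 2); have hS := ltn_expl S (isT : 1 < 2).
have hg : g ^ S <= 2 ^ (g * S).
  by rewrite expnM; case: (S) => // S'; rewrite leq_exp2r // ltnW // ltn_expl.
have h1 : q * S * g ^ S <= 2 ^ (q + S + g * S).
  by rewrite !expnD leq_mul // leq_mul // ltnW.
have h2 : S + 4 <= 2 ^ (S + 3).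
  by rewrite expnD; lia.
apply: leq_trans (_ : 2 ^ ((q + S + g * S) + 3).+1 <= _).
  rewrite expnS mul2n -addnn -addnA leq_add //.
    by apply: leq_trans h1 _; rewrite leq_exp2l // leq_addr.
  by apply: leq_trans h2 _; rewrite leq_exp2l // leq_add2r -addnA addnCA leq_addr.
by rewrite leq_exp2l //; nia.
Qed.

Lemma bin_exp2 a : bin (2 ^ a) = b1 :: nseq a b0.
Proof.
elim: a => [|a IH]; first by rewrite bin_small.
have h : 1 < 2 ^ a.+1 by rewrite -{1}(expn0 2) ltn_exp2l.
rewrite bin_rec // expnS mul2n doubleK odd_double IH /=.
by congr (_ :: _); elim: a {IH h} => //= a ->.
Qed.

(** * Writing the instance in polynomial time *)

Section ReductionString.
Variables (Sigma Gamma Q : finType) (inj : Sigma -> Gamma).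
Variables (delta : Q -> Gamma -> Q * Gamma * dir) (fin q0 : Q) (blank : Gamma).
Variables (p : seq nat) (c : nat).
Local Notation A := (Sigma + 'I_4)%type.
Local Notation str := (seq A).
Local Notation env := (seq str).
Local Notation C := (@C A true).
Local Notation R := (map (@inr Sigma 'I_4)).
Local Notation tiles w := (tileset delta fin blank q0 (map inj w)).
Local Notation width w := (peval p (size w) + (size w + c)).

Definition reduction (w : seq Sigma) : seq 'I_4 := encode (width w) (tiles w) (tile00 Q Gamma).

(** Horner's scheme in unary: concatenation adds and repetition multiplies. *)
Fixpoint mark_str (cs : seq nat) (e : env) : str :=
  if cs is m :: cs' then nseq m (inr s_mark) ++ flatten (nseq (size (nth [::] e 0)) (mark_str cs' e))
  else [::].

Lemma C_mark_str cs : C (mark_str cs).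
Proof.
elim: cs => [|m cs IH] /=; first exact: C_const.
by apply: C_cat; [exact: C_const|apply: C_repeat => //; exact: C_var].
Qed.

Lemma mark_strE cs e : mark_str cs e = nseq (peval cs (size (nth [::] e 0))) (inr s_mark).
Proof.
elim: cs => //= m cs ->; rewrite nseqD; congr (_ ++ _).
move: (peval cs _) => d; by elim: (size _) => //= n ->; rewrite mulSn nseqD.
Qed.

Local Notation K := (#|{: fcol Q Gamma}|.+1).

(** The string [l], turned letter by letter into zeros, supplies the variable part of the code of
    label [size l]. *)
Definition inum_str (l : str) : str := R (b1 :: nseq K b0) ++ map (fun _ => inr b0) l.

Lemma inum_strE (l : str) : inum_str l = R (bin (inum Q Gamma (size l))).
Proof.
rewrite /inum_str /inum bin_exp2 nseqD -cat_cons map_cat; congr (_ ++ _).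
by elim: l => //= a l ->.
Qed.

Lemma C_inum f : C f -> C (fun e => inum_str (f e)).
Proof. by move=> hf; rewrite /inum_str; apply: C_cat; [exact: C_const|apply: C_map]. Qed.

Definition tile_str (ls rs : str) (b : fcol Q Gamma) : str :=
  inr s_sharp :: ls ++ R (s_mark :: bin (fnum (FW Q Gamma)) ++ [:: s_mark]) ++ rs ++ R (s_mark :: bin (fnum b)).

Lemma tile_strE l r b : tile_str (R (bin l)) (R (bin r)) b = R (s_sharp :: enc_tile (itile l r b)).
Proof. by rewrite /tile_str /enc_tile /tleft /ttop /tright /= !(map_cat, map_cons) -!catA. Qed.

Lemma C_tile_str f g b : C f -> C g -> C (fun e => tile_str (f e) (g e) b).
Proof.
move=> hf hg; rewrite /tile_str; apply: C_push; apply: C_cat => //; apply: C_cat; first exact: C_const.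
by apply: C_cat => //; exact: C_const.
Qed.

Definition tape_letter (a : A) : Gamma := if a is inl x then inj x else blank.

Definition chain_tile_str (a : A) (e : env) : str :=
  tile_str (inum_str (nth [::] e 1)) (inum_str (behead (nth [::] e 1))) (FV true (false, tape_letter a, None)).

(** The label of a tile is the number of letters still unread, and [floop] hands that unread part to
    its body. *)
Definition chain_str (l : str) (acc : str) (e : env) : str :=
  floop (fun a e => nth [::] e 0 ++ chain_tile_str a e) e l acc.

Local Notation flat T := (flatten [seq s_sharp :: enc_tile t | t <- T]).

Let flat_cat (T1 T2 : seq tile) : flat (T1 ++ T2) = flat T1 ++ flat T2.
Proof. by rewrite map_cat flatten_cat. Qed.

Lemma chain_strE (w : seq Sigma) acc e :
  chain_str (map inl w) acc e = acc ++ R (flat (chain_tiles Q (map inj w))).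
Proof.
rewrite /chain_str; elim: w acc => [|x w IH] acc; first by rewrite cats0.
by rewrite /= IH /chain_tile_str /= !inum_strE tile_strE /= !size_map -catA !map_cat.
Qed.

Lemma C_chain f : C f -> C (fun e => chain_str (f e) [::] e).
Proof.
move=> hf; pose m := \max_(a : A) size (bin (fnum (FV (Q := Q) true (false, tape_letter a, None)))).
apply: (@C_floop _ _ _ _ _ (fun L => 2 * L + (2 * (K + 1) + (size (bin (fnum (FW Q Gamma))) + 4) + m))) => //.
- by polyb.
- exact: C_const.
- move=> a; apply: C_cat; first exact: C_var.
  by apply: C_tile_str; apply: C_inum; [exact: C_var|apply: C_behead; exact: C_var].
move=> a acc l e L; rewrite /= => /andP[hl _]; rewrite size_cat leq_add2l /chain_tile_str /tile_str /inum_str /=.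
have h : size (bin (fnum (FV (Q := Q) true (false, tape_letter a, None)))) <= m.
  by rewrite /m (bigD1 a) //= leq_maxl.
by do 4!rewrite ?(size_cat, size_map, size_nseq, size_behead) /=; move: hl h; rewrite -/m; set x := size l; set y := size (bin _); lia.
Qed.

Definition first_str (e : env) : str :=
  let rs := inum_str (behead (nth [::] e 0)) in let ls := R (bin (fnum (FZl Q Gamma))) in
  if nth [::] e 0 is a :: _ then tile_str ls rs (FV true (true, tape_letter a, Some q0))
  else tile_str ls rs (FV true (true, blank, Some q0)).

Lemma C_first : C first_str.
Proof.
have hv : C (fun e => nth [::] e 0) by exact: C_var.
have hr : C (fun e => inum_str (behead (nth [::] e 0))) by apply: C_inum; apply: C_behead.
apply: (@C_caseA _ _ (fun e => nth [::] e 0)) => // [a|]; (apply: C_tile_str => //; exact: C_const).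
Qed.

Lemma first_strE (w : seq Sigma) e :
  first_str (map inl w :: e) = R (s_sharp :: enc_tile (first_tile blank q0 (map inj w))).
Proof. by rewrite /first_str /=; case: w => [|x w] /=; rewrite inum_strE tile_strE /first_tile /= ?size_map. Qed.

Definition fixed_str : str :=
  R (s_sharp :: enc_tile (tile00 Q Gamma) ++ flat (blank_tiles Q blank ++ ftiles delta fin blank)).

Lemma reduction_poly_time : poly_time_computable reduction.
Proof.
apply: (@poly_time_intro _ _ _ (fun e => mark_str p e ++ (map (fun _ => inr s_mark) (nth [::] e 0) ++
  nseq c (inr s_mark)) ++ fixed_str ++ first_str e ++ chain_str (behead (nth [::] e 0)) [::] e)).
  have hv : C (fun e => nth [::] e 0) by exact: C_var.
  apply: C_cat; first exact: C_mark_str.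
  apply: C_cat; first by apply: C_cat; [apply: C_map|exact: C_const].
  apply: C_cat; first exact: C_const.
  by apply: C_cat; [exact: C_first|apply: C_chain; apply: C_behead].
move=> w; rewrite mark_strE first_strE (behead_map inl w) chain_strE !size_map.
have -> : reduction w = nseq (width w) s_mark ++ (s_sharp :: enc_tile (tile00 Q Gamma) ++
    flat (blank_tiles Q blank ++ ftiles delta fin blank)) ++
    (s_sharp :: enc_tile (first_tile blank q0 (map inj w))) ++ flat (chain_tiles Q (map inj (behead w))).
  by rewrite /reduction /encode /tileset catA flat_cat behead_map [in RHS]cat_cons -[in RHS](catA (enc_tile _)).
rewrite !map_cat -/fixed_str cat0s !nseqD !map_cat !map_nseq -!catA; congr (_ ++ (_ ++ _)).
by elim: w => //= x w ->.
Qed.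

End ReductionString.

(** One map serves both problems, hence the asymmetry: acceptance yields the prescribed height,
    while a tiling of any positive height yields acceptance. *)
Lemma tiling_reduction k (Sigma : finType) (L : seq Sigma -> Prop) : 0 < k -> in_kEXPSPACE k L ->
  exists2 f : seq Sigma -> seq 'I_4, poly_time_computable f &
  forall w, exists n T t0, [/\ f w = encode n T t0, deterministic T,
    L w -> exists tau, is_tiling T (expk k.+1 n) (expk k n) tau /\ tau 1 1 = t0 &
    forall H tau, 0 < H -> is_tiling T H (expk k n) tau -> tau 1 1 = t0 -> L w].
Proof.
move=> k0 [Gamma [blank [inj [M [p [_ hdec]]]]]].
(* [c] is chosen so that [W] exceeds the logarithm of the halting time by enough rows
   for the head to return to cell 0; the width also has to exceed the space bound. *)
pose g := #|Gamma|; pose q := #|tm_state M|; pose c := g + q + 6.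
pose delta := @sweep_delta Gamma M.
exists (reduction inj delta None (Some (tm_start M)) blank p c); first exact: reduction_poly_time.
move=> w; have [hspace [t0 [ht0 hL]]] := hdec w.
pose n := size w; pose N := peval p n + (n + c); pose S := expk k (peval p n); pose W := expk k N.
exists N, (tileset delta None blank (Some (tm_start M)) (map inj w)), (tile00 (option (tm_state M)) Gamma).
have {}hspace t : cf_head (run (init blank inj M w) t) < S by exact: hspace.
have S0 : 0 < S by apply: leq_ltn_trans (hspace 0).
have hW : c * S <= W.
  apply: leq_trans (_ : 2 ^ c * S <= _); first by rewrite leq_mul2r (ltnW (ltn_expl c (isT : 1 < 2))) orbT.
  apply: leq_trans (expk_addn (peval p n) c k0) _; apply: leq_expk.
  by rewrite /N leq_add2l leq_addl.
have S6 : 6 * S <= W by apply: leq_trans hW; rewrite leq_mul2r leq_addl orbT.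
have W0 : 0 < W by lia.
have WN : N <= W by exact: expk_ge.
have hhalt : exists t, halted (run (init blank inj M w) t) by exists t0.
have [th hth hmin] := ex_minnP hhalt.
have hfirst t : t < th -> ~~ halted (run (init blank inj M w) t).
  by move=> ht; apply/negP => /hmin; rewrite leqNgt ht.
(* The time [t0] may lie after the first halting time [th], but a halted configuration no longer
   changes. *)
have same : cf_state (run (init blank inj M w) th) = tm_acc M <-> L w.
  have <- : run (init blank inj M w) t0 = run (init blank inj M w) th by rewrite -{1}(subnKC (hmin _ ht0)) run_add run_halted.
  exact: hL.
have time := @halting_time Gamma M blank (map inj w) S th hspace hth hfirst.
have bound : th + S + 4 <= 2 ^ W.
  by apply: leq_trans (time_bound S0 hW); rewrite !leq_add2r.
split=> //; first exact: tileset_deterministic.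
  move/same => hacc; exists (full_tiling delta (Some (tm_start M)) blank (map inj w) (2 ^ W) W).
  apply: full_tiling_ok; rewrite ?size_map.
  - exact: sweep_delta_fin.
  - by rewrite oddX orbF -lt0n.
  - by apply: leq_trans bound; rewrite addn4.
  - by apply: leq_trans WN; rewrite /N /c; lia.
  - move=> i; apply: leq_trans (sweep_head hspace hth hfirst i) _.
    by lia.
  by apply: (sweep_end hspace hth hfirst hacc); rewrite -[expk k.+1 N]/(2 ^ W); move: (2 ^ W) bound => x; lia.
move=> H tau H0 htau h1; apply/same.
apply: (proj1 (@sweep_reaches Gamma M blank (map inj w) th hth hfirst)).
by apply: (tiling_reaches_fin H0 W0); exists tau.
Qed.

Theorem theorem15 (k : nat) (hk : 1 <= k) :
  kEXPSPACE_complete k (lang (detTILING (fun n => expk k.+1 n) (fun n => expk k n))) /\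
  kEXPSPACE_complete k (lang (detTILING_star (fun n => expk k n))).
Proof.
split; split; [exact: detTILING_in_kEXPSPACE| |exact: detTILING_star_in_kEXPSPACE|];
  move=> Sigma L /(tiling_reduction hk)[f hf hL]; exists f; split=> // w;
  have [n [T [t0 [-> hdet hto hfrom]]]] := hL w; split.
- by move=> /hto htau; exists n, T, t0.
(* [lang] quantifies over all instances with the given code; injectivity of [encode] identifies them
   with the constructed one. *)
- move=> [n' [T' [t' [/encode_inj[<- <- <-] [_ [tau [h1 h2]]]]]]].
  by apply: hfrom h1 h2; rewrite /= expn_gt0.
- by move=> /hto [tau [h1 h2]]; exists n, T, t0; split=> //; split=> //;
    exists (expk k.+1 n), tau; split=> //; rewrite /= expn_gt0.
move=> [n' [T' [t' [/encode_inj[<- <- <-] [_ [H [tau [h0 [h1 h2]]]]]]]]].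
exact: hfrom h0 h1 h2.
Qed.
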